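(* Let $k$ be a field of characteristic $0$. Let $(R,M)$ be the local ring of a curve over $k$ (the localization at a maximal ideal of a reduced finitely generated $k$-algebra of pure dimension one), and let $S$ be the normalization (integral closure of $R$ in its total ring of fractions). Suppose $M^3S\subseteq R$. If $R$ is not regular, then the torsion submodule of $\Omega_{R/k}$ is nonzero. *)

(* Defs.v *)
From HB Require Import structures.
From mathcomp Require Import all_boot all_order all_algebra.
Set Implicit Arguments. Unset Strict Implicit. Unset Printing Implicit Defensive.
Import Order.TTheory GRing.Theory Num.Theory.
Local Open Scope ring_scope.

Definition pset (T : Type) := T -> Prop.

Section Ideals.
Variable A : comNzRingType.

Definition is_ideal (I : pset A) : Prop :=
  I 0 /\ (forall x y, I x -> I y -> I (x + y)) /\ (forall r x, I x -> I (r * x)).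

Definition is_proper_ideal (I : pset A) : Prop := is_ideal I /\ ~ I 1.

Definition is_prime_ideal (P : pset A) : Prop :=
  is_proper_ideal P /\ (forall a b, P (a * b) -> P a \/ P b).

Definition is_maximal_ideal (m : pset A) : Prop :=
  is_proper_ideal m /\
  (forall J : pset A, is_proper_ideal J -> (forall x, m x -> J x) ->
     forall x, J x -> m x).

Definition strict_sub (P Q : pset A) : Prop :=
  (forall x, P x -> Q x) /\ exists x, Q x /\ ~ P x.

Definition prime_chain (n : nat) (c : nat -> pset A) : Prop :=
  (forall i, (i <= n)%N -> is_prime_ideal (c i)) /\
  (forall i, (i < n)%N -> strict_sub (c i) (c i.+1)).

Definition is_minimal_prime (P : pset A) : Prop :=
  is_prime_ideal P /\ ~ exists Q, is_prime_ideal Q /\ strict_sub Q P.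

Definition krull_dim_eq (n : nat) : Prop :=
  (exists c, prime_chain n c) /\ ~ (exists c, prime_chain n.+1 c).

(* dim (A/P) = n, via the correspondence of primes of A/P with the
   primes of A containing P *)
Definition dim_quot_eq (P : pset A) (n : nat) : Prop :=
  (exists c, prime_chain n c /\ c 0%N = P) /\
  ~ (exists c, prime_chain n.+1 c /\ c 0%N = P).

Definition reduced : Prop := forall (a : A) (n : nat), a ^+ n = 0 -> a = 0.

Definition pure_dim_one : Prop :=
  forall P, is_minimal_prime P -> dim_quot_eq P 1.

Definition nonzerodivisor (r : A) : Prop := forall x, r * x = 0 -> x = 0.

End Ideals.

Definition fin_gen_alg (k : fieldType) (A : comAlgType k) : Prop :=
  exists s : seq A, forall S : pset A,
    (forall c : k, S (c%:A)) -> (forall x, x \in s -> S x) ->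
    (forall x y, S x -> S y -> S (x + y)) ->
    (forall x y, S x -> S y -> S (x * y)) -> forall a, S a.

Definition kalg_hom (k : fieldType) (A B : comAlgType k) (f : A -> B) : Prop :=
  (forall x y, f (x + y) = f x + f y) /\ (forall x y, f (x * y) = f x * f y) /\
  f 1 = 1 /\ (forall (c : k) x, f (c *: x) = c *: f x).

Definition is_localization_at (k : fieldType) (A : comAlgType k)
    (R : comUnitAlgType k) (m : pset A) (phi : A -> R) : Prop :=
  kalg_hom (phi : A -> (R : comAlgType k)) /\
  (forall s, ~ m s -> phi s \is a GRing.unit) /\
  (forall r : R, exists a s, ~ m s /\ r = phi a / phi s) /\
  (forall a, phi a = 0 -> exists s, ~ m s /\ s * a = 0).

Definition is_total_fractions (R Q : comUnitRingType) (iota : R -> Q) : Prop :=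
  (forall x y, iota (x + y) = iota x + iota y) /\
  (forall x y, iota (x * y) = iota x * iota y) /\ iota 1 = 1 /\
  (forall s, nonzerodivisor s -> iota s \is a GRing.unit) /\
  (forall q : Q, exists a s, nonzerodivisor s /\ q = iota a / iota s) /\
  (forall a, iota a = 0 -> a = 0).

Definition integral_over (R Q : comUnitRingType) (iota : R -> Q) (q : Q) : Prop :=
  exists p : {poly R}, p \is monic /\ (map_poly iota p).[q] = 0.

(* M^3 S ⊆ R, stated on the generators m1 m2 m3 s of the R-module M^3 S *)
Definition cube_conductor (R Q : comUnitRingType) (iota : R -> Q) (M : pset R) :=
  forall m1 m2 m3 q, M m1 -> M m2 -> M m3 -> integral_over iota q ->
    exists r, iota (m1 * m2 * m3) * q = iota r.

Definition max_ideal (R : comUnitRingType) : pset R :=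
  fun r => r \isn't a GRing.unit.

Definition regular_local (R : comUnitRingType) : Prop :=
  exists n, krull_dim_eq R n /\
    exists g : 'I_n -> R, forall x,
      max_ideal x <-> exists c : 'I_n -> R, x = \sum_(i < n) c i * g i.

Definition is_kderivation (k : fieldType) (R : comUnitAlgType k)
    (N : lmodType R) (D : R -> N) : Prop :=
  (forall a b, D (a + b) = D a + D b) /\
  (forall a b, D (a * b) = a *: D b + b *: D a) /\
  (forall (c : k) a, D (c *: a) = (c%:A : R) *: D a).

Definition R_linear (R : comUnitRingType) (N1 N2 : lmodType R) (f : N1 -> N2) :=
  forall (a : R) x y, f (a *: x + y) = a *: f x + f y.

Definition is_kaehler (k : fieldType) (R : comUnitAlgType k)
    (Om : lmodType R) (d : R -> Om) : Prop :=
  is_kderivation d /\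
  forall (N : lmodType R) (D : R -> N), is_kderivation D ->
    exists f : Om -> N, R_linear f /\ (forall r, f (d r) = D r) /\
      forall g : Om -> N, R_linear g -> (forall r, g (d r) = D r) ->
        forall w, g w = f w.

Definition torsion_nonzero (R : comUnitRingType) (N : lmodType R) : Prop :=
  exists w : N, w <> 0 /\ exists r : R, nonzerodivisor r /\ r *: w = 0.

(* Main.v *)
(* Choose a nonzerodivisor x in M with M S = x S.  The k-derivation D = x d/dx of Q
   preserves S: for a suitable N, it acts with the weight j / N on the graded pieces
   of the filtration of Q by the sets {s | s^N in x^j S}.  Hence D is injective on
   x S / x^n S, and x^3 S = D (x^3 S) + x^5 S.

   Suppose that Omega is torsion free.  Then sum a_i d b_i = 0 as soon as
   sum a_i D b_i = 0 in Q.  Since x^3 S lies in R, every form with sum a_i D b_i in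
   x^3 S therefore equals d i + i' d x with i in x^3 S and i' in x^4 S.  If R is not
   regular, there is y in M outside x R + M^2; put c = y / x.  When D c lies in x S
   the form x dy - y dx is of this kind, and otherwise x^2 dy is; in either case an
   explicit functional killing every d i and every i' d x takes the value 2,
   respectively 2 D c modulo x S, on it: a contradiction. *)
Require Import Defs.
From HB Require Import structures.
From mathcomp Require Import all_boot all_order all_algebra.
From mathcomp Require Import separable ring_quotient.
From mathcomp Require Import boolp classical_sets.
From mathcomp Require Import zify ring.
Set Implicit Arguments. Unset Strict Implicit. Unset Printing Implicit Defensive.
Import GRing.Theory.
Local Open Scope ring_scope.

(** The ring Q need not be a field and k need not be algebraically closed, so branches, uniformizers
    and completions are avoided: integrality over R takes the place of valuations. The condition
    that s^N lies in x^j S bounds the order of s against that of x at all branches at once. Every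
    element of Q satisfies a relation of degree at most dd over k(x), and N = dd! is then divisible
    by all ramification indices, so that no order falls strictly between two steps of the
    filtration.

    That D preserves S is not proved directly. Its poles on S are bounded, because A is finitely
    generated and x^3 S lies in R; any such bound can be improved by one step of the filtration,
    until D - j / N is seen to raise the filtration.

    The equality M S = x S comes from a generic combination of generators of M, which generates a
    reduction of M. The exponent 5 in x^3 S = D (x^3 S) + x^5 S makes i' the product of x and an
    element of M, hence an element of M^2, on which the functional for x dy - y dx vanishes. *)

(** * Zorn's lemma and the existence of prime ideals *)

Lemma pset_zorn (T : Type) (P : pset (pset T)) (I0 : pset T) :
  P I0 ->
  (forall F : pset (pset T), (exists X, F X) -> (forall X, F X -> P X) ->
     (forall X, F X -> forall t, I0 t -> X t) ->
     (forall X Y, F X -> F Y ->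
        (forall t, X t -> Y t) \/ (forall t, Y t -> X t)) ->
     P (fun t => exists2 X, F X & X t)) ->
  exists J, [/\ P J, forall t, I0 t -> J t &
    forall K, P K -> (forall t, J t -> K t) -> forall t, K t -> J t].
Proof.
move=> PI0 Pchain.
(* [Zorn_bigcup] also covers the empty chain; adjoining [I0] to every set turns the empty union into
   [I0], which satisfies [P]. *)
pose U (X : set T) : set T := fun t => X t \/ I0 t.
have [|A [PA Amax]] := @Zorn_bigcup T (fun X => P (U X)).
  move=> F FP Ftot.
  have [[X0 FX0]|F0] := pselect (exists X, F X); last first.
    suff -> : U (\bigcup_(X in F) X)%classic = I0 by [].
    apply/predeqP => t; split; last by right.
    by case=> // -[X FX _]; case: F0; exists X.
  pose F' : pset (pset T) := fun Y => exists2 X, F X & Y = U X.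
  suff -> : U (\bigcup_(X in F) X)%classic = (fun t => exists2 X, F' X & X t).
    apply: Pchain.
    - by exists (U X0), X0.
    - by move=> _ [X FX ->]; apply: FP.
    - by move=> _ [X FX ->] t It; right.
    - move=> _ _ [X FX ->] [Y FY ->].
      by have [XY|YX] := Ftot _ _ FX FY; [left|right] => t [Xt|]; [left; auto|right|left; auto|right].
  apply/predeqP => t; split.
    case=> [[X FX Xt]|It]; last by exists (U X0); [exists X0|right].
    by exists (U X); [exists X|left].
  by case=> _ [X FX ->] [Xt|It]; [left; exists X|right].
exists (U A); split=> // [t It|K PK AK t Kt]; first by right.
have [//|nUA] := pselect (U A t).
have AsubK : (A `<` K)%classic.
  split; first by move=> s As; apply: AK; left.
  by move=> KA; apply: nUA; left; apply: KA.
case: (Amax _ AsubK); suff -> : U K = K by [].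
by apply/predeqP => s; split; [case=> // Is; apply: AK; right|left].
Qed.

Section PrimeIdeals.
Variable A : comNzRingType.
Implicit Types (I J P : pset A).

Lemma is_idealB I x y : is_ideal I -> I x -> I y -> I (x - y).
Proof.
by case=> _ [Iadd Imul] Ix Iy; apply: Iadd; rewrite // -mulN1r; apply: Imul.
Qed.

Lemma is_ideal_sum I (T : Type) (r : seq T) (Q : pred T) (f : T -> A) :
  is_ideal I -> (forall i, Q i -> I (f i)) -> I (\sum_(i <- r | Q i) f i).
Proof. by case=> I0 [Iadd _] If; elim/big_ind: _ => //. Qed.

Definition ideal_adjoin I (a : A) : pset A :=
  fun z => exists b c, I b /\ z = b + c * a.

Lemma ideal_adjoin_ideal I a : is_ideal I -> is_ideal (ideal_adjoin I a).
Proof.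
case=> I0 [Iadd Imul]; split; first by exists 0, 0; rewrite mul0r addr0.
split=> [_ _ [b [c [Ib ->]]] [b' [c' [Ib' ->]]]|r _ [b [c [Ib ->]]]].
  by exists (b + b'), (c + c'); split; [apply: Iadd|ring].
by exists (r * b), (r * c); split; [apply: Imul|ring].
Qed.

Lemma ideal_adjoin_sub I a x : I x -> ideal_adjoin I a x.
Proof. by move=> Ix; exists x, 0; rewrite mul0r addr0. Qed.

Lemma ideal_adjoin_mem I a : is_ideal I -> ideal_adjoin I a a.
Proof. by case=> I0 _; exists 0, 1; rewrite mul1r add0r. Qed.

Lemma chain_union_ideal (F : pset (pset A)) :
  (exists X, F X) -> (forall X, F X -> is_ideal X) ->
  (forall X Y, F X -> F Y ->
     (forall t, X t -> Y t) \/ (forall t, Y t -> X t)) ->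
  is_ideal (fun t => exists2 X, F X & X t).
Proof.
move=> [X0 FX0] Fid Ftot; split; first by exists X0 => //; case: (Fid _ FX0).
split=> [x y [X FX Xx] [Y FY Yy]|r x [X FX Xx]].
  have [XY|YX] := Ftot _ _ FX FY.
    by exists Y => //; have [_ [Yadd _]] := Fid _ FY; apply: Yadd => //; apply: XY.
  by exists X => //; have [_ [Xadd _]] := Fid _ FX; apply: Xadd => //; apply: YX.
by exists X => //; have [_ [_ Xmul]] := Fid _ FX; apply: Xmul.
Qed.

(** An ideal maximal among those that contain [I] and are disjoint from [T] is prime: if it
    contained a b but neither factor, adjoining a and b in turn would give two elements of [T],
    whose product would lie in the ideal. *)
Lemma prime_avoiding I (T : pset A) :
  is_ideal I -> T 1 -> (forall a b, T a -> T b -> T (a * b)) ->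
  (forall a, I a -> ~ T a) ->
  exists P, [/\ is_prime_ideal P, forall a, I a -> P a &
    forall a, P a -> ~ T a].
Proof.
move=> Iid T1 TM IT.
have [||P [[Pid PT] IP Pmax]] :=
  @pset_zorn A (fun J => is_ideal J /\ forall a, J a -> ~ T a) I.
- by split.
- move=> F Fne FP _ Ftot; split.
    by apply: chain_union_ideal => // X /FP[].
  by move=> a [X /FP[_ XT] Xa]; apply: XT.
have meetT a : ~ P a -> exists b c t, [/\ P b, T t & t = b + c * a].
  move=> nPa; apply: contrapT => nT; apply: nPa.
  apply: (Pmax (ideal_adjoin P a)); last exact: ideal_adjoin_mem.
    split; first exact: ideal_adjoin_ideal.
    by move=> _ [b [c [Pb ->]]] Tt; apply: nT; exists b, c, (b + c * a).
  by move=> t Pt; apply: ideal_adjoin_sub.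
exists P; split=> //; split; first by split=> // P1; apply: (PT 1).
move=> a b Pab; apply: contrapT => /not_orP[nPa nPb].
have [b1 [c1 [t1 [Pb1 Tt1 e1]]]] := meetT a nPa.
have [b2 [c2 [t2 [Pb2 Tt2 e2]]]] := meetT b nPb.
apply: (PT (t1 * t2)); last exact: TM.
have [P0 [Padd Pmul]] := Pid.
have -> : t1 * t2 = (b2 + c2 * b) * b1 + (c1 * a) * b2 + c1 * c2 * (a * b).
  by rewrite e1 e2; ring.
by apply: (Padd); [apply: (Padd)|]; apply: Pmul.
Qed.

(** Zorn's lemma is applied to complements, so that unions of chains become intersections of
    primes. *)
Lemma minimal_prime_below P : is_prime_ideal P ->
  exists P0, is_minimal_prime P0 /\ forall a, P0 a -> P a.
Proof.
move=> Ppr; pose co (X : pset A) : pset A := fun a => ~ X a.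
have coK X : co (co X) = X by apply/predeqP => a; rewrite /co notK.
have [||J [Jpr cPJ Jmax]] := @pset_zorn A (fun X => is_prime_ideal (co X)) (co P).
- by rewrite coK.
- move=> F [X0 FX0] FP cPF Ftot.
  have E a : co (fun t => exists2 X, F X & X t) a <-> forall X, F X -> ~ X a.
    by split=> [h X FX Xa|h [X FX /h]]; [apply: h; exists X|apply].
  split; first split; first split.
  - by apply/E => X FX; have [[[h _] _] _] := FP _ FX.
  - split=> [x y /E hx /E hy|r x /E hx]; apply/E => X FX; have [[[_ [ha hm]] _] _] := FP _ FX.
      by apply: ha; [apply: hx|apply: hy].
    by apply: hm; apply: hx.
  - by move=> /E /(_ _ FX0) h1; have [[_ h] _] := FP _ FX0; apply: h.
  move=> a b /E hab; apply: contrapT => /not_orP[].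
  move=> /E /existsNP[X /not_implyP[FX /contrapT Xa]] /E /existsNP[Y /not_implyP[FY /contrapT Yb]].
  have pr Z : F Z -> Z a -> Z b -> False.
    by move=> FZ Za Zb; have [_ /(_ _ _ (hab _ FZ)) []] := FP _ FZ.
  have [XY|YX] := Ftot _ _ FX FY; first by apply: (pr Y) => //; apply: XY.
  by apply: (pr X) => //; apply: YX.
exists (co J); split; last by move=> a Ja; apply: contrapT => /cPJ.
split=> // -[Q [Qpr [QJ [x [cJx nQx]]]]].
apply: cJx; apply: (Jmax (co Q)); rewrite ?coK //.
by move=> t Jt Qt; apply: (QJ t).
Qed.

Lemma maximal_ideal_prime P : is_maximal_ideal P -> is_prime_ideal P.
Proof.
move=> [[Pid P1] Pmax].
have [||||Q [Qpr PQ _]] := @prime_avoiding P (fun a => a = 1); rewrite ?mulr1 //.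
- by move=> a b -> ->; rewrite mulr1.
- by move=> a Pa a1; apply: P1; rewrite -a1.
suff -> : P = Q by [].
by apply/predeqP => a; split; [apply: PQ|apply: Pmax => //; case: Qpr].
Qed.

End PrimeIdeals.

(** * Quotients by a prime ideal *)

Section PrimeQuotient.
Variables (A : comNzRingType) (P : pset A).
Hypothesis Ppr : is_prime_ideal P.

(** The proof of primality is an argument so that the ideal structures declared below can be
    inferred from the predicate itself. *)
Definition prime_pred (_ : is_prime_ideal P) : {pred A} := fun a => `[< P a >].

Fact prime_pred_ideal : idealr_closed (prime_pred Ppr).
Proof.
have [[[P0 [Padd Pmul]] P1] _] := Ppr.
split; rewrite /in_mem /=; [exact: asboolT|exact/asboolP|].
by move=> a x y /asboolP Px /asboolP Py; apply/asboolP/Padd => //; apply: Pmul.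
Qed.

Fact prime_pred_prime : prime_idealr_closed (prime_pred Ppr).
Proof.
move=> a b /asboolP Pab; have [_ /(_ _ _ Pab) [h|h]] := Ppr.
  by apply/orP; left; apply/asboolP.
by apply/orP; right; apply/asboolP.
Qed.

HB.instance Definition _ := isIdealr.Build A (prime_pred Ppr) prime_pred_ideal.
HB.instance Definition _ :=
  isPrimeIdealrClosed.Build A (prime_pred Ppr) prime_pred_prime.

Definition prime_quotient := {ideal_quot (prime_pred Ppr)}.
HB.instance Definition _ := GRing.ComNzRing.on prime_quotient.

(** Inverses obtained by choice make the quotient an [idomainType], whose fraction field serves as
    residue field later on. *)
Let qunit : pred prime_quotient := fun x => `[< exists y, y * x = 1 >].
Let qinv (x : prime_quotient) : prime_quotient :=
  if pselect (exists y, y * x = 1) is left h then projT1 (cid h) else x.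

Fact prime_quotient_mulVx : {in qunit, left_inverse 1 qinv *%R}.
Proof.
move=> x /asboolP h; rewrite /qinv; case: pselect => // h'.
by case: (cid h').
Qed.

Fact prime_quotient_unitP x y : y * x = 1 -> qunit x.
Proof. by move=> yx; apply/asboolP; exists y. Qed.

Fact prime_quotient_inv_out : {in [predC qunit], qinv =1 id}.
Proof.
move=> x; rewrite inE /= => /asboolP h; rewrite /qinv; case: pselect => // h'.
Qed.

HB.instance Definition _ := GRing.ComNzRing_hasMulInverse.Build prime_quotient
  prime_quotient_mulVx prime_quotient_unitP prime_quotient_inv_out.
HB.instance Definition _ := GRing.ComUnitRing_isIntegral.Build prime_quotient
  (@Quotient.rquot_IdomainAxiom A (prime_pred Ppr)).

Definition prime_proj : {rmorphism A -> prime_quotient} :=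
  (\pi_{ideal_quot (prime_pred Ppr)})%qT.

Lemma prime_proj_eq0 a : (prime_proj a = 0) <-> P a.
Proof.
rewrite /prime_proj /=; split=> [h|Pa].
  have : (a - 0 \in prime_pred Ppr).
    by rewrite Quotient.idealrBE h; apply/eqP; rewrite raddf0.
  by rewrite subr0 => /asboolP.
suff : (a - 0 \in prime_pred Ppr) by rewrite Quotient.idealrBE => /eqP ->; rewrite raddf0.
by rewrite subr0; apply/asboolP.
Qed.

Lemma prime_proj_surj (z : prime_quotient) : exists a, z = prime_proj a.
Proof. by exists (repr z); rewrite /prime_proj /= reprK. Qed.

End PrimeQuotient.

(** * Integral dependence and finitely generated domains *)

Definition polyev (C B : comNzRingType) (j : {rmorphism C -> B}) (b : B) :
  {rmorphism {poly C} -> B} :=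
  horner_morph (fun c => mulrC b (j c)).

Lemma polyevE (C B : comNzRingType) (j : {rmorphism C -> B}) b p :
  polyev j b p = (map_poly j p).[b].
Proof. by []. Qed.

Lemma polyevC (C B : comNzRingType) (j : {rmorphism C -> B}) b c :
  polyev j b c%:P = j c.
Proof. exact: horner_morphC. Qed.

Lemma polyevX (C B : comNzRingType) (j : {rmorphism C -> B}) b :
  polyev j b 'X = b.
Proof. exact: horner_morphX. Qed.

Lemma exprnBM (B : nzRingType) (x : B) i n :
  (i <= n)%N -> x ^+ n = x ^+ (n - i) * x ^+ i.
Proof. by move=> le_in; rewrite -exprD subnK. Qed.

Section IntegralComRing.
Variables (C B : comNzRingType) (j : {rmorphism C -> B}).
Local Notation int := (integralOver j).

Lemma integral_sum (T : Type) (r : seq T) (P : pred T) (f : T -> B) :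
  (forall i, P i -> int (f i)) -> int (\sum_(i <- r | P i) f i).
Proof.
by move=> h; elim/big_ind: _ => //; [exact: integral0|exact: integral_add].
Qed.

Lemma integral_exp n w : int w -> int (w ^+ n).
Proof.
move=> h; elim: n => [|n IH]; first exact: integral1.
by rewrite exprS; apply: integral_mul.
Qed.

Lemma integral_closed_eq n (s : nat -> B) w :
  (forall i, (i < n)%N -> int (s i)) -> w ^+ n = \sum_(i < n) s i * w ^+ i ->
  int w.
Proof.
move=> si e; pose p : {poly B} := 'X^n - \poly_(i < n) s i.
have pmon : p \is monic.
  rewrite monicE /p lead_coefDl ?lead_coefXn //.
  by rewrite size_polyN size_polyXn ltnS size_poly.
apply: (integral_root_monic pmon).
  by apply/rootP; rewrite /p hornerD hornerN hornerXn e horner_poly subrr.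
apply/integral_poly => i; rewrite /p coefB coefXn coef_poly.
apply: integral_sub; first exact: integral_nat.
by case: ifP => // ?; [apply: si|apply: integral0].
Qed.

Lemma integral_eqP w :
  int w <-> exists n (q : nat -> C), w ^+ n = \sum_(i < n) j (q i) * w ^+ i.
Proof.
split=> [[p pmon /rootP pw]|[n [q e]]]; last first.
  by apply: (integral_closed_eq (s := fun i => j (q i)) _ e) => i _; apply: integral_id.
exists (size p).-1, (fun i => - p`_i).
have sp : size p = (size p).-1.+1 by rewrite prednK // lt0n size_poly_eq0 monic_neq0.
move: pw; rewrite horner_poly.
rewrite -(big_mkord xpredT (fun i => j p`_i * w ^+ i)) sp big_mkord big_ord_recr /=.
rewrite -lead_coefE (monicP pmon).
rewrite rmorph1 mul1r addrC => /eqP; rewrite addr_eq0 => /eqP ->.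
by rewrite -sumrN; apply: eq_bigr => i _; rewrite rmorphN mulNr.
Qed.

Lemma integral_eq_scaled w g n (q : nat -> B) :
  w ^+ n = \sum_(i < n) q i * w ^+ i ->
  (g * w) ^+ n = \sum_(i < n) q i * g ^+ (n - i) * (g * w) ^+ i.
Proof.
move=> e; rewrite exprMn e mulr_sumr; apply: eq_bigr => i _.
rewrite exprMn (exprnBM g (ltnW (ltn_ord i))); ring.
Qed.

End IntegralComRing.

Section IntegralDomain.
Variables (C : comNzRingType) (B : idomainType) (j : {rmorphism C -> B}).
Local Notation int := (integralOver j).

(** In a domain, powers of t can be cancelled from an integral equation until its constant term is
    nonzero; that term is t times an integral element. *)
Lemma integral_divides t : int t -> t != 0 ->
  exists e y, [/\ j e != 0, j e = t * y & int y].
Proof.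
move=> it t0; have [n [q]] := (integral_eqP j t).1 it.
elim: n q => [|n IH] q; first by rewrite big_ord0 expr0 => /eqP; rewrite oner_eq0.
rewrite big_ord_recl /= expr0 mulr1 => e.
have [q0|q0] := eqVneq (j (q 0%N)) 0.
  apply: (IH (fun i => q i.+1)); apply: (mulfI t0).
  rewrite -exprS e q0 add0r mulr_sumr; apply: eq_bigr => i _.
  by rewrite exprS; ring.
exists (q 0%N), (t ^+ n - \sum_(i < n) j (q i.+1) * t ^+ i); split=> //.
  rewrite mulrBr -exprS e mulr_sumr -[LHS](addrK (\sum_(i < n) j (q i.+1) * t ^+ i.+1)).
  by congr (_ - _); apply: eq_bigr => i _; rewrite exprS; ring.
apply: integral_sub; first exact: integral_exp.
apply: integral_sum => i _; apply: integral_mul; first exact: integral_id.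
exact: integral_exp.
Qed.

Lemma algebraic_integral b (q : {poly C}) :
  map_poly j q != 0 -> (map_poly j q).[b] = 0 ->
  exists a, j a != 0 /\ int (j a * b).
Proof.
set P := map_poly j q => P0 Pb; pose d := (size P).-1.
have sP : size P = d.+1 by rewrite /d prednK // lt0n size_poly_eq0.
have lP : j q`_d != 0 by rewrite -coef_map -/P /d -lead_coefE lead_coef_eq0.
exists q`_d; split=> //; set l := j q`_d in lP *.
case: (posnP d) => [d0|dgt0].
  move: Pb; rewrite horner_coef sP d0 big_ord1 expr0 mulr1 coef_map /=.
  by move=> /eqP; move: lP; rewrite /l d0 => /negPf ->.
apply: (@integral_closed_eq _ _ j d (fun i => - (j q`_i * l ^+ (d.-1 - i)))).
  move=> i _; apply: integral_opp; apply: integral_mul; first exact: integral_id.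
  exact/integral_exp/integral_id.
have : l ^+ d.-1 * P.[b] = 0 by rewrite Pb mulr0.
rewrite horner_coef sP big_ord_recr /= coef_map -/l mulrDr => /eqP.
rewrite addrC addr_eq0 mulrA -exprSr prednK // -exprMn => /eqP ->.
rewrite mulr_sumr -sumrN; apply: eq_bigr => i _.
have le : (i <= d.-1)%N by rewrite -ltnS prednK.
rewrite coef_map /= (exprnBM _ le) exprMn; ring.
Qed.

Lemma polyev_integral a b (q : {poly C}) D : int (j a * b) ->
  (size q <= D)%N -> int (j a ^+ D * polyev j b q).
Proof.
move=> iab sq; rewrite polyevE (horner_coef_wide _ (leq_trans (size_poly _ _) sq)).
rewrite mulr_sumr; apply: integral_sum => i _.
have -> : j a ^+ D * ((map_poly j q)`_i * b ^+ i) =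
          j (q`_i * a ^+ (D - i)) * (j a * b) ^+ i.
  rewrite coef_map /= (exprnBM _ (ltnW (ltn_ord i))) exprMn rmorphM rmorphXn; ring.
by apply: integral_mul; [apply: integral_id|apply: integral_exp].
Qed.

End IntegralDomain.

Lemma poly_nonroot_nat (B : idomainType) (P : {poly B}) :
  [pchar B] =i pred0 -> P != 0 -> exists n, P.[n%:R] != 0.
Proof.
move=> /pcharf0P ch P0; apply: contrapT => h.
have := @max_poly_roots _ P [seq n%:R | n <- iota 0 (size P)] P0.
rewrite size_map size_iota ltnn => H; suff : false by [].
apply: H.
  by apply/allP => _ /mapP[n _ ->]; apply/rootP/eqP; apply: contra_notT h => ?; exists n.
rewrite map_inj_uniq ?iota_uniq // => m n.
wlog le_mn : m n / (m <= n)%N.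
  by move=> H; have [/H|/ltnW/H h1 /esym/h1] := leqP m n.
move=> /esym/eqP; rewrite -subr_eq0 -natrB // ch subn_eq0 => le_nm.
by apply/eqP; rewrite eqn_leq le_mn.
Qed.

Definition generated_by (C B : nzRingType) (j : C -> B) (bs : seq B) : Prop :=
  forall S : pset B, (forall c, S (j c)) -> (forall b, b \in bs -> S b) ->
    (forall x y, S x -> S y -> S (x + y)) ->
    (forall x y, S x -> S y -> S (x * y)) -> forall z, S z.

(* Any element of Frac(C) lying in the finitely generated extension B of C
   has bounded poles: they are supported on a single element a of C. *)
Lemma generated_domain_poles (B : idomainType) (bs : seq B) :
  [pchar B] =i pred0 ->
  forall (C : comNzRingType) (j : {rmorphism C -> B}), generated_by j bs ->
  exists a, j a != 0 /\ forall z g c, j g != 0 -> j g * z = j c ->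
    exists N, integralOver j (j a ^+ N * z).
Proof.
move=> chB; elim: bs => [|b bs IH] C j jgen.
  exists 1; rewrite rmorph1 oner_eq0; split=> // z g c _ _; exists 0%N.
  rewrite expr0 mul1r.
  have [|//|x y [c1 ->] [c2 ->]|x y [c1 ->] [c2 ->]|c' ->] :=
     jgen (fun z => exists c, z = j c) _ _ _ _ z.
  - by move=> c1; exists c1.
  - by exists (c1 + c2); rewrite rmorphD.
  - by exists (c1 * c2); rewrite rmorphM.
  - exact: integral_id.
pose j1 := polyev j b.
have [|p [p0 pP]] := IH {poly C} j1.
  move=> S Sj Sbs SD SM; apply: jgen => // [c|b'].
    by rewrite -(polyevC j b); apply: Sj.
  by rewrite inE => /orP[/eqP ->|/Sbs//]; rewrite -(polyevX j b); apply: Sj.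
have {}pP z g c : j g != 0 -> j g * z = j c ->
  exists N n (q : nat -> {poly C}),
    (j1 p ^+ N * z) ^+ n = \sum_(i < n) j1 (q i) * (j1 p ^+ N * z) ^+ i.
  rewrite -!(polyevC j b) => g0 gz; have [N iN] := pP _ _ _ g0 gz.
  by exists N; apply/integral_eqP.
(* If [b] is algebraic over [j C], some [j a * b] is integral, hence so is [j a ^+ size p * j1 p].
   The latter divides a nonzero [j e] with integral cofactor [y], so poles supported on [p] are also
   supported on [a * e]. *)
have [[q [q0 qb]]|tr] := pselect (exists q, map_poly j q != 0 /\ (map_poly j q).[b] = 0).
  have [a [a0 iab]] := algebraic_integral q0 qb.
  have [|e [y [e0 ey iy]]] := integral_divides (polyev_integral iab (leqnn (size p))).
    by rewrite mulf_neq0 ?expf_neq0.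
  exists (a * e); rewrite rmorphM mulf_neq0 //; split=> // z g c g0 gz.
  have [N [n [r er]]] := pP _ _ _ g0 gz; set w := j1 p ^+ N * z in er.
  pose D := (\sum_(i < n) size (r i))%N.
  have leD i : (i < n)%N -> (size (r i) <= D)%N.
    by move=> lt_in; rewrite /D (bigD1 (Ordinal lt_in)) //= leq_addr.
  have iw : integralOver j (j a ^+ D * w).
    apply: (integral_closed_eq (s := fun i => j1 (r i) * (j a ^+ D) ^+ (n - i)) _
      (@integral_eq_scaled _ w (j a ^+ D) n (fun i => j1 (r i)) er)) => i lt_in.
    rewrite mulrC -[(n - i)%N]prednK ?subn_gt0 // exprS -mulrA [_ * j1 _]mulrC mulrA.
    apply: integral_mul; first by apply: polyev_integral => //; apply: leD.
    by rewrite -!rmorphXn; apply: integral_id.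
  exists (D + N)%N.
  have -> : (j a * j e) ^+ (D + N) * z =
     j (a ^+ N * e ^+ D) * ((j a ^+ size p * y) ^+ N * (j a ^+ D * w)).
    have -> : (j a * j e) ^+ (D + N) * z =
      (j a ^+ N * j e ^+ D) * (j e ^+ N * (j a ^+ D * z)).
      by rewrite exprMn !exprD; ring.
    rewrite rmorphM !rmorphXn {2}ey /w /j1 !exprMn; ring.
  apply: integral_mul; first exact: integral_id.
  apply: integral_mul => //; apply: integral_exp; apply: integral_mul => //.
  by rewrite -rmorphXn; apply: integral_id.
(* If [b] is transcendental, an integral equation over C[X] for an element of Frac(C) is an identity
   between polynomials, and it can be specialized at a natural number where [p] does not vanish. *)
have inj1 E : j1 E = 0 -> map_poly j E = 0.
  by move=> E0; apply/eqP; apply: contra_notT tr => ?; exists E.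
have [n0 n0P] : exists n, (map_poly j p).[n%:R] != 0.
  apply: poly_nonroot_nat => //; apply: contraNneq p0 => p0.
  by rewrite /j1 polyevE p0 horner0.
have evE E : (map_poly j E).[n0%:R] = j E.[n0%:R].
  by rewrite -[in LHS](rmorph_nat j) horner_map.
exists p.[n0%:R]; rewrite -evE; split=> // z g c g0 gz.
have [N [n [r er]]] := pP _ _ _ g0 gz; exists N.
pose E := (c%:P * p ^+ N) ^+ n -
  \sum_(i < n) r i * g%:P ^+ (n - i) * (c%:P * p ^+ N) ^+ i.
have jw : j g * (j1 p ^+ N * z) = j1 (c%:P * p ^+ N).
  by rewrite rmorphM rmorphXn [j1 _%:P]polyevC -gz; ring.
have E0 : j1 E = 0.
  rewrite /E rmorphB rmorphXn -jw (@integral_eq_scaled _ _ (j g) n (fun i => j1 (r i)) er) rmorph_sum.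
  apply/eqP; rewrite subr_eq0; apply/eqP/eq_bigr => i _.
  by rewrite !rmorphM !rmorphXn [j1 g%:P]polyevC -jw.
have := evE E; rewrite (inj1 _ E0) horner0 => /esym.
rewrite /E hornerD hornerN horner_exp hornerM hornerC horner_exp.
rewrite rmorphB rmorphXn rmorphM rmorphXn.
set A0 := j p.[_]; rewrite horner_sum rmorph_sum /= => e.
apply/integral_eqP; exists n, (fun i => (r i).[n0%:R]).
rewrite evE -/A0; apply: (mulfI (expf_neq0 n g0)); apply/eqP; rewrite -subr_eq0.
apply/eqP; rewrite -[RHS]e -exprMn; congr (_ - _).
  by congr (_ ^+ _); rewrite -gz; ring.
rewrite mulr_sumr; apply: eq_bigr => i _.
rewrite !hornerM !horner_exp !hornerM !hornerC !horner_exp !(rmorphM, rmorphXn) /= -/A0 -gz.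
rewrite (exprnBM (j g) (ltnW (ltn_ord i))) !exprMn; ring.
Qed.

(** * Spans with denominators *)

Section WeakSpan.
Variables (K : idomainType) (B : comNzRingType) (kappa : {rmorphism K -> B}).
Variable J0 : pset B.
Hypothesis J0id : is_ideal J0.

(** Working modulo [J0] covers two uses: A modulo an ideal over the field k, and Q over k[x] with
    [J0] zero. *)
Fixpoint span_mod (E : seq B) : pset B :=
  if E is e :: E' then fun q => exists c r, span_mod E' r /\ q = kappa c * e + r
  else J0.

(* q lies in the span of E over Frac(K), modulo J0. *)
Definition wspan (E : seq B) : pset B :=
  fun q => exists2 h, h != 0 & span_mod E (kappa h * q).

Lemma span_modD E q q' : span_mod E q -> span_mod E q' -> span_mod E (q + q').
Proof.
have [_ [Jadd _]] := J0id.
elim: E q q' => [|e E IH] q q' /=; first exact: Jadd.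
move=> [c [r [Er ->]]] [c' [r' [Er' ->]]]; exists (c + c'), (r + r').
by split; [apply: IH|rewrite rmorphD; ring].
Qed.

Lemma span_modZ E c q : span_mod E q -> span_mod E (kappa c * q).
Proof.
have [_ [_ Jmul]] := J0id.
elim: E q => [|e E IH] q /=; first exact: Jmul.
move=> [c' [r [Er ->]]]; exists (c * c'), (kappa c * r).
by split; [apply: IH|rewrite rmorphM; ring].
Qed.

Lemma span_mod_ideal E q : J0 q -> span_mod E q.
Proof.
move=> Jq; elim: E => [|e E IH] //=.
by exists 0, q; rewrite rmorph0 mul0r add0r.
Qed.

Lemma span_mod_mem E e : e \in E -> span_mod E e.
Proof.
have [J00 _] := J0id.
elim: E => [|e' E IH] //=; rewrite inE => /orP[/eqP <-|/IH Ee].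
  by exists 1, 0; rewrite rmorph1 mul1r addr0; split=> //; apply: span_mod_ideal.
by exists 0, e; rewrite rmorph0 mul0r add0r.
Qed.

Lemma wspan_span E q : span_mod E q -> wspan E q.
Proof. by exists 1; rewrite ?oner_eq0 // rmorph1 mul1r. Qed.

Lemma wspanD E q q' : wspan E q -> wspan E q' -> wspan E (q + q').
Proof.
move=> [h h0 hq] [h' h0' hq']; exists (h * h'); first by rewrite mulf_neq0.
have -> : kappa (h * h') * (q + q') =
   kappa h' * (kappa h * q) + kappa h * (kappa h' * q') by rewrite rmorphM; ring.
by apply: span_modD; apply: span_modZ.
Qed.

Lemma wspanZ E c q : wspan E q -> wspan E (kappa c * q).
Proof.
move=> [h h0 hq]; exists h => //; rewrite mulrCA; exact: span_modZ.
Qed.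

Lemma wspan_sum E (T : Type) (r : seq T) (P : pred T) (f : T -> B) :
  (forall i, P i -> wspan E (f i)) -> wspan E (\sum_(i <- r | P i) f i).
Proof.
move=> h; elim/big_ind: _ => //; last exact: wspanD.
by apply/wspan_span/span_mod_ideal; case: J0id.
Qed.

Lemma wspan_div E h q : h != 0 -> wspan E (kappa h * q) -> wspan E q.
Proof.
move=> h0 [h' h0' hq]; exists (h' * h); first by rewrite mulf_neq0.
by rewrite rmorphM -mulrA.
Qed.

Lemma wspan_mulr E E' q t : wspan E q ->
  (forall e, e \in E -> wspan E' (e * t)) -> wspan E' (q * t).
Proof.
have [_ [_ Jmul]] := J0id.
move=> [h h0 hq] EE'; apply: (wspan_div h0); rewrite mulrA.
elim: E {h h0} (kappa h * q) hq EE' => [|e E IH] /= r.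
  by move=> Jr _; apply/wspan_span/span_mod_ideal; rewrite mulrC; apply: Jmul.
move=> [c [r' [Er' ->]]] EE'; rewrite mulrDl -mulrA; apply: wspanD.
  by apply/wspanZ/EE'; rewrite mem_head.
by apply: IH => // e' Ee'; apply: EE'; rewrite inE Ee' orbT.
Qed.

(** The generators are treated one by one: with denominators allowed, the relation for b rewrites
    each power of b from its degree on in terms of lower ones, so [E] need only be multiplied by
    finitely many powers of b. *)
Lemma wspan_mul_stable (s : seq B) :
  (forall b, b \in s -> exists2 p : {poly K}, p != 0 & J0 (map_poly kappa p).[b]) ->
  exists E, wspan E 1 /\ forall b e, b \in s -> e \in E -> wspan E (b * e).
Proof.
have [_ [_ Jmul]] := J0id.
elim: s => [|b s IH] hs.
  by exists [:: 1]; split=> //; apply/wspan_span/span_mod_mem; rewrite mem_head.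
have [|E [E1 sE]] := IH; first by move=> b' sb'; apply: hs; rewrite inE sb' orbT.
have [p p0 Jp] := hs b (mem_head _ _).
pose d := (size p).-1; pose E' := [seq e * b ^+ i | e <- E, i <- iota 0 d].
have sp : size p = d.+1 by rewrite /d prednK // lt0n size_poly_eq0.
have lp0 : p`_d != 0 by rewrite /d -lead_coefE lead_coef_eq0.
have E'pow e i : e \in E -> wspan E' (e * b ^+ i).
  move=> Ee; elim/ltn_ind: i => i IHi; have [lt_id|le_di] := ltnP i d.
    apply/wspan_span/span_mod_mem; apply/allpairsP; exists (e, i).
    by rewrite mem_iota.
  apply: (wspan_div lp0).
  have -> : kappa p`_d * (e * b ^+ i) = e * b ^+ (i - d) * (map_poly kappa p).[b]
     - \sum_(l < d) kappa p`_l * (e * b ^+ (i - d + l)).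
    have -> : (map_poly kappa p).[b] = \sum_(l < d.+1) kappa p`_l * b ^+ l.
      rewrite -sp (horner_coef_wide _ (size_poly _ _)).
      by apply: eq_bigr => l _; rewrite coef_map.
    rewrite big_ord_recr /= (exprnBM _ le_di) mulrDr mulr_sumr.
    rewrite (eq_bigr (fun l : 'I_d => kappa p`_l * (e * b ^+ (i - d + l)))).
      by ring.
    by move=> l _; rewrite exprD; ring.
  rewrite -sumrN; apply: wspanD.
    by apply/wspan_span/span_mod_ideal/Jmul.
  apply: wspan_sum => l _; rewrite -mulNr -rmorphN; apply/wspanZ/IHi.
  by rewrite -ltn_subRL; have := ltn_ord l; lia.
have EE' q : wspan E q -> wspan E' q.
  move=> Eq; rewrite -[q]mulr1; apply: wspan_mulr Eq _ => e /(E'pow e 0%N).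
  by rewrite expr0.
exists E'; split; first exact: EE'.
move=> b' _ /[swap] /allpairsP[[e i] /= [Ee _ ->]]; rewrite inE.
case/orP => [/eqP ->|sb']; first by rewrite mulrCA -exprS; apply: E'pow.
rewrite mulrA; apply: wspan_mulr (sE _ _ sb' Ee) _ => e' Ee'; exact: E'pow.
Qed.

Lemma wspan_generated (s : seq B) E : generated_by kappa s -> wspan E 1 ->
  (forall b e, b \in s -> e \in E -> wspan E (b * e)) -> forall a, wspan E a.
Proof.
move=> gen E1 sE a; suff aE : forall e, e \in E -> wspan E (a * e).
  by rewrite -[a]mul1r; apply: wspan_mulr E1 _ => e Ee; rewrite mulrC; apply: aE.
apply: (gen (fun a => forall e, e \in E -> wspan E (a * e))) => //.
- by move=> c e Ee; apply/wspanZ/wspan_span/span_mod_mem.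
- by move=> b sb e; apply: sE.
- by move=> x y hx hy e Ee; rewrite mulrDl; apply: wspanD; [apply: hx|apply: hy].
- move=> x y hx hy e Ee; have -> : x * y * e = (y * e) * x by ring.
  by apply: wspan_mulr (hy e Ee) _ => e' Ee'; rewrite mulrC; apply: hx.
Qed.

(** Gaussian elimination without division: either no [q i] involves the first generator [e], or a
    pivot [q i0] that does is used to remove [e] from all the others, which leaves one vector and
    one generator less. *)
Lemma wspan_dependent E m (q : 'I_m -> B) : (size E < m)%N ->
  (forall i, wspan E (q i)) ->
  exists2 c : 'I_m -> K, (exists i, c i != 0) & J0 (\sum_i kappa (c i) * q i).
Proof.
have [J00 _] := J0id.
elim: E m q => [|e E IH] m q /=.
  case: m q => // m q _ /(_ ord0)[h h0 Jh].
  exists (fun i => if i == ord0 then h else 0); first by exists ord0; rewrite eqxx.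
  rewrite (bigD1 ord0) //= big1 ?addr0 // => i /negPf ->.
  by rewrite rmorph0 mul0r.
move=> ltEm qE.
have /choice[/= f fP] : forall i : 'I_m, exists hc : K * K,
    hc.1 != 0 /\ span_mod E (kappa hc.1 * q i - kappa hc.2 * e).
  move=> i; have [h h0 [c [r [Er hr]]]] := qE i; exists (h, c); split=> //=.
  by rewrite hr addrC addKr.
have [[i0 c0]|nc] := pselect (exists i, (f i).2 != 0); last first.
  apply: IH; first exact: ltnW.
  move=> i; have [h0 hE] := fP i; exists (f i).1 => //.
  have c0 : (f i).2 = 0 by apply/eqP; apply: contra_notT nc => ?; exists i.
  by move: hE; rewrite c0 rmorph0 mul0r subr0.
case: m q ltEm qE f fP i0 c0 => [|m] q ltEm qE f fP i0 c0; first by case: i0 c0.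
have [||d [j0 dj0] Jd] := IH m (fun j => kappa ((f i0).2 * (f (lift i0 j)).1) * q (lift i0 j)
     - kappa ((f (lift i0 j)).2 * (f i0).1) * q i0).
- by [].
- move=> j; apply: wspan_span; set i := lift i0 j.
  have -> : kappa ((f i0).2 * (f i).1) * q i - kappa ((f i).2 * (f i0).1) * q i0 =
    kappa (f i0).2 * (kappa (f i).1 * q i - kappa (f i).2 * e) +
    kappa (- (f i).2) * (kappa (f i0).1 * q i0 - kappa (f i0).2 * e).
    by rewrite !rmorphM rmorphN; ring.
  by apply: span_modD; apply: span_modZ; [have [] := fP i|have [] := fP i0].
exists (fun i => if unlift i0 i is Some j then d j * (f i0).2 * (f (lift i0 j)).1
          else - \sum_j d j * (f (lift i0 j)).2 * (f i0).1).
  by exists (lift i0 j0); rewrite liftK !mulf_neq0 //; case: (fP (lift i0 j0)).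
suff <- : \sum_j kappa (d j) * (kappa ((f i0).2 * (f (lift i0 j)).1) * q (lift i0 j)
     - kappa ((f (lift i0 j)).2 * (f i0).1) * q i0) =
   \sum_i kappa (if unlift i0 i is Some j then d j * (f i0).2 * (f (lift i0 j)).1
          else - \sum_j d j * (f (lift i0 j)).2 * (f i0).1) * q i by [].
rewrite (bigD1_ord i0) //= unlift_none rmorphN rmorph_sum mulNr mulr_suml addrC -sumrB.
apply: eq_bigr => j _; rewrite liftK !rmorphM; ring.
Qed.

End WeakSpan.

(** * Algebraic dependence in one-dimensional finitely generated algebras *)

Lemma kalg_pchar (k : fieldType) (B : nzRingType) (j : {rmorphism k -> B}) :
  [pchar k] =i pred0 -> [pchar B] =i pred0.
Proof.
move=> ch p; apply/negP => /andP[pp /eqP p0].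
have /pcharf0P chk := ch; move: (chk p); rewrite (gtn_eqF (prime_gt0 pp)) => /negbT pk.
have : j (p%:R^-1 * p%:R) != 0 by rewrite mulVf // rmorph1 oner_eq0.
by rewrite rmorphM rmorph_nat p0 mulr0 eqxx.
Qed.

(* The poles of B over C0[X] are supported on one polynomial a, so X - n
   does not become a divisor of a constant when a does not vanish at n. *)
Lemma const_not_multiple (C0 B : idomainType) (j : {rmorphism {poly C0} -> B})
  (bs : seq B) : [pchar B] =i pred0 -> generated_by j bs ->
  (forall f, j f = 0 -> f = 0) ->
  exists n : nat, forall f b, f != 0 -> j f%:P <> j ('X - n%:R%:P) * b.
Proof.
move=> chB jgen jinj.
have [a [a0 aP]] := generated_domain_poles chB jgen.
have chC : [pchar C0] =i pred0.
  move=> p; apply/negP => /andP[pp /eqP p0]; have := chB p.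
  by rewrite !inE pp -(rmorph_nat j) -polyC_natr p0 rmorph0 eqxx.
have [|n an0] := poly_nonroot_nat chC (P := a).
  by apply: contraNneq a0 => ->; rewrite rmorph0.
exists n => f b f0; have [g gE] : exists g : {poly C0}, g = 'X - n%:R%:P.
  by exists ('X - n%:R%:P).
rewrite -gE => fb.
have [||N /integral_eqP[m [q e]]] := aP b g f%:P; last 1 first.
- have E0 : j ((a ^+ N * f%:P) ^+ m -
      \sum_(i < m) q i * g ^+ (m - i) * (a ^+ N * f%:P) ^+ i) = 0.
    have jw : j g * (j a ^+ N * b) = j (a ^+ N * f%:P).
      by rewrite rmorphM rmorphXn fb; ring.
    have := @integral_eq_scaled _ _ (j g) m (fun i => j (q i)) e; rewrite jw => E1.
    rewrite rmorphB rmorphXn rmorph_sum; apply/eqP; rewrite subr_eq0; apply/eqP.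
    apply: (etrans E1); apply: eq_bigr => i _.
    by rewrite !(rmorphM, rmorphXn).
  (* At X = n every term with a factor [g] vanishes, and the equation leaves a power of a(n)^N f
     equal to zero. *)
  have := congr1 (horner^~ n%:R) (jinj _ E0).
  rewrite hornerD hornerN horner0 horner_sum big1 ?subr0 => [|i _]; last first.
    rewrite !hornerM !horner_exp gE !hornerXsubC subrr expr0n.
    by rewrite subn_eq0 leqNgt ltn_ord mulr0 mul0r.
  rewrite horner_exp hornerM horner_exp hornerC => /eqP.
  by rewrite (negPf (expf_neq0 _ _)) // mulf_neq0 // expf_neq0.
- apply/eqP => /jinj/eqP; by rewrite gE polyXsubC_eq0.
- exact: esym fb.
Qed.

Section FinGenAlgebra.
Variables (k : fieldType) (A : comAlgType k).
Hypothesis (hchar : [pchar k] =i pred0) (hfg : fin_gen_alg A).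

Definition kincl (B : comAlgType k) : {rmorphism k -> B} := in_alg B.
Definition ev1 (B : comAlgType k) (u : B) := polyev (kincl B) u.
Definition ev2 (B : comAlgType k) (u v : B) := polyev (ev1 u) v.

(** This turns algebraic independence into chains of primes: imposing X = n for a suitable n gives a
    strictly larger prime that still meets [C0] only in zero. *)
Lemma prime_above_avoiding (C0 : idomainType) (e : {rmorphism {poly C0} -> A})
  (P : pset A) : is_prime_ideal P -> (forall f, P (e f) -> f = 0) ->
  (forall c : k, exists f, c%:A = e f) ->
  exists n : nat, exists p, [/\ is_prime_ideal p, forall a, P a -> p a,
    p (e ('X - n%:R%:P)) & forall f, p (e f%:P) -> f = 0].
Proof.
move=> Ppr einj ek; pose j : {rmorphism {poly C0} -> prime_quotient Ppr} := prime_proj Ppr \o e.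
have [s sP] := hfg.
have jinj f : j f = 0 -> f = 0 by move/prime_proj_eq0/einj.
have [||n nP] := @const_not_multiple C0 _ j (map (prime_proj Ppr) s) _ _ jinj.
- exact: (kalg_pchar (prime_proj Ppr \o in_alg A)).
- move=> S Sj Ss SD SM z; have [a ->] := prime_proj_surj z.
  apply: (sP (fun a => S (prime_proj Ppr a))) => [c|x xs|x y Sx Sy|x y Sx Sy].
  + by have [f ->] := ek c; apply: Sj.
  + by apply: Ss; apply: map_f.
  + by rewrite rmorphD; apply: SD.
  + by rewrite rmorphM; apply: SM.
exists n; have [[Pid _] _] := Ppr.
have [||||p [ppr Ip pT]] := @prime_avoiding A (ideal_adjoin P (e ('X - n%:R%:P)))
   (fun a => exists2 f, f != 0 & a = e f%:P).
- exact: ideal_adjoin_ideal.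
- by exists 1; rewrite ?oner_eq0 // rmorph1.
- move=> _ _ [f f0 ->] [g g0 ->]; exists (f * g); first by rewrite mulf_neq0.
  by rewrite polyCM rmorphM.
- move=> a [b [c [Pb ->]]] [f f0 ef]; apply: (nP f (prime_proj Ppr c) f0).
  have := congr1 (prime_proj Ppr) ef.
  rewrite rmorphD rmorphM (proj2 (prime_proj_eq0 Ppr b) Pb) add0r /j /= => <-.
  by rewrite mulrC.
exists p; split=> //.
- by move=> a Pa; apply/Ip/ideal_adjoin_sub.
- by apply/Ip/ideal_adjoin_mem.
- by move=> f pf; apply/eqP; apply: contra_notT (pT _ pf) => f0; exists f.
Qed.

Lemma kincl_ev1 (u : A) (c : k) : c%:A = ev1 u c%:P.
Proof. by rewrite /ev1 polyevC. Qed.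

Lemma prime_above_algebraic (P : pset A) (u : A) : is_prime_ideal P ->
  (forall f, P (ev1 u f) -> f = 0) ->
  exists q, is_prime_ideal q /\ strict_sub P q.
Proof.
move=> Ppr uP.
have [|n [q [qpr Pq qn _]]] := prime_above_avoiding Ppr uP.
  by move=> c; exists c%:P; apply: kincl_ev1.
exists q; split=> //; split=> //; exists (ev1 u ('X - n%:R%:P)); split=> // /uP.
by apply/eqP; rewrite polyXsubC_eq0.
Qed.

(** A form of Zariski's lemma: an element transcendental modulo m would produce a prime strictly
    above m. *)
Lemma algebraic_mod_maximal (m : pset A) (u : A) : is_maximal_ideal m ->
  exists2 f, f != 0 & m (ev1 u f).
Proof.
move=> mmax; apply: contrapT => h.
have uP f : m (ev1 u f) -> f = 0.
  by move=> mf; apply/eqP; apply: contra_notT h => f0; exists f.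
have [q [[qid _] [mq [x [qx nmx]]]]] := prime_above_algebraic (maximal_ideal_prime mmax) uP.
by apply: nmx; apply: (mmax.2 q).
Qed.

(** If u and v were independent, they would remain so modulo some prime, hence modulo a minimal
    prime below it; specializing first v and then u would give a chain of length two above that
    minimal prime. *)
Lemma algebraically_dependent (u v : A) : pure_dim_one A ->
  exists2 f, f != 0 & ev2 u v f = 0.
Proof.
move=> hpure; apply: contrapT => h.
have evN0 f : ev2 u v f = 0 -> f = 0.
  by move=> f0; apply/eqP; apply: contra_notT h => ?; exists f.
have [||||P [Ppr _ PT]] := @prime_avoiding A (fun a => a = 0)
   (fun a => exists2 f, f != 0 & a = ev2 u v f).
- by split=> //; split=> [x y -> ->|r x ->]; rewrite ?addr0 ?mulr0.
- by exists 1; rewrite ?oner_eq0 ?rmorph1.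
- move=> _ _ [f f0 ->] [g g0 ->]; exists (f * g); first by rewrite mulf_neq0.
  by rewrite rmorphM.
- by move=> _ -> [f /eqP f0 /esym/evN0].
have [P0 [P0min P0P]] := minimal_prime_below Ppr.
have P0pr := P0min.1; have [_ []] := hpure _ P0min.
have uvP0 f : P0 (ev2 u v f) -> f = 0.
  by move=> /P0P/PT nT; apply/eqP; apply: contra_notT nT => ?; exists f.
have [|n [p [ppr P0p pn pinj]]] := prime_above_avoiding P0pr uvP0.
  by move=> c; exists c%:P%:P; rewrite /ev2 polyevC -kincl_ev1.
have [|q [qpr pq]] := prime_above_algebraic (u := u) ppr.
  by move=> f pf; apply: pinj; rewrite /ev2 polyevC.
exists (fun i => match i with 0 => P0 | 1 => p | _ => q end); split=> //; split.
  by case=> [|[|]].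
case=> [|[|//]] _ //; split=> //; exists (ev2 u v ('X - n%:R%:P)); split=> // /uvP0.
by apply/eqP; rewrite polyXsubC_eq0.
Qed.

(* A/m has finite dimension over k, being spanned by finitely many monomials. *)
Lemma maximal_ideal_fin_gen (m : pset A) : is_maximal_ideal m ->
  exists ms : seq A, (forall a, a \in ms -> m a) /\
    forall I : pset A, is_ideal I -> (forall a, a \in ms -> I a) ->
      forall a, m a -> I a.
Proof.
move=> mmax; have mid : is_ideal m by case: mmax => -[].
have [s sP] := hfg.
have /choice[/= p pP] : forall b : A, exists f, f != 0 /\ m (ev1 b f).
  by move=> b; have [f] := algebraic_mod_maximal b mmax; exists f.
pose ms0 := [seq ev1 b (p b) | b <- s].
pose J0 : pset A := fun a => forall I, is_ideal I -> (forall b, b \in ms0 -> I b) -> I a.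
have J0id : is_ideal J0.
  split; first by move=> I [].
  split=> [x y Jx Jy|r x Jx] I Iid Is; have [_ [Iadd Imul]] := Iid.
    by apply: Iadd; [apply: Jx|apply: Jy].
  by apply: Imul; apply: Jx.
have J0m a : J0 a -> m a by apply=> // b /mapP[c _ ->]; apply: (pP c).2.
have [|E [E1 sE]] := @wspan_mul_stable k A (kincl A) J0 J0id s.
  move=> b sb; exists (p b); first exact: (pP b).1.
  by move=> I _; apply; apply: (map_f (fun b => ev1 b (p b))).
have gen : generated_by (kincl A) s by exact: sP.
have {E1 sE}Eall := wspan_generated J0id gen E1 sE.
have Espan a : span_mod (kincl A) J0 E a.
  have [h h0 /(span_modZ J0id h^-1)] := Eall a.
  by rewrite mulrA -rmorphM mulVf // rmorph1 mul1r.
(* Row reduction along [E]: a generator of m is recorded for [e] exactly when m contains an element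
   with leading term [e]; subtracting multiples of it reduces to the span of the remaining list. *)
have [l [lm lP]] : exists l : seq A, (forall a, a \in l -> m a) /\
    forall I : pset A, is_ideal I -> (forall a, J0 a -> I a) ->
      (forall a, a \in l -> I a) -> forall a, span_mod (kincl A) J0 E a -> m a -> I a.
  elim: E {Eall Espan} => [|e E [l [lm lP]]].
    by exists [::]; split=> // I _ JI _ a /JI.
  have [[z [Ez mz]]|nz] := pselect (exists z, span_mod (kincl A) J0 E z /\ m (e + z)).
    exists (e + z :: l); split=> [a|I Iid JI lI _ [c [r [Er ->]]] mr].
      by rewrite inE => /orP[/eqP ->|/lm].
    have [_ [Iadd Imul]] := Iid.
    have Iez : I (e + z) by apply: lI; rewrite mem_head.
    have -> : kincl A c * e + r = kincl A c * (e + z) + (r - kincl A c * z) by ring.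
    apply: Iadd; first exact: Imul.
    apply: (lP I) => //.
    - by move=> a al; apply: lI; rewrite inE al orbT.
    - apply: span_modD => //; rewrite -mulNr -rmorphN; exact: span_modZ.
    - have -> : r - kincl A c * z = (kincl A c * e + r) - kincl A c * (e + z) by ring.
      by apply: is_idealB => //; have [_ [_]] := mid; apply.
  exists l; split=> // I Iid JI lI _ [c [r [Er ->]]].
  have [->|c0 mr] := eqVneq c 0; first by rewrite rmorph0 mul0r add0r; apply: lP.
  case: nz; exists (kincl A c^-1 * r); split; first exact: span_modZ.
  have [_ [_ mmul]] := mid; have := mmul (kincl A c^-1) _ mr.
  by rewrite mulrDr mulrA -rmorphM mulVf // rmorph1 mul1r.
exists (ms0 ++ l); split=> [a|I Iid msI a ma].
  rewrite mem_cat => /orP[/mapP[b _ ->]|/lm //]; exact: (pP b).2.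
apply: (lP I) => // [a'|a' al]; last by apply: msI; rewrite mem_cat al orbT.
by apply=> // b bs; apply: msI; rewrite mem_cat bs.
Qed.

End FinGenAlgebra.

(** * The local ring and a minimal reduction of its maximal ideal *)

Section RmorphismOf.
Variables (R S : nzRingType) (f : R -> S).
Hypotheses (fD : forall x y, f (x + y) = f x + f y)
  (fM : forall x y, f (x * y) = f x * f y) (f1 : f 1 = 1).

Fact rmorphism_of_zmod : zmod_morphism f.
Proof.
by move=> x y; apply: (addIr (f y)); rewrite -fD !subrK.
Qed.

Fact rmorphism_of_monoid : monoid_morphism f.
Proof. by split. Qed.

Definition rmorphism_of : {rmorphism R -> S} :=
  HB.pack f (GRing.isZmodMorphism.Build R S f rmorphism_of_zmod)
    (GRing.isMonoidMorphism.Build R S f rmorphism_of_monoid).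

End RmorphismOf.

Lemma ev2E (k : fieldType) (B : comAlgType k) (u v : B) (f : {poly {poly k}}) n :
  (size f <= n)%N -> (forall j, (size (f`_j)%R <= n)%N) ->
  ev2 u v f = \sum_(j < n) \sum_(i < n) (f`_j`_i)%:A * u ^+ i * v ^+ j.
Proof.
move=> sf sfj; rewrite /ev2 polyevE (horner_coef_wide _ (leq_trans (size_poly _ _) sf)).
apply: eq_bigr => j _; rewrite coef_map /= /ev1.
rewrite -[horner_morph _ _]/(polyev (kincl B) u f`_j) polyevE.
rewrite (horner_coef_wide _ (leq_trans (size_poly _ _) (sfj j))) mulr_suml.
by apply: eq_bigr => i _; rewrite coef_map.
Qed.

Lemma coef_size_bound (R : nzRingType) (f : {poly {poly R}}) :
  exists n, (size f <= n)%N /\ forall j, (size (f`_j)%R <= n)%N.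
Proof.
exists (size f + \sum_(j < size f) size (f`_j)%R)%N; split=> [|j]; first exact: leq_addr.
have [lt_j|/leq_sizeP/(_ j (leqnn _)) ->] := ltnP j (size f); last by rewrite size_poly0.
by rewrite (bigD1 (Ordinal lt_j)) //= addnCA leq_addr.
Qed.

Section PowerCombination.
Variables (R : comNzRingType) (b v : R).

(* b (b, v)^(d-1), the part of (b, v)^d that is divisible by b *)
Definition bpart (d : nat) : pset R :=
  fun r => exists c : nat -> R, r = \sum_(l < d) c l * b ^+ l.+1 * v ^+ (d - l.+1).

Lemma bpartD d r r' : bpart d r -> bpart d r' -> bpart d (r + r').
Proof.
move=> [c ->] [c' ->]; exists (fun l => c l + c' l).
by rewrite -big_split /=; apply: eq_bigr => l _; rewrite !mulrDl.
Qed.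

Lemma bpartZ d a r : bpart d r -> bpart d (a * r).
Proof.
move=> [c ->]; exists (fun l => a * c l).
by rewrite mulr_sumr; apply: eq_bigr => l _; rewrite !mulrA.
Qed.

Lemma bpart0 d : bpart d 0.
Proof. by exists (fun=> 0); rewrite big1 // => l _; rewrite !mul0r. Qed.

Lemma bpart_mulv d r : bpart d r -> bpart d.+1 (v * r).
Proof.
move=> [c ->]; exists (fun l => if (l < d)%N then c l else 0).
rewrite big_ord_recr /= ltnn !mul0r addr0 mulr_sumr; apply: eq_bigr => l _.
by rewrite ltn_ord subSn ?ltn_ord // [v ^+ _.+1]exprS; ring.
Qed.

Lemma bpart_mulb d r : bpart d r -> bpart d.+1 (b * r).
Proof.
move=> [c ->]; exists (fun l => if l is l'.+1 then c l' else 0).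
rewrite big_ord_recl /= !mul0r add0r mulr_sumr; apply: eq_bigr => l _.
by rewrite /bump /= add1n subSS [b ^+ l.+2]exprS; ring.
Qed.

Lemma bpart_pow d : bpart d.+1 (b * v ^+ d).
Proof.
exists (fun l => if l == 0%N then 1 else 0).
rewrite big_ord_recl /= big1 ?addr0 ?subn1 ?mul1r ?expr1 // => l _.
by rewrite !mul0r.
Qed.

Lemma bpart_monomial t i j :
  bpart (i + j) ((b + t * v) ^+ i * v ^+ j - t ^+ i * v ^+ (i + j)).
Proof.
elim: i => [|i IH]; first by rewrite !expr0 !mul1r subrr; apply: bpart0.
rewrite addSn.
have -> : (b + t * v) ^+ i.+1 * v ^+ j - t ^+ i.+1 * v ^+ (i + j).+1 =
  b * ((b + t * v) ^+ i * v ^+ j - t ^+ i * v ^+ (i + j)) +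
  t * (v * ((b + t * v) ^+ i * v ^+ j - t ^+ i * v ^+ (i + j))) +
  t ^+ i * (b * v ^+ (i + j)) by rewrite !exprS; ring.
apply: bpartD; last by apply/bpartZ/bpart_pow.
by apply: bpartD; [apply: bpart_mulb|apply/bpartZ/bpart_mulv].
Qed.

End PowerCombination.

Section LocalRing.
Variable R : comUnitRingType.
Hypothesis Mid : is_ideal (@max_ideal R).
Local Notation M := (@max_ideal R).

Lemma max_idealP (x : R) : M x <-> ~ (x \is a GRing.unit).
Proof. by rewrite /max_ideal; split=> [/negP|h]; last exact/negP. Qed.

Lemma local_unitD (a x : R) : a \is a GRing.unit -> M x -> a + x \is a GRing.unit.
Proof.
move=> ua Mx; apply: contrapT => /max_idealP Max.
by have := is_idealB Mid Max Mx; rewrite addrK => /max_idealP.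
Qed.

End LocalRing.

Section LocalAlgebra.
Variables (k : fieldType) (R : comUnitAlgType k).
Hypothesis hchar : [pchar k] =i pred0.
Hypothesis Mid : is_ideal (@max_ideal R).
Local Notation M := (@max_ideal R).

Lemma alg_scalar_unit (c : k) : c != 0 -> c%:A \is a @GRing.unit R.
Proof. by move=> c0; apply: (rmorph_unit (in_alg R)); rewrite unitfE. Qed.

(* For a generic b = u - n v, the leading form of f does not vanish at (n, 1),
   so the relation f(u, v) = 0 makes v integral over the ideal (b). *)
Lemma generic_reduction (u v : R) (f : {poly {poly k}}) :
  M u -> M v -> f != 0 -> ev2 u v f = 0 ->
  exists (n d : nat), bpart (u - n%:R * v) v d (v ^+ d).
Proof.
move=> Mu Mv f0 fuv; have [N [sf sfj]] := coef_size_bound f.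
(* [P d] says that [f] has a monomial of total degree [d]; the least such degree is the order of
   [f]. *)
pose P d := [exists i : 'I_N, exists j : 'I_N, ((i + j)%N == d) && (f`_j`_i != 0)].
have exP : exists d, P d.
  have [j fj] : exists j, f`_j != 0.
    by exists (size f).-1; rewrite -lead_coefE lead_coef_eq0.
  have [i fij] : exists i, f`_j`_i != 0.
    by exists (size f`_j).-1; rewrite -lead_coefE lead_coef_eq0.
  have ltj : (j < N)%N.
    rewrite ltnNge; apply: contraNN fj => le_Nj.
    by rewrite nth_default // (leq_trans sf).
  have lti : (i < N)%N.
    rewrite ltnNge; apply: contraNN fij => le_Ni.
    by rewrite nth_default // (leq_trans (sfj j)).
  exists (i + j)%N; apply/existsP; exists (Ordinal lti); apply/existsP.
  by exists (Ordinal ltj); rewrite /= eqxx.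
pose d := ex_minn exP.
have [Pd dmin] : P d /\ forall e, P e -> (d <= e)%N by rewrite /d; case: ex_minnP.
have {dmin} low (i j : 'I_N) : (i + j < d)%N -> f`_j`_i = 0.
  move=> lt_d; apply/eqP; apply: contraTT lt_d => fij; rewrite -leqNgt; apply: dmin.
  by apply/existsP; exists i; apply/existsP; exists j; rewrite eqxx.
(* The leading form of [f], evaluated at (X, 1). *)
pose g : {poly k} := \poly_(i < N) \sum_(j < N) if (i + j == d)%N then f`_j`_i else 0.
have g0 : g != 0.
  have /existsP[i0 /existsP[j0 /andP[/eqP ed fij]]] := Pd.
  apply: contraNneq fij => /polyP/(_ i0); rewrite coef_poly ltn_ord coef0.
  rewrite (bigD1 j0) //= ed eqxx big1 ?addr0 ?eqxx // => [->//|j jj0].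
  by rewrite -ed eqn_add2l (inj_eq val_inj) (negPf jj0).
have [n gn] := poly_nonroot_nat hchar g0.
exists n, d; set b := u - n%:R * v.
have ub : u = b + n%:R * v by rewrite subrK.
have [_ [Madd Mmul]] := Mid.
(* Up to [bpart], [r] is a multiple of [v ^+ d] by a coefficient with residue [a]. Applied to f(u,
   v) = 0, this exhibits a coefficient with residue g(n), hence a unit. *)
pose Z (r a : R) := exists x, bpart b v d (r - x * v ^+ d) /\ max_ideal (x - a).
have ZD r a r' a' : Z r a -> Z r' a' -> Z (r + r') (a + a').
  move=> [x [Ex Mx]] [x' [Ex' Mx']]; exists (x + x'); split.
    by rewrite mulrDl opprD addrACA; apply: bpartD.
  by rewrite opprD addrACA; apply: Madd.
have Z0 : Z 0 0.
  by exists 0; rewrite mul0r !subr0; split; [apply: bpart0|case: Mid].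
have Mmon i j : (0 < i + j)%N -> M (u ^+ i * v ^+ j).
  case: i => [|i] lt0.
    by case: j lt0 => [//|j] _; rewrite expr0 mul1r exprSr; apply: Mmul.
  have -> : u ^+ i.+1 * v ^+ j = (u ^+ i * v ^+ j) * u by rewrite exprSr; ring.
  exact: Mmul.
have Zij (i j : 'I_N) : Z ((f`_j`_i)%:A * u ^+ i * v ^+ j)
    (if (i + j == d)%N then f`_j`_i * n%:R ^+ i else 0)%:A.
  have [ed|nd] := eqVneq (i + j)%N d.
    exists (f`_j`_i * n%:R ^+ i)%:A; rewrite subrr; split; last by case: Mid.
    rewrite -!in_algE rmorphM rmorphXn rmorph_nat -!mulrA -mulrBr -ed {1}ub.
    exact/bpartZ/bpart_monomial.
  have [lt_d|] := ltnP (i + j)%N d.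
    by rewrite low // !scale0r !mul0r.
  rewrite leq_eqVlt eq_sym (negPf nd) /= => gt_d.
  (* A monomial of degree above [d] is one of degree [d] times an element of M, so its coefficient
     has residue 0. *)
  have [i' [j' [le_i le_j e]]] : exists i' j', [/\ (i' <= i)%N, (j' <= j)%N & (i' + j' = d)%N].
    have [le_di|lt_id] := leqP d i; first by exists d, 0%N; rewrite addn0.
    by exists i, (d - i)%N; split=> //; lia.
  set w := (f`_j`_i)%:A * (u ^+ (i - i') * v ^+ (j - j')).
  exists (w * n%:R ^+ i'); rewrite scale0r subr0; split; last first.
    rewrite mulrC; apply/Mmul/Mmul/Mmon.
    by rewrite -(subnK le_i) -(subnK le_j) -e in gt_d; lia.
  rewrite (exprnBM u le_i) (exprnBM v le_j).
  have -> : (f`_j`_i)%:A * (u ^+ (i - i') * u ^+ i') * (v ^+ (j - j') * v ^+ j') -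
      w * n%:R ^+ i' * v ^+ d = w * (u ^+ i' * v ^+ j' - n%:R ^+ i' * v ^+ (i' + j')).
    by rewrite e /w; ring.
  by rewrite {1}ub -{1}e; apply/bpartZ/bpart_monomial.
have ZS : Z (ev2 u v f) (g.[n%:R])%:A.
  rewrite (ev2E _ _ sf sfj) horner_poly scaler_suml exchange_big /=.
  elim/big_rec2: _ => // i a r _; apply: (ZD).
  rewrite mulr_suml scaler_suml; elim/big_rec2: _ => // j a' r' _; apply: (ZD).
  have := Zij i j; case: ifP => _ //; by rewrite mul0r.
have [x [Ex Mx]] := ZS; rewrite fuv sub0r in Ex.
have ux : x \is a GRing.unit.
  by rewrite -[x](subrKC (g.[n%:R])%:A); apply: local_unitD => //; apply: alg_scalar_unit.
have -> : v ^+ d = - x^-1 * (- (x * v ^+ d)) by rewrite mulrNN mulKr.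
exact: bpartZ.
Qed.

(** Each term of v^d has a factor b, so b z = 0 forces (v z)^(d+1) = 0. Thus annihilators do not
    grow when generators are replaced by the generic b. *)
Lemma bpart_annihilator (b v z : R) d : reduced R -> bpart b v d (v ^+ d) ->
  b * z = 0 -> v * z = 0.
Proof.
move=> Rred [c e] bz; apply: (Rred _ d.+1).
rewrite exprMn exprS e mulr_sumr mulr_suml big1 // => l _.
rewrite [z ^+ _]exprS exprS.
have -> : v * (c l * (b * b ^+ l) * v ^+ (d - l.+1)) * (z * z ^+ d) =
  v * c l * b ^+ l * v ^+ (d - l.+1) * z ^+ d * (b * z) by ring.
by rewrite bz mulr0.
Qed.

End LocalAlgebra.

(** Dividing the relation for v^d by b^d gives a monic equation for v / b. *)
Lemma bpart_integral (R Q : comUnitRingType) (iota : {rmorphism R -> Q}) (b v : R) d :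
  iota b \is a GRing.unit -> bpart b v d (v ^+ d) ->
  integralOver iota (iota v / iota b).
Proof.
move=> ub [c e].
apply: (@integral_closed_eq _ _ iota d (fun i => iota (c (d - i.+1)%N))).
  by move=> i _; apply: integral_id.
apply: (mulIr (unitrX d ub)); rewrite -exprMn divrK // -rmorphXn e rmorph_sum mulr_suml.
rewrite (reindex_inj rev_ord_inj) /=; apply: eq_bigr => i _.
have lt_id := ltn_ord i.
rewrite !rmorphM !rmorphXn subnSK // subKn 1?ltnW //.
rewrite (exprnBM (iota b) (ltnW lt_id)) exprMn exprVn -!mulrA; congr (_ * _).
rewrite mulrC; congr (_ * _).
by rewrite mulrCA mulVr ?mulr1 // unitrX.
Qed.

Lemma integral_overP (R Q : comUnitRingType) (iota : R -> Q) q :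
  integral_over iota q <-> integralOver iota q.
Proof.
by split=> [[p [pmon pq]]|[p pmon /rootP pq]]; exists p => //; apply/rootP.
Qed.

Section LocalRingOfCurve.
Variables (k : fieldType) (A : comAlgType k) (m : pset A).
Variables (R : comUnitAlgType k) (phi : A -> R).
Variables (Q : comUnitRingType) (iota : R -> Q).
Hypothesis hchar : [pchar k] =i pred0.
Hypotheses (hfg : fin_gen_alg A) (hred : reduced A) (hpure : pure_dim_one A).
Hypothesis (hm : is_maximal_ideal m).
Hypothesis (hloc : is_localization_at m phi) (hQ : is_total_fractions iota).

Local Notation M := (@max_ideal R).

Let phiD : forall x y, phi (x + y) = phi x + phi y. Proof. by case: hloc => -[]. Qed.
Let phiM : forall x y, phi (x * y) = phi x * phi y. Proof. by case: hloc => -[_ []]. Qed.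
Let phi1 : phi 1 = 1. Proof. by case: hloc => -[_ [_ []]]. Qed.
Let phiZ : forall c x, phi (c *: x) = c *: phi x. Proof. by case: hloc => -[_ [_ []]]. Qed.
Definition loc_morph : {rmorphism A -> R} := rmorphism_of phiD phiM phi1.

Let iotaD : forall x y, iota (x + y) = iota x + iota y. Proof. by case: hQ. Qed.
Let iotaM : forall x y, iota (x * y) = iota x * iota y. Proof. by case: hQ => _ []. Qed.
Let iota1 : iota 1 = 1. Proof. by case: hQ => _ [_ []]. Qed.
Definition frac_morph : {rmorphism R -> Q} := rmorphism_of iotaD iotaM iota1.

Let phi' := loc_morph.
Let iota' := frac_morph.
Let mpr := maximal_ideal_prime hm.

Lemma loc_unit s : ~ m s -> phi s \is a GRing.unit.
Proof. by case: hloc => _ [h _]; apply: h. Qed.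

Lemma loc_frac r : exists a s, ~ m s /\ r = phi a / phi s.
Proof. by case: hloc => _ [_ [h _]]; apply: h. Qed.

Lemma loc_eq0 a : phi a = 0 -> exists s, ~ m s /\ s * a = 0.
Proof. by case: hloc => _ [_ [_ h]]; apply: h. Qed.

Lemma loc_max a : M (phi a) <-> m a.
Proof.
split=> [/max_idealP nu|ma]; first by apply: contrapT => /loc_unit.
apply/max_idealP => ua; have [b [s [nms e]]] := loc_frac (phi a)^-1.
have [[[m0 [madd mmul]] _] mprime] := mpr.
have /loc_eq0[t [nmt te]] : phi (a * b - s) = 0.
  rewrite -[phi]/(phi' : A -> R) rmorphB rmorphM /=; apply/eqP; rewrite subr_eq0.
  have -> : phi b = (phi a)^-1 * phi s by rewrite e divrK ?loc_unit.
  by rewrite mulrA mulrV // mul1r.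
have mts : m (t * s).
  have -> : t * s = (t * b) * a - t * (a * b - s) by ring.
  by rewrite te subr0; apply: mmul.
by case: (mprime _ _ mts).
Qed.

Lemma loc_max_frac r : M r -> exists a s, [/\ m a, ~ m s & r = phi a / phi s].
Proof.
move=> Mr; have [a [s [nms e]]] := loc_frac r; exists a, s; split=> //.
apply/loc_max/max_idealP => ua; move/max_idealP: Mr; apply.
by rewrite e unitrM ua unitrV loc_unit.
Qed.

Lemma loc_max_ideal : is_ideal M.
Proof.
have [[[m0 [madd mmul]] m1] mprime] := mpr.
have nmM s t : ~ m s -> ~ m t -> ~ m (s * t) by move=> ns nt /mprime[].
have Mfrac a s : m a -> ~ m s -> M (phi a / phi s).
  move=> ma nms; have us := loc_unit nms; apply/max_idealP; rewrite unitrMl ?unitrV //.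
  exact/max_idealP/loc_max.
split; first by apply/max_idealP; rewrite unitr0.
split=> [r r' /loc_max_frac[a [s [ma nms ->]]] /loc_max_frac[b [t [mb nmt ->]]]|].
  have us := loc_unit nms; have ut := loc_unit nmt.
  have -> : phi a / phi s + phi b / phi t = phi (t * a + s * b) / phi (s * t).
    rewrite phiD !phiM invrM // mulrDl; congr (_ + _).
      by rewrite mulrAC -mulrA mulrC mulrA mulVKr.
    by rewrite mulrA -[_ * _ / phi t]mulrA [phi s * _]mulrC mulrK.
  by apply: Mfrac; [apply: madd; apply: mmul|apply: nmM].
move=> r r' /loc_max_frac[a [s [ma nms ->]]]; have [b [t [nmt ->]]] := loc_frac r.
have us := loc_unit nms; have ut := loc_unit nmt.
have -> : phi b / phi t * (phi a / phi s) = phi (b * a) / phi (s * t).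
  by rewrite !phiM invrM // mulrACA.
by apply: Mfrac; [apply: mmul|apply: nmM].
Qed.

Lemma loc_reduced : reduced R.
Proof.
move=> r n rn0; have [a [s [nms er]]] := loc_frac r; have us := loc_unit nms.
have /loc_eq0[t [nmt ta]] : phi (a ^+ n) = 0.
  have -> : phi (a ^+ n) = (r * phi s) ^+ n by rewrite er divrK // -(rmorphXn phi').
  by rewrite exprMn rn0 mul0r.
suff h : t * a = 0.
  have ut := loc_unit nmt; have := congr1 phi' h; rewrite rmorphM rmorph0 /= => h'.
  by rewrite er -[phi a](mulKr ut) h' mulr0 mul0r.
case: n {rn0} ta => [|n] ta.
  by move: nmt; rewrite -[t]mulr1 -(expr0 a) ta; case: mpr => -[[]].
by apply: (hred (n := n.+1)); rewrite exprMn [t ^+ _]exprSr -mulrA ta mulr0.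
Qed.

(** If M were zero, every element of m would be killed by an element outside m; m would then be a
    minimal prime, and A / m, a field, would have dimension one. *)
Lemma loc_max_nonzero : exists y, M y /\ y <> 0.
Proof.
apply: contrapT => h.
have mphi a : m a -> exists s, ~ m s /\ s * a = 0.
  by move=> ma; apply: loc_eq0; apply: contrapT => a0; apply: h; exists (phi a); split=> //; apply/loc_max.
have [|[c [[cpr cstr] c0]] _] := hpure (P := m).
  split=> // -[P [[[Pid P1] Pprime] [Pm [a [ma nPa]]]]].
  have [s [nms sa]] := mphi a ma.
  have [|Ps|//] := Pprime s a; first by rewrite sa; case: Pid.
  exact/nms/Pm.
have [mc [a [ca nma]]] := cstr 0%N isT; rewrite c0 in mc nma.
by apply: nma; apply: (hm.2 (c 1%N)) => //; case: (cpr 1%N isT).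
Qed.

Lemma loc_ev2 u v (f : {poly {poly k}}) : phi (ev2 u v f) = ev2 (phi u) (phi v) f.
Proof.
have [n [sf sfj]] := coef_size_bound f.
rewrite !(ev2E _ _ sf sfj) -[phi]/(phi' : A -> R) rmorph_sum; apply: eq_bigr => j _.
rewrite rmorph_sum; apply: eq_bigr => i _.
by rewrite !(rmorphM, rmorphXn) /= phiZ phi1.
Qed.

Lemma loc_dependent u v : exists2 f, f != 0 & ev2 (phi u) (phi v) f = 0.
Proof.
have [f f0 e] := algebraically_dependent hchar hfg u v hpure.
by exists f => //; rewrite -loc_ev2 e -[phi]/(phi' : A -> R) rmorph0.
Qed.

Lemma loc_generic_reduction u v : m u -> m v ->
  exists w d, m w /\ bpart (phi w) (phi v) d (phi v ^+ d) /\
    exists n : nat, phi u = phi w + n%:R * phi v.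
Proof.
move=> mu mv; have [f f0 fuv] := loc_dependent u v.
have [n [d nd]] := generic_reduction hchar loc_max_ideal
  (proj2 (loc_max u) mu) (proj2 (loc_max v) mv) f0 fuv.
have [[mid _] _] := mpr; have [_ [_ mmul]] := mid.
have e : phi (u - n%:R * v) = phi u - n%:R * phi v.
  by rewrite -[phi]/(phi' : A -> R) rmorphB rmorphM rmorph_nat.
exists (u - n%:R * v), d; split; first by apply: is_idealB => //; apply: mmul.
by rewrite e; split=> //; exists n; rewrite subrK.
Qed.

Lemma loc_max_gen : exists ms : seq A, (forall a, a \in ms -> m a) /\
  forall I : pset R, is_ideal I -> (forall a, a \in ms -> I (phi a)) ->
    forall y, M y -> I y.
Proof.
have [ms [msm msI]] := maximal_ideal_fin_gen hchar hfg hm.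
exists ms; split=> // I Iid Ims y /loc_max_frac[a [s [ma nms ->]]].
have [I0 [Iadd Imul]] := Iid; rewrite mulrC; apply: (Imul).
apply: (msI (fun a => I (phi a))) => //; split.
  by rewrite -[phi]/(phi' : A -> R) rmorph0.
by split=> [x z Ix Iz|r x Ix]; [rewrite phiD; apply: Iadd|rewrite phiM; apply: Imul].
Qed.

(** A generic combination of generators is annihilated only by elements z with M z = 0. Such a z
    cannot be a unit as M is nonzero, and if it lies in M then z^2 = 0. *)
Lemma loc_max_nzd : exists xi, m xi /\ nonzerodivisor (phi xi).
Proof.
have [ms [msm msI]] := loc_max_gen.
have [xi [mxi xiP]] : exists xi, m xi /\ forall z, phi xi * z = 0 ->
    forall a, a \in ms -> phi a * z = 0.
  elim: ms msm {msI} => [|a l IH] lm.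
    by exists 0; split=> //; case: mpr => -[[]].
  have [|xi [mxi xiP]] := IH; first by move=> b bl; apply: lm; rewrite inE bl orbT.
  have ma : m a by apply: lm; rewrite mem_head.
  have [w [d [mw [wd [n e]]]]] := loc_generic_reduction mxi ma.
  exists w; split=> // z wz.
  have az := bpart_annihilator loc_reduced wd wz.
  move=> b; rewrite inE => /orP[/eqP ->//|bl]; apply: xiP => //.
  by rewrite e mulrDl wz -mulrA az mulr0 addr0.
exists xi; split=> // z xiz.
have annM y : M y -> y * z = 0.
  apply: (msI (fun y => y * z = 0)) => [|a /(xiP z xiz)//]; split; first by rewrite mul0r.
  by split=> [x x' h h'|r x h]; [rewrite mulrDl h h' addr0|rewrite -mulrA h mulr0].
have [uz|/negP/max_idealP Mz] := boolP (z \is a GRing.unit).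
  have [y [My y0]] := loc_max_nonzero; case: y0.
  by apply: (mulIr uz); rewrite mul0r; apply: annM.
by apply: (loc_reduced (n := 2)); rewrite expr2; apply: annM.
Qed.

Lemma frac_unit r : nonzerodivisor r -> iota r \is a GRing.unit.
Proof. by case: hQ => _ [_ [_ [h _]]]; apply: h. Qed.

(** This gives M S = x S. Starting from a nonzerodivisor, the generators a are absorbed one at a
    time: for the new element w, a / w is integral and xi / w = 1 + n (a / w), so the quotients
    already known to be integral over xi stay so over w. *)
Lemma loc_minimal_reduction : exists xi, [/\ m xi, nonzerodivisor (phi xi) &
  forall y, M y -> integralOver iota' (iota y / iota (phi xi))].
Proof.
have [ms [msm msI]] := loc_max_gen; have [xi0 [mxi0 nzd0]] := loc_max_nzd.
have [xi [mxi nzd xiP]] : exists xi, [/\ m xi, nonzerodivisor (phi xi) &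
    forall a, a \in ms -> integralOver iota' (iota (phi a) / iota (phi xi))].
  elim: ms msm {msI} => [|a l IH] lm; first by exists xi0.
  have [|xi [mxi nzd xiP]] := IH; first by move=> b bl; apply: lm; rewrite inE bl orbT.
  have ma : m a by apply: lm; rewrite mem_head.
  have [w [d [mw [wd [n e]]]]] := loc_generic_reduction mxi ma.
  have nzdw : nonzerodivisor (phi w).
    move=> z wz; apply: nzd.
    by rewrite e mulrDl wz -mulrA (bpart_annihilator loc_reduced wd wz) mulr0 addr0.
  have uw := frac_unit nzdw; have ux := frac_unit nzd.
  have aw : integralOver iota' (iota (phi a) / iota (phi w)) := bpart_integral (iota := iota') uw wd.
  exists w; split=> // b; rewrite inE => /orP[/eqP ->//|bl].
  have -> : iota (phi b) / iota (phi w) =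
      iota (phi b) / iota (phi xi) * (1 + n%:R * (iota (phi a) / iota (phi w))).
    have -> : 1 + n%:R * (iota (phi a) / iota (phi w)) = iota (phi xi) / iota (phi w).
      rewrite e -[iota]/(iota' : R -> Q) rmorphD rmorphM rmorph_nat mulrDl divrr //.
      by rewrite mulrA.
    by rewrite mulrA divrK.
  apply: integral_mul; first exact: xiP.
  apply: integral_add; first exact: integral1.
  by apply: integral_mul => //; apply: integral_nat.
exists xi; split=> //.
apply: (msI (fun y => integralOver iota' (iota y / iota (phi xi)))) => //; split.
  by rewrite -[iota]/(iota' : R -> Q) rmorph0 mul0r; apply: integral0.
split=> [y y' iy iy'|r y iy].
  by rewrite iotaD mulrDl; apply: integral_add.
by rewrite iotaM -mulrA; apply: integral_mul => //; apply: (integral_id iota').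
Qed.

End LocalRingOfCurve.

(** * Extension of derivations *)

Section SeparableRelation.
Variables (C : idomainType) (B : comNzRingType) (ev : {rmorphism C -> B}).
Variables (J : pset B) (u : B).
Hypothesis Jmul : forall (r : {poly C}) b, J b -> J (polyev ev u r * b).
Hypothesis Jrad : forall b n, J (b ^+ n) -> J b.
Hypothesis chC : [pchar C] =i pred0.

Lemma deriv_neq0 (p : {poly C}) : (1 < size p)%N -> p^`() != 0.
Proof.
move=> sp; apply/eqP => /polyP/(_ (size p).-2); rewrite coef0 coef_deriv.
have -> : (size p).-2.+1 = (size p).-1 by lia.
rewrite -lead_coefE -mulr_natr => /eqP; rewrite mulf_eq0 lead_coef_eq0.
by rewrite -size_poly_eq0 ((pcharf0P _).1 chC); lia.
Qed.

(** A relation q of least degree is square-free: if g^2 divides q, dropping one factor g gives a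
    polynomial whose square is a multiple of q, up to constants, hence a relation as [J] is radical.
    In characteristic 0 it is therefore separable. *)
Lemma separable_relation (p : {poly C}) : p != 0 -> J (polyev ev u p) ->
  exists p : {poly C}, [/\ p != 0, separable_poly p & J (polyev ev u p)].
Proof.
move=> p0 Jp.
pose Pn n := `[< exists q : {poly C}, [/\ size q = n, q != 0 & J (polyev ev u q)] >].
have exP : exists n, Pn n by exists (size p); apply/asboolP; exists p.
case: (ex_minnP exP) => n /asboolP[q [sq q0 Jq]] qmin.
exists q; split=> //; apply/separable_polyP; split=> [a b abq|a _]; last exact: deriv_neq0.
rewrite /coprimep; set g := gcdp a b.
have /Pdiv.Idomain.dvdpP[[c r] /= c0 e] : g * g %| q.
  by apply: dvdp_trans abq; apply: dvdp_mul; [apply: dvdp_gcdl|apply: dvdp_gcdr].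
have rgg0 : r * (g * g) != 0 by rewrite -e scale_poly_eq0 negb_or c0.
have [r0 g0] : r != 0 /\ g != 0.
  by move: rgg0; rewrite !mulf_eq0 !negb_or => /and3P[].
apply: contraT => sg1.
have sg : (1 < size g)%N by rewrite ltn_neqAle eq_sym sg1 lt0n size_poly_eq0.
have Jrg : J (polyev ev u (r * g)).
  apply: (Jrad (n := 2)); rewrite -rmorphXn.
  have -> : (r * g) ^+ 2 = r * c%:P * q by rewrite -mulrA mul_polyC e; ring.
  by rewrite rmorphM; apply: Jmul.
have : (n <= size (r * g)%R)%N by apply: qmin; apply/asboolP; exists (r * g); rewrite mulf_neq0.
have := size_scale q c0; rewrite e !size_mul ?mulf_neq0 // sq.
rewrite -size_poly_gt0 in r0; lia.
Qed.

End SeparableRelation.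

Definition der_over (C B : nzRingType) (ev : C -> B) (d : C -> B) :=
  forall a b, d (a * b) = ev a * d b + ev b * d a.

Section AdditiveOf.
Variables (U V : zmodType) (f : U -> V).
Hypothesis fD : forall x y, f (x + y) = f x + f y.

Fact additive_of_zmod : zmod_morphism f.
Proof. by move=> x y; apply: (addIr (f y)); rewrite -fD !subrK. Qed.

Definition additive_of : {additive U -> V} :=
  HB.pack f (GRing.isZmodMorphism.Build U V f additive_of_zmod).

End AdditiveOf.

Section PolynomialDerivation.
Variables (C B : comNzRingType) (ev : {rmorphism C -> B}) (d : {additive C -> B}).
Hypothesis dM : der_over ev d.
Variables (y z : B).

Definition poly_der (g : {poly C}) : B :=
  (map_poly d g).[y] + z * polyev ev y g^`().

Lemma poly_derD f g : poly_der (f + g) = poly_der f + poly_der g.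
Proof. by rewrite /poly_der derivD !rmorphD raddfD hornerD /=; ring. Qed.

Lemma poly_derC c : poly_der c%:P = d c.
Proof.
rewrite /poly_der derivC rmorph0 mulr0 addr0.
by rewrite (map_polyC d) hornerC.
Qed.

Lemma der_over1 : d 1 = 0.
Proof.
have := dM 1 1; rewrite mulr1 rmorph1 !mul1r => /eqP.
by rewrite -subr_eq0 opprD addNKr oppr_eq0 => /eqP.
Qed.

Lemma poly_derX : poly_der 'X = z.
Proof.
rewrite /poly_der derivX rmorph1 mulr1.
suff -> : map_poly d 'X = 0 by rewrite horner0 add0r.
apply/polyP => i; rewrite coef_map coefX coef0 /=.
by case: eqP => _; rewrite ?der_over1 ?raddf0.
Qed.

Lemma poly_derM : der_over (polyev ev y) poly_der.
Proof.
move=> f g; rewrite /poly_der derivM rmorphD !rmorphM /=.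
have -> : map_poly d (f * g) = map_poly ev f * map_poly d g + map_poly d f * map_poly ev g.
  apply/polyP => i; rewrite coefD coef_map !coefM raddf_sum -big_split /=.
  by apply: eq_bigr => j _; rewrite dM !coef_map /=; ring.
by rewrite hornerD !hornerM !polyevE; ring.
Qed.

End PolynomialDerivation.

Lemma poly_der_unique (C B : comNzRingType) (ev : {rmorphism C -> B})
  (d : {additive C -> B}) (dM : der_over ev d) (y : B) (e : {additive {poly C} -> B}) :
  der_over (polyev ev y) e -> (forall c, e c%:P = d c) ->
  forall f, e f = poly_der ev d y (e 'X) f.
Proof.
move=> eM ed; elim/poly_ind => [|f c IH].
  by rewrite raddf0 -polyC0 poly_derC raddf0.
rewrite raddfD eM poly_derD poly_derC ed; congr (_ + _).
by rewrite (poly_derM dM) poly_derX // IH.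
Qed.

Section ExtendDerivation.
Variables (C : idomainType) (L : fieldType) (ev : {rmorphism C -> L}).
Variable d : {additive C -> L}.
Hypothesis dM : der_over ev d.
Hypothesis dker : forall c, ev c = 0 -> d c = 0.
Hypothesis chL : [pchar L] =i pred0.

(** A relation [m] of least degree determines the value at 'X, since its derivative does not vanish
    at y. Pseudo-division by [m] leaves a remainder with coefficients in the kernel of [ev], which
    [d] kills, so every relation is sent to zero. *)
Lemma extend_derivation (y : L) (p : {poly C}) :
  map_poly ev p != 0 -> polyev ev y p = 0 ->
  exists e : {additive {poly C} -> L}, [/\ der_over (polyev ev y) e,
    forall c, e c%:P = d c & forall g, polyev ev y g = 0 -> e g = 0].
Proof.
move=> p0 py.
(* As [ev] may have a kernel, the degree is only meaningful for polynomials whose leading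
   coefficient survives [ev]. *)
pose good (g : {poly C}) := ev (lead_coef g) != 0 /\ polyev ev y g = 0.
have trunc (g : {poly C}) : map_poly ev g != 0 -> polyev ev y g = 0 ->
    exists g', good g' /\ (size g' <= size g)%N.
  move=> g0 gy; pose n := (size (map_poly ev g)).-1.
  have sg : size (map_poly ev g) = n.+1 by rewrite /n prednK // lt0n size_poly_eq0.
  have ln : ev g`_n != 0 by rewrite -coef_map /n -lead_coefE lead_coef_eq0.
  have e : map_poly ev (\poly_(i < n.+1) g`_i) = map_poly ev g.
    apply/polyP => i; rewrite [LHS]coef_map [RHS]coef_map /= coef_poly.
    case: ltnP => // le_i.
    have gi : ev g`_i = 0 by rewrite -coef_map nth_default // sg.
    by rewrite gi rmorph0.
  have s' : size (\poly_(i < n.+1) g`_i) = n.+1.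
    by rewrite size_poly_eq //; apply: contraNneq ln => ->; rewrite rmorph0.
  exists (\poly_(i < n.+1) g`_i); split; last by rewrite s' -sg size_poly.
  by split; [rewrite lead_coefE s' coef_poly ltnSn|rewrite polyevE e].
pose Pn n := `[< exists g, good g /\ size g = n >].
have exP : exists n, Pn n.
  by have [g [gg _]] := trunc p p0 py; exists (size g); apply/asboolP; exists g.
case: (ex_minnP exP) => n /asboolP[m [[lm my] sm]] mmin.
have small (g : {poly C}) : (size g < n)%N -> polyev ev y g = 0 -> map_poly ev g = 0.
  move=> lt_g gy; apply/eqP; apply: contraTT lt_g => g0; rewrite -leqNgt.
  have [g' [gg' sg']] := trunc g g0 gy; apply: leq_trans sg'; apply: mmin.
  by apply/asboolP; exists g'.
have m0 : m != 0 by apply: contraNneq lm => ->; rewrite lead_coef0 rmorph0.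
have sm1 : (1 < size m)%N.
  rewrite ltnNge; apply/negP => /size1_polyC em; move: my lm.
  by rewrite em polyevC lead_coefC => ->; rewrite eqxx.
have m'y : polyev ev y m^`() != 0.
  apply/eqP => m'0.
  have lt_m' : (size m^`() < n)%N by rewrite -sm lt_size_deriv.
  have /polyP/(_ (size m).-2) := small _ lt_m' m'0.
  rewrite coef_map coef0 coef_deriv /=.
  have -> : (size m).-2.+1 = (size m).-1 by lia.
  rewrite -lead_coefE rmorphMn -mulr_natr => /eqP; rewrite mulf_eq0 (negPf lm) /=.
  by rewrite ((pcharf0P _).1 chL); case: (size m) sm1 => [|[|?]].
pose z := - (map_poly d m).[y] / polyev ev y m^`().
pose e := additive_of (poly_derD ev d y z).
exists e; split; [exact: poly_derM|exact: poly_derC|].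
have em : e m = 0 by rewrite /e /= /poly_der /z divfK // subrr.
move=> g gy; have := Pdiv.Idomain.divp_eq g m.
set c := _ ^+ _; set q := (g %/ m)%R; set r := (g %% m)%R => eg.
have ry : polyev ev y r = 0.
  have := congr1 (polyev ev y) eg.
  by rewrite -mul_polyC rmorphD !rmorphM gy my !mulr0 add0r.
have er : e r = 0.
  have r0 : map_poly ev r = 0 by apply: small => //; rewrite -sm ltn_modpN0.
  rewrite /e /= /poly_der polyevE -deriv_map r0 deriv0 horner0 mulr0 addr0.
  suff -> : map_poly d r = 0 by rewrite horner0.
  by apply/polyP => i; rewrite coef_map coef0; apply: dker; rewrite -coef_map r0 coef0.
have := congr1 e eg; rewrite -mul_polyC raddfD er addr0.
rewrite [e (_ * _)](poly_derM dM) [e (_ * m)](poly_derM dM) -![poly_der _ _ _ _ _]/(e _).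
rewrite em gy my mulr0 !mul0r !addr0 polyevC => /eqP; rewrite mulf_eq0 => /orP[|/eqP //].
by rewrite rmorphXn expf_eq0 (negPf lm) andbF.
Qed.

End ExtendDerivation.

Lemma reduced_prime_avoiding (Q : comNzRingType) (q : Q) : reduced Q -> q <> 0 ->
  exists2 P, is_prime_ideal P & ~ P q.
Proof.
move=> Qred q0.
have [||||P [Ppr _ Pq]] := @prime_avoiding Q (fun a => a = 0) (fun a => exists n, a = q ^+ n).
- by split=> //; split=> [x y -> ->|r x ->]; rewrite ?addr0 ?mulr0.
- by exists 0%N.
- by move=> _ _ [n ->] [n' ->]; exists (n + n')%N; rewrite exprD.
- by move=> _ -> [n /esym /Qred].
by exists P => // /Pq[]; exists 1%N.
Qed.

Definition residue_field (A : comNzRingType) (P : pset A) (Ppr : is_prime_ideal P) :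
  fieldType := {fraction (prime_quotient Ppr)}.

Definition residue_map (A : comNzRingType) (P : pset A) (Ppr : is_prime_ideal P) :
  {rmorphism A -> residue_field Ppr} :=
  @tofrac (prime_quotient Ppr) \o prime_proj Ppr.

Lemma residue_map_eq0 (A : comNzRingType) (P : pset A) (Ppr : is_prime_ideal P) a :
  residue_map Ppr a = 0 <-> P a.
Proof.
rewrite -(prime_proj_eq0 Ppr) /residue_map /=; split=> [/eqP|->]; last exact: rmorph0.
by rewrite tofrac_eq0 => /eqP.
Qed.

Section DerivationOfReducedRing.
Variables (C : idomainType) (Q : comUnitRingType) (ev : {rmorphism C -> Q}).
Variable d : {additive C -> Q}.
Hypothesis dM : der_over ev d.
Hypothesis Qred : reduced Q.
Hypothesis chQ : forall n : nat, (0 < n)%N -> n%:R \is a @GRing.unit Q.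
Hypothesis evU : forall c, c != 0 -> ev c \is a GRing.unit.
Hypothesis alg : forall q, exists2 f : {poly C}, f != 0 & polyev ev q f = 0.

Let chC : [pchar C] =i pred0.
Proof.
move=> p; apply/negP => /andP[pp /eqP p0]; have := chQ (prime_gt0 pp).
by rewrite -(rmorph_nat ev) p0 rmorph0 unitr0.
Qed.

Lemma separable_relation_unit q :
  exists2 f : {poly C}, polyev ev q f = 0 & polyev ev q f^`() \is a GRing.unit.
Proof.
have [f f0 fq] := alg q.
have [||f1 [f10 sep f1q]] := @separable_relation C Q ev (fun a => a = 0) q _ _ chC f f0 fq.
- by move=> r b ->; rewrite mulr0.
- by move=> b n; apply: Qred.
exists f1 => //; move: sep; rewrite unlock => /Bezout_coprimepP[[u v] /=].
case/eqpP => -[c1 c2] /= /andP[c10 c20] e.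
have := congr1 (polyev ev q) e; rewrite -!mul_polyC mulr1 !rmorphM rmorphD !rmorphM f1q.
rewrite mulr0 add0r !polyevC => e'.
by have := evU c20; rewrite -e' !unitrM => /and3P[].
Qed.

(** Two variables suffice because additivity and the Leibniz rule involve only y1, y2, their sum and
    their product. The final identity shows that the value on y = G(y1, y2) is forced by any
    relation for y whose derivative at y has nonzero residue, and so does not depend on y1, y2 and
    G. *)
Lemma relation_derivation_mod (P : pset Q) (Ppr : is_prime_ideal P) (y1 y2 : Q) :
  exists D : {additive {poly {poly C}} -> residue_field Ppr},
    der_over (residue_map Ppr \o polyev (polyev ev y1) y2) D /\
    forall G f, polyev ev (polyev (polyev ev y1) y2 G) f = 0 ->
      residue_map Ppr (map_poly d f).[polyev (polyev ev y1) y2 G] +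
      D G * residue_map Ppr (polyev ev (polyev (polyev ev y1) y2 G) f^`()) = 0.
Proof.
set pi := residue_map Ppr; set L := residue_field Ppr in pi *.
pose evL : {rmorphism C -> L} := pi \o ev.
pose dL : {additive C -> L} := pi \o d.
have piev y f : pi (polyev ev y f) = polyev evL (pi y) f.
  by rewrite !polyevE -(horner_map pi) -map_poly_comp.
have evL0 c : c != 0 -> evL c != 0.
  move=> c0; have u : evL c \is a GRing.unit := rmorph_unit pi (evU c0).
  by apply/eqP => e; rewrite e unitr0 in u.
have chL : [pchar L] =i pred0.
  move=> p; apply/negP => /andP[pp /eqP p0]; have := rmorph_unit pi (chQ (prime_gt0 pp)).
  by rewrite rmorph_nat p0 unitr0.
have dLM : der_over evL dL.
  move=> a b; rewrite -[dL _]/(pi (d (a * b))) dM.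
  by rewrite (rmorphD pi) (rmorphM pi (ev a)) (rmorphM pi (ev b)).
have dLker c : evL c = 0 -> dL c = 0.
  by have [->|/evL0/eqP h /h] := eqVneq c 0; rewrite ?raddf0.
have algL q : exists2 f : {poly C}, map_poly evL f != 0 & polyev evL (pi q) f = 0.
  have [f f0 fq] := alg q; exists f; last by rewrite -piev fq rmorph0.
  apply/eqP => /polyP/(_ (size f).-1); rewrite coef_map coef0 => /eqP.
  by apply/negP/evL0; rewrite -lead_coefE lead_coef_eq0.
have [f1 f10 f1y] := algL y1; have [f2 f20 f2y] := algL y2.
have [D1 [D1M D1C D1ker]] := extend_derivation dLM dLker chL f10 f1y.
have [|| D [DM DC Dker]] := @extend_derivation _ _ _ D1 D1M D1ker chL (pi y2) (map_poly polyC f2).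
- rewrite -map_poly_comp; apply: contraNneq f20 => e; rewrite -e; apply/eqP/eq_map_poly => c.
  by rewrite /= polyevC.
- rewrite polyevE -map_poly_comp -f2y polyevE; congr (_.[_]); apply: eq_map_poly => c.
  by rewrite /= polyevC.
have ev2 G : pi (polyev (polyev ev y1) y2 G) = polyev (polyev evL (pi y1)) (pi y2) G.
  rewrite [X in pi X]polyevE -(horner_map pi) -map_poly_comp polyevE; congr (_.[_]).
  by apply: eq_map_poly => c; apply: piev.
exists D; split=> [a b|G f]; first by rewrite DM -!ev2.
set y := polyev _ _ G => fG.
pose cc : {rmorphism C -> {poly {poly C}}} := polyC \o polyC.
pose s := polyev cc G.
(* [s f] is [f] with [G] substituted for its variable: a relation for y becomes a relation between
   y1 and y2, which [D] kills. *)
pose F := polyev (polyev evL (pi y1)) (pi y2).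
have es h : F (s h) = polyev evL (pi y) h.
  rewrite [X in F X]polyevE -(horner_map F) -map_poly_comp /y ev2 [RHS]polyevE.
  by congr (_.[_]); apply: eq_map_poly => c; rewrite /= /F !polyevC.
pose e : {additive {poly C} -> L} := D \o s.
have eM : der_over (polyev evL (pi y)) e.
  by move=> a b; rewrite -[e _]/(D (s (a * b))) rmorphM DM -/F !es.
have eC c : e c%:P = dL c by rewrite /e /= /s polyevC /= DC D1C.
have := Dker (s f); rewrite -/F es -piev fG rmorph0 => /(_ erefl).
rewrite -[D (s f)]/(e f) (poly_der_unique dLM eM eC) /poly_der.
rewrite -[e 'X]/(D (s 'X)) [X in D X]polyevX -piev => H.
have -> : pi (map_poly d f).[y] = (map_poly dL f).[pi y].
  by rewrite -(horner_map pi) -map_poly_comp.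
exact: H.
Qed.

(** A separable relation f for q leaves only one possible value, the one obtained by differentiating
    f(q) = 0. Since Q is reduced, its additivity and Leibniz rule may be checked modulo every prime,
    where the previous lemma supplies a genuine derivation. *)
Lemma derivation_of_reduced_ring :
  exists D : {additive Q -> Q}, der_over id D /\ forall c, D (ev c) = d c.
Proof.
have /choice[f fP] : forall q, exists f : {poly C},
    polyev ev q f = 0 /\ polyev ev q f^`() \is a GRing.unit.
  by move=> q; have [f] := separable_relation_unit q; exists f.
have [D key] : exists D : Q -> Q, forall (P : pset Q) (Ppr : is_prime_ideal P) y1 y2,
  exists E : {additive {poly {poly C}} -> residue_field Ppr},
    [/\ forall a b, E (a * b) =
        residue_map Ppr (polyev (polyev ev y1) y2 a) * E b +
        residue_map Ppr (polyev (polyev ev y1) y2 b) * E a,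
    forall G, residue_map Ppr (D (polyev (polyev ev y1) y2 G)) = E G &
    forall G f, polyev ev (polyev (polyev ev y1) y2 G) f = 0 ->
      residue_map Ppr (map_poly d f).[polyev (polyev ev y1) y2 G] +
      E G * residue_map Ppr (polyev ev (polyev (polyev ev y1) y2 G) f^`()) = 0].
  exists (fun q => - (map_poly d (f q)).[q] / polyev ev q (f q)^`()) => P Ppr y1 y2.
  have [E [EM EP]] := relation_derivation_mod Ppr y1 y2.
  exists E; split=> // G; set y := polyev _ _ G.
  have [fy fu] := fP y; have := EP G _ fy; rewrite -/y => /eqP.
  rewrite addrC addr_eq0 => /eqP e.
  have u := rmorph_unit (residue_map Ppr) fu; apply: (mulIr u).
  by rewrite -(rmorphM (residue_map Ppr)) divrK // e rmorphN.
have zero (q : Q) :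
    (forall P (Ppr : is_prime_ideal P), residue_map Ppr q = 0) -> q = 0.
  move=> h; apply: contrapT => q0; have [P Ppr] := reduced_prime_avoiding Qred q0.
  by apply; apply/(residue_map_eq0 Ppr); apply: h.
have ev2X y1 y2 : polyev (polyev ev y1) y2 'X = y2 by rewrite polyevX.
have ev2Y y1 y2 : polyev (polyev ev y1) y2 'X%:P = y1 by rewrite polyevC polyevX.
have DD y1 y2 : D (y1 + y2) = D y1 + D y2.
  apply/eqP; rewrite -subr_eq0; apply/eqP; apply: zero => P Ppr.
  have [E [EM EP _]] := key P Ppr y1 y2.
  have e1 := EP 'X%:P; have e2 := EP 'X; have := EP ('X%:P + 'X).
  rewrite rmorphD raddfD ev2X ev2Y => e3; rewrite ev2Y in e1; rewrite ev2X in e2.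
  by rewrite rmorphB e3 rmorphD e1 e2 subrr.
have DM y1 y2 : D (y1 * y2) = y1 * D y2 + y2 * D y1.
  apply/eqP; rewrite -subr_eq0; apply/eqP; apply: zero => P Ppr.
  have [E [EM EP _]] := key P Ppr y1 y2.
  have e1 := EP 'X%:P; have e2 := EP 'X; have := EP ('X%:P * 'X).
  rewrite EM rmorphM !ev2X !ev2Y => e3; rewrite ev2Y in e1; rewrite ev2X in e2.
  by rewrite rmorphB e3 rmorphD !rmorphM e1 e2 subrr.
exists (additive_of DD); split=> //= c.
apply/eqP; rewrite -subr_eq0; apply/eqP; apply: zero => P Ppr.
have [E [EM EP ER]] := key P Ppr (ev c) 0.
have e1 := EP 'X%:P; have := ER 'X%:P ('X - c%:P); rewrite ev2Y in e1 *.
rewrite rmorphB polyevX polyevC subrr derivXsubC rmorph1 rmorph1.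
have -> : map_poly d ('X - c%:P) = - (d c)%:P.
  apply/polyP => i; rewrite coef_map coefB coefX coefC coefN coefC /=.
  case: (i == 0%N) / eqP => [->|_]; first by rewrite sub0r raddfN.
  by rewrite subr0 oppr0; case: eqP => _; rewrite ?(der_over1 dM) ?raddf0.
rewrite mulr1 hornerN hornerC rmorphN addrC => /(_ erefl)/eqP.
rewrite subr_eq0 => /eqP e2.
by rewrite rmorphB e1 e2 subrr.
Qed.

End DerivationOfReducedRing.

(** * The filtration of Q by fractional powers of x *)

Section DeterminantTrick.
Variables (R Q : comNzRingType) (iota : {rmorphism R -> Q}).
Local Notation S := (integralOver iota).

Lemma integral_polyM (p q : {poly Q}) :
  (forall i, S p`_i) -> (forall i, S q`_i) -> forall i, S (p * q)`_i.
Proof.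
by move=> hp hq i; rewrite coefM; apply: integral_sum => l _; apply: integral_mul.
Qed.

Lemma integral_char_poly n (C : 'M[Q]_n) : (forall i j, S (C i j)) ->
  forall l, S (char_poly C)`_l.
Proof.
move=> hC; rewrite /char_poly /determinant => l.
rewrite coef_sum; apply: integral_sum => s _.
rewrite -signr_odd; apply: (integral_polyM (p := (-1) ^+ _)).
  case: (odd _) => i; rewrite ?expr1 ?expr0 ?coefN coef1; last exact: integral_nat.
  by apply: integral_opp; apply: integral_nat.
elim/big_ind: _ => [i|p q hp hq|i _ j]; first by rewrite coef1; apply: integral_nat.
  exact: integral_polyM.
rewrite !mxE coefB coefMn coefX coefC; apply: integral_sub.
  by rewrite -mulrnA; apply: integral_nat.
by case: (j == 0%N); [apply: hC|apply: integral0].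
Qed.

(** The determinant trick; the generator 1 among the [t i] makes the module faithful. *)
Lemma integral_fin_stable n (t : 'I_n.+1 -> Q) (w : Q) (C : 'M[Q]_n.+1) :
  t ord0 = 1 -> (forall i j, S (C i j)) ->
  (forall i, w * t i = \sum_j C i j * t j) -> S w.
Proof.
move=> t0 hC wt.
have root_w : (char_poly C).[w] = 0.
  have -> : (char_poly C).[w] = \det (w%:M - C).
    rewrite /char_poly -[_.[w]]/(horner_eval w _) -det_map_mx; congr (\det _).
    apply/matrixP => i j; rewrite !mxE /horner_eval.
    by rewrite -[LHS]/((_ : {poly Q}).[w]) hornerD hornerN hornerMn hornerX hornerC.
  pose tc : 'cV[Q]_n.+1 := \col_i t i.
  have Ct : (w%:M - C) *m tc = 0.
    apply/colP => i; rewrite mulmxBl mul_scalar_mx !mxE wt.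
    apply/eqP; rewrite subr_eq0; apply/eqP.
    by apply: eq_bigr => j _; rewrite mxE.
  have := congr1 (mulmx (\adj (w%:M - C))) Ct.
  rewrite mulmxA mul_adj_mx mulmx0 mul_scalar_mx => /colP/(_ ord0).
  by rewrite !mxE t0 mulr1.
apply: (integral_root_monic (char_poly_monic C)); first exact/rootP.
by apply/integral_poly; apply: integral_char_poly.
Qed.

End DeterminantTrick.

Section Filtration.
Variables (R Q : comUnitRingType) (iota : {rmorphism R -> Q}) (x : R).
Hypothesis Mid : is_ideal (@max_ideal R).
Hypothesis Mx : max_ideal x.
Local Notation X := (iota x).
Hypothesis uX : X \is a GRing.unit.
Local Notation S := (integralOver iota).

Lemma integral_root_unit (p : {poly R}) (t : Q) : p`_0 \is a GRing.unit ->
  polyev iota t p = 0 -> S t -> t \is a GRing.unit /\ S t^-1.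
Proof.
elim/poly_ind: p => [|p c _]; first by rewrite coef0 unitr0.
rewrite coefD coefMX coefC /= add0r => uc.
rewrite rmorphD rmorphM polyevX polyevC => /eqP.
rewrite addr_eq0 => /eqP e St.
have e1 : t * (- (polyev iota t p) * iota c^-1) = 1.
  rewrite mulrA mulrN [t * _]mulrC e opprK -rmorphM mulrV ?rmorph1 //.
have ut : t \is a GRing.unit by apply/unitrPr; exists (- (polyev iota t p) * iota c^-1).
split=> //; rewrite -[t^-1]mulr1 -e1 mulKr //.
apply: integral_mul; last exact: integral_id.
apply: integral_opp; rewrite polyevE; apply: integral_horner => //.
by apply/integral_poly => i; rewrite coef_map; apply: integral_id.
Qed.

(** X S lies in the Jacobson radical of S: the scaled integral equation of X s, rewritten for 1 + X
    s, has constant coefficient (-1)^n modulo M, a unit of R. *)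
Lemma integral_unit_1D s : S s -> (1 + X * s) \is a GRing.unit /\ S (1 + X * s)^-1.
Proof.
move=> Ss; have [n [q e]] := (integral_eqP iota s).1 Ss.
pose p : {poly R} := ('X - 1) ^+ n -
  \sum_(i < n) (q i * x ^+ (n - i)) *: ('X - 1) ^+ i.
apply: (integral_root_unit (p := p)).
- rewrite -horner_coef0 /p hornerD hornerN horner_sum horner_exp !hornerE.
  apply: local_unitD => //; first by rewrite unitrX // unitrN unitr1.
  have [_ [_ Mmul]] := Mid; rewrite -sumrN.
  apply: is_ideal_sum => // i _; rewrite hornerZ -[(n - i)%N]prednK ?subn_gt0 // exprSr.
  set y := _.[0]; set z := x ^+ _.
  have -> : - (q i * (z * x) * y) = (- q i * z * y) * x by ring.
  exact: (Mmul).
- have e2 : polyev iota (1 + X * s) ('X - 1) = X * s.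
    by rewrite rmorphB polyevX rmorph1 addrAC subrr add0r.
  rewrite /p rmorphB rmorphXn rmorph_sum e2.
  rewrite (@integral_eq_scaled _ _ X n (fun i => iota (q i)) e).
  apply/eqP; rewrite subr_eq0; apply/eqP/eq_bigr => i _.
  by rewrite -mul_polyC rmorphM polyevC rmorphXn e2 rmorphM rmorphXn.
- apply: integral_add; first exact: integral1.
  by apply: integral_mul => //; apply: integral_id.
Qed.

Lemma X_notin_unit s : S s -> X * s <> 1.
Proof.
move=> Ss e; have [] := integral_unit_1D (integral_opp Ss).
by rewrite mulrN e subrr unitr0.
Qed.

(* the radical of X S in S *)
Definition radX : pset Q := fun g => exists n, S (g ^+ n / X).

Lemma integral_expK n w : (0 < n)%N -> S (w ^+ n) -> S w.
Proof.
case: n => // n _ Swn.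
apply: (@integral_closed_eq _ _ iota n.+1 (fun i => if i == 0%N then w ^+ n.+1 else 0)).
  by case=> [|i] _ //=; apply: integral0.
by rewrite big_ord_recl /= expr0 mulr1 big1 ?addr0 // => i _; rewrite mul0r.
Qed.

Lemma radXP g : radX g -> exists n, S (g ^+ n.+1 / X).
Proof.
case=> -[|n] Sg; last by exists n.
by rewrite expr0 mul1r in Sg; have [] := X_notin_unit Sg; rewrite mulrV.
Qed.

Lemma radX_integral g : radX g -> S g.
Proof.
move=> /radXP[n Sg]; apply: (@integral_expK n.+1) => //.
by rewrite -(divrK uX (g ^+ n.+1)); apply: integral_mul => //; apply: integral_id.
Qed.

Lemma radX_pow_ge g n : S g -> S (g ^+ n / X) ->
  forall m, (n <= m)%N -> S (g ^+ m / X).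
Proof.
move=> Sg Sn m le_nm; rewrite (exprnBM g le_nm) -mulrA.
by apply: integral_mul => //; apply: integral_exp.
Qed.

Lemma radXD g h : radX g -> radX h -> radX (g + h).
Proof.
move=> Jg Jh; have Sg := radX_integral Jg; have Sh := radX_integral Jh.
have [[n gn] [m hm]] := (Jg, Jh); exists (n + m)%N.
rewrite exprDn mulr_suml; apply: integral_sum => i _.
rewrite -mulr_natl -!mulrA; apply: integral_mul; first exact: integral_nat.
have [le_n|lt_n] := leqP n (n + m - i).
  rewrite mulrCA; apply: integral_mul; first exact: integral_exp.
  exact: radX_pow_ge gn _ le_n.
apply: integral_mul; first exact: integral_exp.
by apply: radX_pow_ge hm _ _ => //; lia.
Qed.

Lemma radXM s g : S s -> radX g -> radX (s * g).
Proof.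
move=> Ss [n gn]; exists n; rewrite exprMn -mulrA.
by apply: integral_mul => //; apply: integral_exp.
Qed.

Lemma radX0 : radX 0.
Proof. by exists 1%N; rewrite expr1 mul0r; apply: integral0. Qed.

Lemma radX_exp b n : radX (b ^+ n) -> radX b.
Proof. by case=> m; rewrite -exprM => ?; exists (n * m)%N. Qed.

(** After u is factored out, 1 - h divides 1 - h^(n+1), which differs from 1 by an element of X
    S. *)
Lemma unit_radXD (u : R) g : u \is a GRing.unit -> radX g ->
  (iota u + g) \is a GRing.unit /\ S (iota u + g)^-1.
Proof.
move=> uu Jg; have uiu : iota u \is a GRing.unit := rmorph_unit iota uu.
have Jg' : radX (- (iota u^-1 * g)).
  by rewrite -mulNr; apply: radXM => //; apply: integral_opp; apply: integral_id.
set h := - (iota u^-1 * g) in Jg'; have Sh := radX_integral Jg'.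
have [n hn] := radXP Jg'.
have [u1 S1] := integral_unit_1D (integral_opp hn).
have e : 1 + X * - (h ^+ n.+1 / X) = (1 - h) * \sum_(i < n.+1) h ^+ i.
  by rewrite mulrN mulrC divrK // -opprB subrX1 -mulNr opprB.
have e2 : iota u + g = iota u * (1 - h).
  by rewrite /h opprK mulrDr mulr1 mulrA -rmorphM mulrV // rmorph1 mul1r.
rewrite e in u1 S1; have u1h : (1 - h) \is a GRing.unit by move: u1; rewrite unitrM => /andP[].
rewrite e2 unitrM uiu u1h; split=> //.
rewrite invrM // -(rmorphV iota) //; apply: integral_mul; last exact: integral_id.
have -> : (1 - h)^-1 = (\sum_(i < n.+1) h ^+ i) *
     ((1 - h) * \sum_(i < n.+1) h ^+ i)^-1.
  apply: (mulrI u1h); rewrite mulrV // mulrA mulrV //.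
by apply: integral_mul => //; apply: integral_sum => i _; apply: integral_exp.
Qed.

Lemma integral_Xz (z : int) : (0 <= z)%R -> S (X ^ z).
Proof. by case: z => // n _; apply: integral_exp; apply: integral_id. Qed.

Variable N : nat.
Hypothesis N0 : (0 < N)%N.

(** In terms of valuations: the order of s is at least j / N times that of x at every branch. *)
Definition filt (j : int) : pset Q := fun s => S (s ^+ N * X ^ (- j)).

Lemma filt_leq i j s : (i <= j)%R -> filt j s -> filt i s.
Proof.
rewrite /filt => le_ij Fs; have -> : - i = - j + (j - i) by ring.
rewrite exprzDr // mulrA; apply: integral_mul => //.
by apply: integral_Xz; rewrite Num.Theory.subr_ge0.
Qed.

Lemma filt0 s : filt 0 s <-> S s.
Proof.
rewrite /filt oppr0 expr0z mulr1; split; first exact: integral_expK.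
exact: integral_exp.
Qed.

Lemma filtM i j s t : filt i s -> filt j t -> filt (i + j) (s * t).
Proof.
rewrite /filt => Fs Ft; rewrite opprD exprzDr // exprMn mulrACA.
exact: integral_mul.
Qed.

Lemma filt_integralM j s t : S s -> filt j t -> filt j (s * t).
Proof. by move=> /filt0 Fs Ft; rewrite -[j]add0r; apply: filtM. Qed.

(** The mixed terms of the binomial expansion are integral because their N-th powers are products of
    integral elements. *)
Lemma filtD j s t : filt j s -> filt j t -> filt j (s + t).
Proof.
rewrite /filt => Fs Ft; rewrite exprDn mulr_suml; apply: integral_sum => i _.
rewrite -mulr_natl -mulrA; apply: integral_mul; first exact: integral_nat.
apply: (@integral_expK N) => //.
have -> : (s ^+ (N - i) * t ^+ i * X ^ (- j)) ^+ N =
  (s ^+ N * X ^ (- j)) ^+ (N - i) * (t ^+ N * X ^ (- j)) ^+ i.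
  rewrite !exprMn -!exprM mulrACA -exprD subnK; last by rewrite -ltnS.
  by rewrite [(_ * N)%N]mulnC [(i * N)%N]mulnC.
by apply: integral_mul; apply: integral_exp.
Qed.

Lemma filtX (z j : int) s : filt j s -> filt (j + N%:Z * z) (X ^ z * s).
Proof.
rewrite /filt exprMn => Fs.
have e1 : (X ^ z) ^+ N * X ^ (- (N%:Z * z)) = 1.
  rewrite -[(X ^ z) ^+ N]/((X ^ z) ^ N%:Z) exprz_exp -exprzDr // [z * _]mulrC.
  by rewrite subrr expr0z.
rewrite opprD exprzDr //; set a := _ ^+ N in e1 *; set b := X ^ (- (_ * _)) in e1 *.
have -> : a * s ^+ N * (X ^ (- j) * b) = (a * b) * (s ^+ N * X ^ (- j)) by ring.
by rewrite e1 mul1r.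
Qed.

Lemma filtN s : filt N%:Z s <-> S (s / X).
Proof.
rewrite -filt0; split=> Fs.
  by have := filtX (-1) Fs; rewrite mulrN1 subrr exprN1 mulrC.
by have := filtX 1 Fs; rewrite mulr1 add0r expr1z mulrC divrK.
Qed.

End Filtration.

Section FiltrationEquation.
Variables (R Q : comUnitRingType) (iota : {rmorphism R -> Q}) (x : R).
Hypothesis Mid : is_ideal (@max_ideal R).
Hypothesis Mx : max_ideal x.
Local Notation X := (iota x).
Hypothesis uX : X \is a GRing.unit.
Local Notation S := (integralOver iota).
Variable N : nat.
Hypothesis N0 : (0 < N)%N.
Local Notation filt := (filt iota x N).

(* The S-module spanned by the v^i / X^floor(i a / N) is finitely generated
   and stable under v^N / X^a. *)
Lemma filt_equation n (c : nat -> Q) (b : nat -> int) (a : int) v :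
  (forall i, (i < n)%N -> S (c i)) ->
  (forall i, (i < n)%N -> ((n - i)%N%:Z * a <= N%:Z * b i)%R) ->
  v ^+ n = \sum_(i < n) c i * X ^ b i * v ^+ i -> filt a v.
Proof.
case: n => [|n] Sc hb ev.
  by move: ev; rewrite big_ord0 expr0 => /eqP; rewrite oner_eq0.
have N0' : N%:Z != 0 by lia.
pose fl (i : nat) : int := (i%:Z * a %/ N%:Z)%Z.
pose t (i : nat) : Q := v ^+ i * X ^ (- fl i).
pose span q := exists e : nat -> Q, (forall i, S (e i)) /\ q = \sum_(i < n.+1) e i * t i.
have spanD q q' : span q -> span q' -> span (q + q').
  move=> [e [Se ->]] [e' [Se' ->]]; exists (fun i => e i + e' i); split.
    by move=> i; apply: integral_add.
  by rewrite -big_split; apply: eq_bigr => i _; rewrite mulrDl.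
have spanZ s q : S s -> span q -> span (s * q).
  move=> Ss [e [Se ->]]; exists (fun i => s * e i); split.
    by move=> i; apply: integral_mul.
  by rewrite mulr_sumr; apply: eq_bigr => i _; rewrite mulrA.
have span0 : span 0.
  by exists (fun=> 0); split=> [_|]; [apply: integral0|rewrite big1 // => i _; rewrite mul0r].
have vt i : v ^+ i = t i * X ^ (fl i).
  by rewrite /t -mulrA -exprzDr // addNr expr0z mulr1.
have spant i : span (t i).
  elim/ltn_ind: i => i IH; have [lt_in|le_ni] := ltnP i n.+1.
    exists (fun l => if l == i then 1 else 0); split.
      by move=> l; case: eqP => _; [apply: integral1|apply: integral0].
    rewrite (bigD1 (Ordinal lt_in)) //= eqxx mul1r big1 ?addr0 // => l.
    by rewrite -val_eqE /= => /negPf ->; rewrite mul0r.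
  have -> : t i = \sum_(l < n.+1) (c l * X ^ (b l + fl (i - n.+1 + l)%N - fl i)) *
       t (i - n.+1 + l)%N.
    rewrite {1}/t -(subnK le_ni) exprD ev mulr_sumr mulr_suml subnK //.
    apply: eq_bigr => l _.
    have -> : v ^+ (i - n.+1) * (c l * X ^ b l * v ^+ l) * X ^ (- fl i) =
       c l * X ^ b l * v ^+ (i - n.+1 + l) * X ^ (- fl i) by rewrite exprD; ring.
    by rewrite vt !exprzDr //; ring.
  elim/big_ind: _ => // l _; apply: (spanZ); last by apply: IH; have := ltn_ord l; lia.
  apply: integral_mul; first exact: Sc.
  (* The power of X has a nonnegative exponent: the slope condition on [b l] compares the two
     floors. *)
  apply: integral_Xz; rewrite Num.Theory.subr_ge0 /fl -divzMDl //.
  apply: lez_pdiv2r; first by lia.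
  have := hb l (ltn_ord l).
  have -> : i%:Z = (i - n.+1 + l)%N%:Z + (n.+1 - l)%N%:Z by have := ltn_ord l; lia.
  by rewrite mulrDl [b l * _]mulrC addrC Num.Theory.lerD2r.
have /choice[/= e eP] : forall i, exists e : nat -> Q, (forall l, S (e l)) /\
   t (N + i)%N = \sum_(l < n.+1) e l * t l by move=> i; apply: spant.
have tN : t N = v ^+ N * X ^ (- a) by rewrite /t; congr (_ * X ^ - _); rewrite /fl mulrC mulzK.
have flN i : fl (N + i)%N = a + fl i.
  by rewrite /fl PoszD mulrDl [N%:Z * a]mulrC divzMDl.
rewrite /filt -tN.
apply: (@integral_fin_stable _ _ iota n (fun i => t i) (t N) (\matrix_(i, j) e i j)).
- by rewrite /t /fl mul0r div0z oppr0 expr0 expr0z mulr1.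
- by move=> i j; rewrite mxE; apply: (eP i).1.
- move=> i; have -> : t N * t i = t (N + i)%N.
    by rewrite tN /t flN opprD exprzDr // exprD; ring.
  by rewrite (eP i).2; apply: eq_bigr => l _; rewrite mxE.
Qed.

Lemma expr_radX (v : Q) (m : nat) (e : int) (g : Q) :
  (0 < m)%N -> (0 < e)%R -> S (g ^+ m * X ^ (- e)) -> radX iota x g.
Proof.
move=> m0 e0 Sg; exists m; rewrite -exprN1.
have -> : (-1 : int) = - e + (e - 1) by ring.
rewrite exprzDr // mulrA; apply: integral_mul => //.
by apply: integral_Xz; lia.
Qed.

(* A Newton polygon argument: the weights w i of the terms of the relation are
   pairwise distinct because q = (j n + 1) / (n N) is not the slope of a segment
   of width at most dd. *)
Lemma filt_step dd (I : pred 'I_dd.+1) (u : nat -> R) (al : nat -> nat)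
    (v : Q) (n : nat) (j : int) :
  (forall i, (0 < i <= dd)%N -> (i %| N)%N) ->
  (exists i, I i) -> (forall i, I i -> u i \is a GRing.unit) ->
  \sum_(i | I i) iota (u i) * X ^+ al i * v ^+ i = 0 ->
  S (v ^+ (N * n.+1) * X ^ (- (j * n.+1%:Z + 1))) -> filt (j + 1) v.
Proof.
move=> hN [i1 Ii1] uu rel Sv.
case: n Sv => [|n] Sv; first by rewrite mulr1 muln1 in Sv.
pose w (i : nat) : int := (n.+2 * N * al i)%N%:Z + i%:Z * (j * n.+2%:Z + 1).
have winj (i l : 'I_dd.+1) : w i = w l -> i = l.
  wlog lt_il : i l / (i < l)%N.
    move=> H e; have [|h|//] := ltngtP i l; first by move/H; apply.
      by apply/esym/H.
    by move=> h; apply: val_inj.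
  rewrite /w => e; exfalso.
  (* Since l - i divides N, an equality of weights can be divided by l - i, and it then says that n
     + 2 divides 1. *)
  have /dvdnP[N' eN] : (l - i %| N)%N.
    by apply: hN; have := ltn_ord l; lia.
  have : (n.+2%:Z * (N'%:Z * ((al i)%:Z - (al l)%:Z) - j) = 1)%R.
    have li0 : ((l - i)%N%:Z != 0) by lia.
    apply: (mulIf li0); rewrite mul1r.
    have := e; rewrite eN; have -> : (l - i)%N%:Z = l%:Z - i%:Z by lia.
    rewrite !PoszM; have -> : (l - i)%N%:Z = l%:Z - i%:Z by lia.
    by move=> /eqP; rewrite -subr_eq0 => /eqP e'; apply/eqP; rewrite -subr_eq0 -e'; apply/eqP; ring.
  set z := (_ - j : int); move=> h.
  have : (n.+2%:Z %| 1)%Z by apply/dvdzP; exists z; rewrite mulrC h.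
  by rewrite dvdzE /= dvdn1.
have [i0 Ii0 i0min] : exists2 i0, I i0 & forall i, I i -> i != i0 -> (w i0 < w i)%R.
  case: (@Order.TotalTheory.arg_minP _ int _ i1 I (fun i : 'I_dd.+1 => w i) Ii1) => i0 Ii0 hmin.
  exists i0 => // i Ii ne; rewrite Order.POrderTheory.lt_neqAle hmin // andbT.
  by apply: contraNneq ne => /winj ->.
(* The terms of index above [i0] are absorbed into the coefficient of v^i0: relative to the term
   [i0] they have positive order, so the coefficient becomes a unit [W] of S. *)
pose g (i : nat) : Q := X ^ ((al i)%:Z - (al i0)%:Z) * v ^+ (i - i0).
have Jg (i : 'I_dd.+1) : I i -> (i0 < i)%N -> radX iota x (g i).
  move=> Ii lt_i0i; apply: (@expr_radX v (N * n.+2) (w i - w i0)) => //.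
  - by rewrite muln_gt0 N0.
  - by rewrite Num.Theory.subr_gt0 i0min // neq_ltn lt_i0i orbT.
  have -> : g i ^+ (N * n.+2) * X ^ (- (w i - w i0)) =
     (v ^+ (N * n.+2) * X ^ (- (j * n.+2%:Z + 1))) ^+ (i - i0).
    rewrite !exprMn -!exprM (mulnC (i - i0)%N).
    rewrite -![(X ^ _) ^+ _]/((X ^ _) ^ _%:Z) !exprz_exp mulrAC -exprzDr // mulrC.
    congr (_ * X ^ _); rewrite /w; have -> : (i - i0)%N%:Z = i%:Z - i0%:Z by lia.
    by rewrite !PoszM; ring.
  exact: integral_exp.
pose G : Q := \sum_(i | I i && (i0 < i)%N) iota (u i) * g i.
have JG : radX iota x G.
  rewrite /G; elim/big_ind: _ => [|? ?|i /andP[Ii lt_i]]; first exact: radX0.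
    exact: radXD.
  by apply: radXM; [apply: integral_id|apply: Jg].
have [uW SW] := unit_radXD Mid Mx uX (uu _ Ii0) JG.
set W := iota (u i0) + G in uW SW.
have eW : W * v ^+ i0 = - \sum_(i | I i && (i < i0)%N) iota (u i) * X ^ ((al i)%:Z - (al i0)%:Z) * v ^+ i.
  have Xa : X ^ (- (al i0)%:Z) * \sum_(i | I i) iota (u i) * X ^+ al i * v ^+ i = 0.
    by rewrite rel mulr0.
  apply/eqP; rewrite -addr_eq0 -[X in _ == X]Xa; apply/eqP.
  rewrite mulr_sumr [in RHS](bigD1 i0) //=.
  rewrite [in RHS](bigID (fun i : 'I_dd.+1 => (i0 < i)%N)) /= /W mulrDl -!addrA; congr (_ + _).
    have -> : X ^ (- (al i0)%:Z) * (iota (u i0) * X ^+ al i0 * v ^+ i0) =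
      (X ^ (- (al i0)%:Z) * X ^ (al i0)%:Z) * (iota (u i0) * v ^+ i0).
      by rewrite -[X ^ (al i0)%:Z]/(X ^+ al i0); ring.
    by rewrite -exprzDr // addNr expr0z mul1r.
  congr (_ + _).
    rewrite /G mulr_suml; apply: eq_big => i.
      by case: (I i) => //=; case: ltnP => //; rewrite ?andbT ?andbF // neq_ltn orbC => ->.
    move=> /andP[Ii lt_i]; rewrite /g (exprnBM v (ltnW lt_i)) addrC exprzDr //.
    by rewrite -[X ^ (al i)%:Z]/(X ^+ al i); ring.
  apply: eq_big => i.
    by case: (I i) => //=; rewrite -leqNgt -val_eqE /= ltn_neqAle.
  move=> _; rewrite addrC exprzDr // -[X ^ (al i)%:Z]/(X ^+ al i); ring.
(* Division by [W] gives a monic equation of degree [i0]. For absent terms the coefficient is 0, and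
   the absolute value is merely an exponent that meets the slope condition. *)
apply: (@filt_equation i0 (fun i => if (i < dd.+1)%N && I (inord i) then - W^-1 * iota (u i) else 0)
   (fun i => if (i < dd.+1)%N && I (inord i) then (al i)%:Z - (al i0)%:Z else `|(i0 - i)%N%:Z * (j + 1)|)).
- move=> i _; case: ifP => _; last exact: integral0.
  by rewrite mulNr; apply/integral_opp/integral_mul => //; apply: integral_id.
- move=> i lt_i; case: ifP => [/andP[lt_id Ii]|_]; last first.
    apply: Order.POrderTheory.le_trans (Num.Theory.ler_norm _) _.
    by rewrite -[X in (X <= _)%R]mul1r Num.Theory.ler_wpM2r //; lia.
  have ne : inord i != i0.
    by rewrite -val_eqE /= inordK //; lia.
  have := i0min _ Ii ne; rewrite inordK //.
  have /dvdnP[N' eN] : (i0 - i %| N)%N by apply: hN; have := ltn_ord i0; lia.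
  rewrite /w eN; set A := (al i)%:Z; set A0 := (al i0)%:Z => h.
  have li0 : (0 < (i0 - i)%N%:Z :> int)%R by lia.
  have h2 : (0 < (i0 - i)%N%:Z * (n.+2%:Z * (N'%:Z * (A - A0) - j) - 1))%R.
    move: h; rewrite -Num.Theory.subr_gt0; congr (0 < _)%R.
    have e : (i0 - i)%N%:Z = i0%:Z - i%:Z by lia.
    rewrite !PoszM -/A -/A0 e; ring.
  rewrite Num.Theory.pmulr_rgt0 // in h2.
  (* Integrality rounds the strict inequality for the slope q up to the value j + 1. *)
  have h3 : (j + 1 <= N'%:Z * (A - A0))%R.
    set z := (N'%:Z * (A - A0))%R in h2 *.
    have : (0 < z - j)%R; last by lia.
    by rewrite -(@Num.Theory.pmulr_rgt0 _ n.+2%:Z) //; lia.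
  by rewrite mulrC PoszM mulrAC Num.Theory.ler_pM2r.
- apply: (mulrI uW); rewrite eW mulr_sumr.
  rewrite (big_ord_widen_cond dd.+1 xpredT (fun i => W * ((if (i < dd.+1)%N && I (inord i) then - W^-1 * iota (u i) else 0) *
     X ^ (if (i < dd.+1)%N && I (inord i) then (al i)%:Z - (al i0)%:Z else `|(i0 - i)%N%:Z * (j + 1)|) * v ^+ i))); last first.
    by rewrite ltnW.
  rewrite -sumrN big_mkcond [RHS]big_mkcond; apply: eq_bigr => i _ /=.
  rewrite ltn_ord inord_val /=; case: (I i) => /=; last first.
    by case: ifP => // _; rewrite !mul0r mulr0.
  case: ifP => // _; rewrite mulNr !mulNr mulrN; congr (- _).
  by rewrite !mulrA mulrV // mul1r.
Qed.

End FiltrationEquation.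

(** * The derivation x d/dx on the normalization *)

Section LogDerivation.
Variables (k : fieldType) (R : comUnitAlgType k) (Q : comUnitRingType).
Variables (iota : {rmorphism R -> Q}) (x : R).
Hypothesis hchar : [pchar k] =i pred0.
Hypothesis Mid : is_ideal (@max_ideal R).
Hypothesis Mx : max_ideal x.
Local Notation X := (iota x).
Hypothesis uX : X \is a GRing.unit.
Local Notation S := (integralOver iota).
Variable N : nat.
Hypothesis N0 : (0 < N)%N.
Local Notation filt := (filt iota x N).
Local Notation radX := (radX iota x).
Hypothesis hstep : forall v n (j : int),
  S (v ^+ (N * n.+1) * X ^ (- (j * n.+1%:Z + 1))) -> filt (j + 1) v.

Definition kscal : {rmorphism k -> Q} := iota \o in_alg R.

Hypothesis hres : forall u, S u -> exists2 p : {poly k}, p != 0 & radX (polyev kscal u p).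
Variable D : {additive Q -> Q}.
Hypotheses (DM : der_over id D) (DX : D X = X) (Dk : forall c, D (kscal c) = 0).

Let natk_neq0 n : (0 < n)%N -> n%:R != 0 :> k.
Proof. by rewrite ((pcharf0P _).1 hchar) lt0n. Qed.

(** The eigenvalue j / N of x d/dx on x^(j/N), as a constant of Q. *)
Definition wt (j : int) : Q := kscal (j%:~R / N%:R).

Lemma wtD i j : wt (i + j) = wt i + wt j.
Proof. by rewrite /wt rmorphD mulrDl rmorphD. Qed.

Lemma wtN j : wt (- j) = - wt j.
Proof. by rewrite /wt rmorphN mulNr rmorphN. Qed.

Lemma wt_nat (n : nat) : wt (n * N)%N%:Z = n%:R.
Proof.
by rewrite /wt -pmulrn natrM mulfK ?natk_neq0 // rmorph_nat.
Qed.

Lemma wt_unit (j : int) : (0 < j)%R -> exists c, wt j * kscal c = 1.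
Proof.
case: j => // n n0; exists (N%:R / n%:R); rewrite /wt -rmorphM -pmulrn.
by rewrite mulrA divfK ?natk_neq0 // mulfV ?natk_neq0 // rmorph1.
Qed.

Lemma kscal_integral c : S (kscal c).
Proof. exact: integral_id. Qed.

Lemma D1 : D 1 = 0.
Proof. by rewrite -(rmorph1 kscal) Dk. Qed.

Lemma D_exp s n : D (s ^+ n) = n%:R * s ^+ n.-1 * D s.
Proof.
elim: n => [|n IH]; first by rewrite expr0 D1 !mul0r.
rewrite exprS DM IH; case: n {IH} => [|n]; first by rewrite expr0 /=; ring.
by rewrite /= -[n.+2%:R]natr1 exprS; ring.
Qed.

Lemma D_Xz (z : int) : D (X ^ z) = z%:~R * X ^ z.
Proof.
have pos n : D (X ^ n%:Z) = n%:R * X ^ n%:Z.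
  rewrite -[X ^ n%:Z]/(X ^+ n) D_exp DX; case: n => [|n]; first by rewrite !mul0r.
  by rewrite /= exprSr; ring.
case: z => n; first exact: pos.
rewrite NegzE; set y := X ^ _; set z := X ^ n.+1%:Z.
have zy : z * y = 1 by rewrite -exprzDr // subrr expr0z.
have yz : y * z = 1 by rewrite mulrC.
have : y * D (z * y) = 0 by rewrite zy D1 mulr0.
rewrite DM pos -/z mulrDr mulrA yz mul1r => /eqP.
rewrite addr_eq0 => /eqP ->; rewrite rmorphN /= mulNr; congr (- _).
have -> : y * (y * (n.+1%:R * z)) = n.+1%:R * y * (y * z) by ring.
by rewrite yz mulr1.
Qed.

Lemma D_polyev u (p : {poly k}) :
  D (polyev kscal u p) = polyev kscal u p^`() * D u.
Proof.
elim/poly_ind: p => [|p c IH]; first by rewrite deriv0 !rmorph0 mul0r raddf0.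
rewrite rmorphD raddfD polyevC Dk addr0 rmorphM polyevX DM IH.
by rewrite derivD derivC addr0 derivM derivX mulr1 rmorphD rmorphM polyevX; ring.
Qed.

Definition Dw (j : int) (s : Q) : Q := D s - wt j * s.

Lemma polyev_integralS u (p : {poly k}) : S u -> S (polyev kscal u p).
Proof.
move=> Su; rewrite polyevE; apply: integral_horner => //.
by apply/integral_poly => i; rewrite coef_map; apply: kscal_integral.
Qed.

Lemma filt_scal j c s : filt j s -> filt j (kscal c * s).
Proof. by move=> Fs; apply: filt_integralM => //; apply: kscal_integral. Qed.

Lemma filt_opp j s : filt j s -> filt j (- s).
Proof. by rewrite -mulN1r -(rmorph1 kscal) -rmorphN; apply: filt_scal. Qed.

Lemma filt_sub j s t : filt j s -> filt j t -> filt j (s - t).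
Proof. by move=> Fs Ft; apply: filtD => //; apply: filt_opp. Qed.

Lemma radX_filt1 w : radX w -> filt 1 w.
Proof.
move=> Jw; have Sw := radX_integral Mid Mx uX Jw.
have [n wn] := radXP Mid Mx uX Jw.
rewrite -[1%R]add0r; apply: (hstep (n := n)); rewrite mul0r add0r exprN1.
by apply: (radX_pow_ge Sw wn); rewrite leq_pmull.
Qed.

(** At each branch the residue of u is 0 or a root of p1. The polynomial p1 + N X p1' vanishes at
    none of these: at 0 it equals p1(0), and at a root of p1 it equals N X p1', nonzero by
    separability. *)
Lemma residue_separable u : S u -> exists p1 a b : {poly k},
  radX (u * polyev kscal u p1) /\
  a * (p1 + N%:R *: ('X * p1^`())) + b * ('X * p1) = 1.
Proof.
move=> Su; have [p p0 Jp] := hres Su.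
have [||p' [p'0 sep Jp']] := @separable_relation k Q kscal radX u _ _ hchar p p0 Jp.
- by move=> r b; apply: radXM; apply: polyev_integralS.
- by move=> b n; apply: radX_exp.
have [p1 [p10 sep1 Jp1]] : exists p1 : {poly k},
    [/\ ~~ root p1 0, separable_poly p1 & radX (u * polyev kscal u p1)].
  have [/factor_theorem[q]|r0] := boolP (root p' 0); last first.
    by exists p'; split=> //; apply: radXM.
  rewrite subr0 => e; move: sep; rewrite e separable_mul => /and3P[sq _ cq].
  exists q; split=> //; first by rewrite -coprimep_XsubC subr0.
  by rewrite -{1}(polyevX kscal u) -rmorphM mulrC -e.
have /Bezout_eq1_coprimepP[[a b] /= e] :
   coprimep (p1 + N%:R *: ('X * p1^`())) ('X * p1).
  rewrite coprimepMr coprimepX /root.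
  rewrite hornerD hornerZ hornerM hornerX mul0r mulr0 addr0.
  rewrite -[_ == 0]/(root p1 0) p10 /=.
  rewrite coprimep_sym -[X in X + _]mul1r coprimep_addl_mul coprimep_sym.
  rewrite coprimepZl ?natk_neq0 // coprimepMl coprimep_sym.
  rewrite coprimepX p10 /= coprimep_sym.
  by move: sep1; rewrite unlock.
by exists p1, a, b.
Qed.

Definition log_bound (c : int) := forall j s, filt j s -> filt (j - c) (Dw j s).

(* u = s^N / x^j has residues that are separable over k, hence D kills them; the
   factor p1(u) kills the branches where s has order > j. *)
Lemma log_bound_improve (c : int) : (0 <= c)%R -> log_bound c -> log_bound (c - 1).
Proof.
move=> c0 hc j s Fs; set u := s ^+ N * X ^ (- j).
have Su : S u := Fs.
have [p1 [a [b [Jw ab]]]] := residue_separable Su.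
set w := u * _ in Jw; set P := polyev kscal u p1 in w Jw.
have SP : S P := polyev_integralS _ Su.
have Fw := radX_filt1 Jw.
have [n wn] := radXP Mid Mx uX Jw.
have Xj : X ^ (- j) * X ^ j = 1 by rewrite -exprzDr // addNr expr0z.
(* At a branch where s has order exactly j / N, u has a nonzero residue and P = p1(u) vanishes; so
   [s * P] has order above j / N everywhere, and [hstep] rounds it up. *)
have Fv : filt (j + 1) (s * P).
  apply: (hstep (n := n)).
  have -> : (s * P) ^+ (N * n.+1) * X ^ (- (j * n.+1%:Z + 1)) =
     (w ^+ n.+1 / X) * P ^+ (N * n.+1 - n.+1).
    have -> : w ^+ n.+1 = (s ^+ N) ^+ n.+1 * X ^ (- (j * n.+1%:Z)) * P ^+ n.+1.
      by rewrite /w /u !exprMn -[(X ^ _) ^+ _]/((X ^ _) ^ n.+1%:Z) exprz_exp mulNr.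
    have le_n : (n.+1 <= N * n.+1)%N by rewrite leq_pmull.
    rewrite opprD exprzDr // exprN1 exprMn (exprnBM P le_n) (exprM s N); ring.
  by apply: integral_mul => //; apply: integral_exp.
set h := Dw j s.
(* Logarithmic differentiation of u = s^N / x^j gives s D u = N u h, whence the factor p1 + N X
   p1'. *)
have Dv : Dw j (s * P) = h * polyev kscal u (p1 + N%:R *: ('X * p1^`())).
  have sDu : s * D u = N%:R * u * h.
    have NN : N%:R * wt j = j%:~R.
      rewrite -(rmorph_nat kscal) /wt -rmorphM mulrC divfK ?natk_neq0 //.
      by rewrite rmorph_int.
    have sN : s ^+ N = s * s ^+ N.-1 by rewrite -exprS prednK.
    rewrite /u DM D_Xz D_exp rmorphN /h /Dw sN; set y := s ^+ N.-1; set z := X ^ _.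
    have -> : N%:R * (s * y * z) * (D s - wt j * s) =
      N%:R * (s * y * z) * D s - (N%:R * wt j) * (s * y * z) * s by ring.
    by rewrite NN; ring.
  have -> : Dw j (s * P) = h * P + s * D P by rewrite /h /Dw DM; ring.
  rewrite D_polyev rmorphD -mul_polyC !rmorphM polyevC polyevX rmorph_nat -/P.
  set P' := polyev kscal u _.
  have -> : s * (P' * D u) = P' * (s * D u) by ring.
  by rewrite sDu; ring.
have FhR : filt (j + 1 - c) (h * polyev kscal u (p1 + N%:R *: ('X * p1^`()))).
  rewrite -Dv; have -> : Dw j (s * P) = Dw (j + 1) (s * P) + wt 1 * (s * P).
    by rewrite /Dw wtD; ring.
  apply: filtD => //; first exact: hc.
  by apply: filt_scal; apply: filt_leq Fv => //; rewrite Num.Theory.gerBl.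
(* The Bezout identity splits h. In the first part the bound is used one step higher, on [s * P]; in
   the second the factor [w] contributes the extra step. *)
have -> : h = polyev kscal u a * (h * polyev kscal u (p1 + N%:R *: ('X * p1^`()))) +
              polyev kscal u b * (w * h).
  rewrite -[LHS]mul1r -(rmorph1 (polyev kscal u)) -ab rmorphD !rmorphM polyevX /w; ring.
have -> : j - (c - 1) = j + 1 - c by ring.
apply: filtD => //; first by apply: filt_integralM => //; apply: polyev_integralS.
apply: filt_integralM => //; first exact: polyev_integralS.
have -> : j + 1 - c = 1 + (j - c) by ring.
by apply: filtM => //; apply: hc.
Qed.

Lemma log_bound_all (c : nat) : log_bound c%:Z -> forall j s, filt j s -> filt (j + 1) (Dw j s).
Proof.
elim: c => [|c IH] hc.
  (* The improvement still applies at c = 0 and yields -1: [Dw j] raises the filtration. *)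
  by move=> j s Fs; have := log_bound_improve (Order.POrderTheory.lexx _) hc Fs; rewrite sub0r opprK.
apply: IH; have -> : c%:Z = c.+1%:Z - 1 by lia.
exact: log_bound_improve.
Qed.

End LogDerivation.

(** * The action of D modulo powers of x *)

Section DerivationOnNormalization.
Variables (k : fieldType) (R : comUnitAlgType k) (Q : comUnitRingType).
Variables (iota : {rmorphism R -> Q}) (x : R).
Hypothesis hchar : [pchar k] =i pred0.
Local Notation X := (iota x).
Hypothesis uX : X \is a GRing.unit.
Local Notation S := (integralOver iota).
Variable N : nat.
Hypothesis N0 : (0 < N)%N.
Local Notation filt := (filt iota x N).
Local Notation kscal := (kscal iota).
Local Notation wt := (wt iota N).
Variable D : {additive Q -> Q}.
Hypotheses (DM : der_over id D) (DX : D X = X) (Dk : forall c, D (kscal c) = 0).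
Local Notation Dw := (Dw iota N D).

Definition xS (n : nat) : pset Q := fun s => S (s / X ^+ n).

Lemma xS0 s : xS 0 s <-> S s.
Proof. by rewrite /xS expr0 divr1. Qed.

Lemma xSP n s : xS n s -> exists2 t, S t & s = X ^+ n * t.
Proof. by move=> h; exists (s / X ^+ n) => //; rewrite mulrC divrK // unitrX. Qed.

Lemma xS_mulX n s : S s -> xS n (X ^+ n * s).
Proof. by move=> Ss; rewrite /xS mulrC mulKr // unitrX. Qed.

Lemma xSD n s t : xS n s -> xS n t -> xS n (s + t).
Proof. by move=> hs ht; rewrite /xS mulrDl; apply: integral_add. Qed.

Lemma xSN n s : xS n s -> xS n (- s).
Proof. by move=> hs; rewrite /xS mulNr; apply: integral_opp. Qed.

Lemma xSB n s t : xS n s -> xS n t -> xS n (s - t).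
Proof. by move=> hs ht; apply: xSD => //; apply: xSN. Qed.

Lemma xS_mull n s t : S s -> xS n t -> xS n (s * t).
Proof. by move=> hs ht; rewrite /xS -mulrA; apply: integral_mul. Qed.

Lemma xSM m n s t : xS m s -> xS n t -> xS (m + n) (s * t).
Proof.
move=> hs ht; rewrite /xS exprD invrM ?unitrX // [X in _ * X]mulrC mulrACA.
exact: integral_mul.
Qed.

Lemma xS_leq m n s : (m <= n)%N -> xS n s -> xS m s.
Proof.
move=> le_mn /xSP[t St ->]; rewrite -(subnKC le_mn) exprD -mulrA.
by apply/xS_mulX/integral_mul => //; apply/integral_exp/integral_id.
Qed.

Lemma xS_integral n s : xS n s -> S s.
Proof. by move/(xS_leq (leq0n n))/xS0. Qed.

Lemma xS00 n : xS n 0.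
Proof. by rewrite /xS mul0r; apply: integral0. Qed.

Lemma xSXP n s : xS n.+1 (X * s) <-> xS n s.
Proof. by rewrite /xS exprSr invrM ?unitrX // mulrA [X * s]mulrC mulrK. Qed.

Lemma D_X_pow n : D (X ^+ n) = n%:R * X ^+ n.
Proof.
rewrite (D_exp DM Dk) DX; case: n => [|n]; first by rewrite !mul0r.
by rewrite /= exprSr; ring.
Qed.

(* Since x^3 S lies in R, the poles of D on R bound those on S. *)
Lemma log_bound_init (C : nat) :
  (forall s, S s -> exists r, X ^+ 3 * s = iota r) ->
  (forall r, S (X ^+ C * D (iota r))) ->
  log_bound iota x N D (N * (C + 4))%N%:Z.
Proof.
move=> hcube hC j s Fs; pose l := (j %/ N%:Z)%Z; pose j' := (j %% N%:Z)%Z.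
have N0' : N%:Z != 0 by lia.
have ej : j = l * N%:Z + j' by apply: divz_eq.
have j'0 : (0 <= j')%R by apply: modz_ge0.
have j'N : (j' < N%:Z)%R by apply: ltz_pmod; lia.
pose t := X ^ (- l) * s.
have St : S t.
  apply/(filt0 iota x N0); apply: (filt_leq uX (j := j')) => //.
  have -> : j' = j + N%:Z * (- l) by rewrite {1}ej; ring.
  exact: filtX.
have es : s = X ^ l * t by rewrite /t mulrA -exprzDr // subrr expr0z mul1r.
have [r er] := hcube t St.
have SDt : S (X ^+ (C + 3) * D t).
  have := hC r; rewrite -er DM D_X_pow => h.
  have -> : X ^+ (C + 3) * D t =
     X ^+ C * (X ^+ 3 * D t + t * (3%:R * X ^+ 3)) - X ^+ C * (t * (3%:R * X ^+ 3)).
    by rewrite exprD; ring.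
  apply: integral_sub => //; apply: integral_mul; first exact/integral_exp/integral_id.
  apply: integral_mul => //; apply: integral_mul; first exact: integral_nat.
  exact/integral_exp/integral_id.
have -> : Dw j s = (l%:~R - wt j) * s + X ^ (l - (C + 3)%N%:Z) * (X ^+ (C + 3) * D t).
  rewrite /Dw {1}es DM (D_Xz uX DM DX Dk) -/t.
  have -> : X ^ (l - (C + 3)%N%:Z) * (X ^+ (C + 3) * D t) = X ^ l * D t.
    rewrite mulrA -[X ^+ (C + 3)]/(X ^ (C + 3)%N%:Z) -exprzDr // subrK //.
  by rewrite mulrBl {2}es; ring.
apply: filtD => //.
  apply: filt_integralM => //; last first.
    by apply: filt_leq Fs => //; lia.
  by apply: integral_sub; [rewrite -(rmorph_int kscal)|]; apply: integral_id.
have /(filt0 iota x N0)/(filtX uX (l - (C + 3)%N%:Z)) := SDt.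
rewrite add0r; apply: filt_leq => //.
(* The power of X costs (C + 3) N, and j exceeds l N by j' < N; hence C + 4. *)
rewrite ej !PoszM !PoszD; nia.
Qed.

Hypothesis hD : forall j s, filt j s -> filt (j + 1) (Dw j s).

Lemma wt0 : wt 0 = 0.
Proof. by rewrite /wt mul0r rmorph0. Qed.

Lemma wt_N : wt N%:Z = 1.
Proof. by have := wt_nat iota hchar N0 1; rewrite mul1n. Qed.

Lemma D_integral s : S s -> S (D s).
Proof.
move=> /(filt0 iota x N0)/hD; rewrite /Dw wt0 mul0r subr0 => h.
by apply/(filt0 iota x N0); apply: filt_leq h.
Qed.

Lemma xS_filt s : xS 1 s <-> filt N%:Z s.
Proof. by rewrite /xS expr1; symmetry; apply: filtN. Qed.

(** The conjugate of D by x^(a/N); for a = n N it describes D on x^n S. *)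
Definition Dshift (a : int) (s : Q) : Q := D s + wt a * s.

Lemma DshiftB a s t : Dshift a (s - t) = Dshift a s - Dshift a t.
Proof. by rewrite /Dshift raddfB; ring. Qed.

Lemma DshiftD a s t : Dshift a (s + t) = Dshift a s + Dshift a t.
Proof. by rewrite /Dshift raddfD; ring. Qed.

Lemma Dshift_integral a s : S s -> S (Dshift a s).
Proof.
move=> Ss; apply: integral_add; first exact: D_integral.
by apply: integral_mul => //; apply: integral_id.
Qed.

Lemma DshiftX a s : Dshift a (X * s) = X * Dshift (a + N%:Z) s.
Proof.
by rewrite /Dshift DM DX wtD wt_N; ring.
Qed.

Lemma D_Xmul s : D (X * s) = X * Dshift N%:Z s.
Proof. by have := DshiftX 0 s; rewrite /Dshift wt0 mul0r addr0 add0r. Qed.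

Lemma Dshift_pow a n s : Dshift a (X ^+ n * s) = X ^+ n * Dshift (a + (n * N)%N%:Z) s.
Proof.
by rewrite /Dshift DM D_X_pow wtD (wt_nat iota hchar N0); ring.
Qed.

Lemma Dshift_xS a n s : xS n s -> xS n (Dshift a s).
Proof.
by move=> /xSP[t St ->]; rewrite Dshift_pow; apply: xS_mulX; apply: Dshift_integral.
Qed.

Lemma D_xS n s : xS n s -> xS n (D s).
Proof. by move=> h; have := Dshift_xS 0 h; rewrite /Dshift wt0 mul0r addr0. Qed.

Lemma Dw_xS j n s : xS n s -> xS n (Dw j s).
Proof.
move=> h; have -> : Dw j s = Dshift (- j) s by rewrite /Dw /Dshift wtN; ring.
exact: Dshift_xS.
Qed.

(** From [filt i] to [filt i] modulo [filt (i + 1)], [Dshift a] is multiplication by (i + a) / N,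
    which is invertible for i >= 0 and a > 0. The equation is solved one step of the filtration at a
    time, and N steps lead from S to x S. *)
Lemma Dshift_surj a s : (0 < a)%R -> S s -> exists2 t, S t & xS 1 (Dshift a t - s).
Proof.
move=> a0 Ss; suff H : forall j : nat, (j <= N)%N -> forall s, filt (N - j)%N%:Z s ->
    exists2 t, S t & xS 1 (Dshift a t - s).
  by apply: (H N) => //; rewrite subnn; apply/(filt0 iota x N0).
elim=> [|j IH] le_jN {Ss}s Fs.
  exists 0; first exact: integral0.
  by rewrite /Dshift raddf0 mulr0 addr0 sub0r; apply/xSN/xS_filt; rewrite subn0 in Fs.
set i := (N - j.+1)%N%:Z in Fs.
have [|c hc] := wt_unit iota hchar N0 (j := i + a); first by lia.
set t1 := kscal c * s.
have Ft1 : filt i t1 by apply: filt_scal.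
have e1 : Dshift a t1 = Dw i t1 + s.
  rewrite /Dshift /Dw.
  have -> : D t1 - wt i * t1 + s = D t1 - wt i * t1 + wt (i + a) * kscal c * s.
    by rewrite hc mul1r.
  by rewrite wtD /t1; ring.
have [|t2 St2 h2] := IH (ltnW le_jN) (- Dw i t1).
  apply: filt_opp => //.
  have -> : (N - j)%N%:Z = i + 1 by rewrite /i; lia.
  exact: hD.
exists (t1 + t2); last first.
  by rewrite DshiftD e1; have -> : Dw i t1 + s + Dshift a t2 - s = Dshift a t2 - - Dw i t1 by ring.
apply: integral_add => //; apply/(filt0 iota x N0); apply: filt_leq Ft1 => //.
Qed.

(** The same eigenvalues being nonzero, t is pushed up the filtration step by step. *)
Lemma Dshift_inj1 a t : (0 < a)%R -> S t -> xS 1 (Dshift a t) -> xS 1 t.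
Proof.
move=> a0 St h; suff H : forall j : nat, (j <= N)%N -> filt j%:Z t by apply/xS_filt/H.
elim=> [|j IH] le_jN; first exact/(filt0 iota x N0).
have Fj := IH (ltnW le_jN).
have [|c hc] := wt_unit iota hchar N0 (j := j%:Z + a); first by lia.
have -> : t = kscal c * (Dshift a t - Dw j t).
  rewrite /Dshift /Dw.
  have -> : kscal c * (D t + wt a * t - (D t - wt j * t)) = (wt j + wt a) * kscal c * t by ring.
  by rewrite -wtD hc mul1r.
apply: filt_scal => //; apply: filt_sub => //.
  by apply: (filt_leq uX (j := N%:Z)); [lia|apply/xS_filt].
by have -> : j.+1%:Z = j%:Z + 1 by [lia]; apply: hD.
Qed.

Lemma Dshift_inj a n t : (0 < a)%R -> S t -> xS n (Dshift a t) -> xS n t.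
Proof.
elim: n a t => [|n IH] a t a0 St h; first exact/xS0.
have /xSP[t' St' et] := Dshift_inj1 a0 St (xS_leq (isT : (1 <= n.+1)%N) h).
rewrite expr1 in et; rewrite et in h *; apply/xSXP.
by move: h; rewrite DshiftX => /xSXP; apply: IH => //; lia.
Qed.

Lemma D_inj n s : xS 1 s -> xS n (D s) -> xS n s.
Proof.
move=> /xSP[t St]; rewrite expr1 => ->; rewrite D_Xmul.
case: n => [|n]; first by move=> _; apply/xS0/integral_mul => //; apply: integral_id.
by move=> /xSXP h; apply/xSXP; apply: Dshift_inj h => //; lia.
Qed.

(** Two rounds of [Dshift_surj], on x^3 S modulo x^4 S and on x^4 S modulo x^5 S. The remainder x^5
    v is the value of x^4 v dx, and x^4 v is x times an element of R in M. *)
Lemma cube_decomposition s : S s -> exists u v,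
  [/\ S u, S v & X ^+ 3 * s = D (X ^+ 3 * u) + X ^+ 5 * v].
Proof.
move=> Ss.
have [|s1 S1 /xSP[s2 S2]] := @Dshift_surj (3 * N)%N%:Z s _ Ss; first by lia.
rewrite expr1 => e1.
have [|s3 S3 /xSP[s4 S4]] := @Dshift_surj (4 * N)%N%:Z s2 _ S2; first by lia.
rewrite expr1 => e2.
exists (s1 - X * s3), s4; split=> //.
  by apply: integral_sub => //; apply: integral_mul => //; apply: integral_id.
have D3 t : D (X ^+ 3 * t) = X ^+ 3 * Dshift (3 * N)%N%:Z t.
  by have := Dshift_pow 0 3 t; rewrite /Dshift wt0 mul0r addr0 add0r.
rewrite D3 DshiftB DshiftX -PoszD.
have -> : (3 * N + N = 4 * N)%N by lia.
have -> : Dshift (3 * N)%N%:Z s1 = s + X * s2 by rewrite -e1; ring.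
have -> : Dshift (4 * N)%N%:Z s3 = s2 + X * s4 by rewrite -e2; ring.
by ring.
Qed.

(** The product of the D - i / N for i < j. For j = N it maps S into x S; [prodDshift N] is its
    conjugate by X, with positive shifts, so it is bijective on S modulo x S. *)
Fixpoint prodD (j : nat) (s : Q) : Q := if j is i.+1 then Dw i%:Z (prodD i s) else s.

Fixpoint prodDshift (j : nat) (s : Q) : Q :=
  if j is i.+1 then Dshift (N - i)%N%:Z (prodDshift i s) else s.

Lemma prodDshiftB j s t : prodDshift j (s - t) = prodDshift j s - prodDshift j t.
Proof. by elim: j => //= j ->; rewrite DshiftB. Qed.

Lemma prodD_filt j s : S s -> filt j%:Z (prodD j s).
Proof.
move=> Ss; elim: j => [|j IH] /=; first exact/(filt0 iota x N0).
by have -> : j.+1%:Z = j%:Z + 1 by [lia]; apply: hD.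
Qed.

Lemma prodDX j s : (j <= N)%N -> prodD j (X * s) = X * prodDshift j s.
Proof.
elim: j => //= j IH lt_jN; rewrite IH ?(ltnW lt_jN) //.
rewrite /Dw /Dshift DM DX.
have -> : (N - j)%N%:Z = N%:Z - j%:Z by lia.
by rewrite wtD wtN wt_N; ring.
Qed.

Lemma prodDshift_inj j t : (j <= N)%N -> S t -> xS 1 (prodDshift j t) -> xS 1 t.
Proof.
move=> + St; elim: j => //= j IH lt_jN h; apply: IH; first exact: ltnW.
apply: Dshift_inj1 h; first by lia.
by elim: (j) => //= i; apply: Dshift_integral.
Qed.

Lemma prodDshift_surj j s : (j <= N)%N -> S s ->
  exists2 t, S t & xS 1 (prodDshift j t - s).
Proof.
elim: j s => [|j IH] s lt_jN Ss /=.
  by exists s => //; rewrite subrr; apply: xS00.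
have [|w Sw hw] := @Dshift_surj (N - j)%N%:Z s _ Ss; first by lia.
have [t St ht] := IH w (ltnW lt_jN) Sw; exists t => //.
have -> : Dshift (N - j)%N (prodDshift j t) - s =
  Dshift (N - j)%N (prodDshift j t - w) + (Dshift (N - j)%N w - s) by rewrite DshiftB; ring.
by apply: xSD => //; apply: Dshift_xS.
Qed.

Lemma prodD_scal j z s : S s -> xS 2 (D z) -> xS 2 (prodD j (z * s) - z * prodD j s).
Proof.
move=> Ss Dz; elim: j => [|j IH] /=; first by rewrite subrr; apply: xS00.
have Sp : S (prodD j s).
  by have := prodD_filt j Ss; move/(filt_leq uX (i := 0)) => h; apply/(filt0 iota x N0)/h.
have -> : Dw j (prodD j (z * s)) - z * Dw j (prodD j s) =
   Dw j (prodD j (z * s) - z * prodD j s) + prodD j s * D z.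
  by rewrite /Dw raddfB DM; ring.
by apply: xSD; [apply: Dw_xS|apply: xS_mull].
Qed.

(* The D-equivariant splitting of x S / x^2 S -> S / x^2 S -> S / x S: the weights
   of D on S / x S lie in [0, 1), those on x S / x^2 S in [1, 2). *)
Lemma equivariant_splitting : exists tau : Q -> Q,
  [/\ forall s, S s -> S (tau s),
      forall s t, S s -> S t -> xS 1 (tau (s + t) - tau s - tau t),
      forall t, S t -> xS 1 (tau (X * t) - t) &
      forall z s, S z -> S s -> xS 2 (D z) -> xS 1 (tau (z * s) - z * tau s)].
Proof.
have pS s : S s -> S (prodD N s / X).
  by move=> Ss; have := prodD_filt N Ss; move/xS_filt; rewrite /xS expr1.
(* [prodD N] removes the weights in [0, 1). Dividing the result by X and inverting [prodDshift N]
   modulo x S recovers the component of s of weight in [1, 2), divided by X. *)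
have /choice[tau tauP] : forall s, exists t, S s ->
    S t /\ xS 1 (prodDshift N t - prodD N s / X).
  move=> s; have [Ss|nS] := pselect (S s); last by exists 0.
  by have [t St ht] := prodDshift_surj (leqnn N) (pS s Ss); exists t.
have inj := prodDshift_inj (leqnn N).
have Stau s : S s -> S (tau s) by move/tauP => [].
exists tau; split=> //.
- move=> s t Ss St; have Sst := integral_add Ss St.
  apply: inj; first by do 2?[apply: integral_sub]; apply: Stau.
  have -> : prodDshift N (tau (s + t) - tau s - tau t) =
     (prodDshift N (tau (s + t)) - prodD N (s + t) / X) -
     (prodDshift N (tau s) - prodD N s / X) - (prodDshift N (tau t) - prodD N t / X).
    have -> : prodD N (s + t) = prodD N s + prodD N t.
      by elim: (N) => //= j ->; rewrite /Dw raddfD; ring.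
    by rewrite !prodDshiftB; ring.
  by apply: xSB; [apply: xSB|]; apply: (tauP _ _).2.
- move=> t St; have SXt : S (X * t) by apply: integral_mul => //; apply: integral_id.
  apply: inj; first by apply: integral_sub => //; apply: Stau.
  rewrite prodDshiftB; have := (tauP _ SXt).2.
  by rewrite prodDX // (mulrC X (prodDshift N t)) mulrK.
- move=> z s Sz Ss Dz; have Szs := integral_mul Sz Ss.
  apply: inj; first by apply: integral_sub; [|apply: integral_mul => //]; apply: Stau.
  have h1 := (tauP _ Szs).2; have h2 := xS_mull Sz (tauP _ Ss).2.
  have h3 : xS 1 (prodD N (z * s) / X - z * (prodD N s / X)).
    apply/xSXP; have -> : X * (prodD N (z * s) / X - z * (prodD N s / X)) =
       X / X * (prodD N (z * s) - z * prodD N s) by ring.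
    by rewrite divrr // mul1r; apply: prodD_scal.
  have h4 : xS 1 (prodDshift N (z * tau s) - z * prodDshift N (tau s)).
    apply/xSXP.
    have -> : X * (prodDshift N (z * tau s) - z * prodDshift N (tau s)) =
      prodD N (z * (X * tau s)) - z * prodD N (X * tau s).
      by rewrite [z * (X * _)]mulrCA !prodDX //; ring.
    by apply: prodD_scal => //; apply: integral_mul; [apply: integral_id|apply: Stau].
  rewrite prodDshiftB.
  have -> : prodDshift N (tau (z * s)) - prodDshift N (z * tau s) =
     (prodDshift N (tau (z * s)) - prodD N (z * s) / X) +
     (prodD N (z * s) / X - z * (prodD N s / X)) -
     z * (prodDshift N (tau s) - prodD N s / X) -
     (prodDshift N (z * tau s) - z * prodDshift N (tau s)) by ring.
  by apply: xSB => //; apply: xSB => //; apply: xSD.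
Qed.

End DerivationOnNormalization.

(** * The total fraction ring as a finite extension of k(x) *)

Lemma poly_split0 (C : nzRingType) (p : {poly C}) : p != 0 ->
  exists a (q : {poly C}), p = q * 'X^a /\ q`_0 != 0.
Proof.
elim/poly_ind: p => [|p c IH]; first by rewrite eqxx.
have [->|c0 _] := eqVneq c 0.
  rewrite addr0 => pX0; have [|a [q [-> q0]]] := IH.
    by apply: contraNneq pX0 => ->; rewrite mul0r.
  by exists a.+1, q; rewrite exprSr mulrA.
by exists 0%N, (p * 'X + c%:P); rewrite expr0 mulr1 coefD coefMX coefC add0r.
Qed.

Section CurveFractions.
Variables (k : fieldType) (A : comAlgType k) (R : comUnitAlgType k).
Variables (phi : {rmorphism A -> R}) (Q : comUnitRingType).
Variable iota : {rmorphism R -> Q}.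
Hypothesis hchar : [pchar k] =i pred0.
Hypothesis hfg : fin_gen_alg A.
Hypothesis phiZ : forall (c : k) a, phi (c *: a) = c *: phi a.
Hypothesis hdep : forall u v, exists2 f, f != 0 & ev2 (phi u) (phi v) f = 0.
Hypothesis hfrac : forall r, exists a s, phi s \is a GRing.unit /\ r = phi a / phi s.
Hypothesis Rred : reduced R.
Hypothesis Mid : is_ideal (@max_ideal R).
Hypothesis hnzd : forall r, nonzerodivisor r -> iota r \is a GRing.unit.
Hypothesis hQ : forall q, exists r s, nonzerodivisor s /\ q = iota r / iota s.
Hypothesis iota_inj : forall r, iota r = 0 -> r = 0.
Variable xi : A.
Local Notation x := (phi xi).
Hypotheses (Mx : max_ideal x) (nzdx : nonzerodivisor x).
Local Notation X := (iota x).
Local Notation S := (integralOver iota).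
Local Notation kscal := (kscal iota).

Let uX : X \is a GRing.unit := hnzd nzdx.

Definition xev : {rmorphism {poly k} -> Q} := polyev kscal X.

Lemma xevE p : xev p = iota (ev1 x p).
Proof.
by rewrite /ev1 polyevE -horner_map -map_poly_comp.
Qed.

Lemma xev2E f r : polyev xev (iota r) f = iota (polyev (ev1 x) r f).
Proof.
rewrite [Y in _ = iota Y]polyevE -(horner_map iota) -map_poly_comp polyevE.
by congr (_.[_]); apply: eq_map_poly => p; apply: xevE.
Qed.

Lemma ev1_split (p : {poly k}) : p != 0 ->
  exists a u, u \is a GRing.unit /\ ev1 x p = x ^+ a * u.
Proof.
move=> /poly_split0[a [q [-> q0]]]; exists a, (ev1 x q).
rewrite rmorphM rmorphXn /= [ev1 x 'X]polyevX mulrC; split=> //.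
elim/poly_ind: q q0 => [|q c _]; first by rewrite coef0 eqxx.
rewrite coefD coefMX coefC add0r /= => c0.
rewrite rmorphD rmorphM [ev1 x 'X]polyevX [ev1 x c%:P]polyevC addrC.
apply: local_unitD => //; first exact: alg_scalar_unit.
by have [_ [_]] := Mid; apply.
Qed.

Lemma xev_split (p : {poly k}) : p != 0 ->
  exists a u, u \is a GRing.unit /\ xev p = X ^+ a * iota u.
Proof.
move=> /ev1_split[a [u [uu e]]]; exists a, u; split=> //.
by rewrite xevE e rmorphM rmorphXn.
Qed.

Lemma xev_unit (p : {poly k}) : p != 0 -> xev p \is a GRing.unit.
Proof.
move=> /xev_split[a [u [uu ->]]].
by rewrite unitrM unitrX // (rmorph_unit iota).
Qed.

Lemma relation_const_neq0 (b : Q) (f : {poly {poly k}}) : b \is a GRing.unit ->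
  f != 0 -> polyev xev b f = 0 ->
  exists (h : {poly k}) g, h != 0 /\ xev h = b * polyev xev b g.
Proof.
move=> ub; elim/poly_ind: f => [|f c IH]; first by rewrite eqxx.
rewrite rmorphD rmorphM polyevX polyevC.
have [->|c0 _] := eqVneq c 0.
  rewrite addr0 rmorph0 addr0 => f0 /(canRL (mulrK ub)); rewrite mul0r; apply: IH.
  by apply: contraNneq f0 => ->; rewrite mul0r.
rewrite addrC => /eqP; rewrite addr_eq0 => /eqP e.
by exists c, (- f); split=> //; rewrite e rmorphN mulrN mulrC.
Qed.

(** Q has finite dimension over k(x). [G q] below says that multiplication by q preserves the span
    of [E]; it passes to sums, products and, through a relation with nonzero constant term, to
    inverses of elements coming from A. *)
Lemma fraction_span : exists E, forall q, wspan xev (fun q => q = 0) E q.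
Proof.
have Jid : is_ideal (fun q : Q => q = 0).
  by split=> //; split=> [a b -> ->|r b ->]; rewrite ?addr0 ?mulr0.
have dep a : exists2 f : {poly {poly k}}, f != 0 & polyev xev (iota (phi a)) f = 0.
  by have [f f0 e] := hdep xi a; exists f => //; rewrite xev2E -[polyev _ _ f]/(ev2 x _ f) e rmorph0.
have [s sP] := hfg.
have [|E [E1 sE]] := @wspan_mul_stable {poly k} Q xev _ Jid [seq iota (phi b) | b <- s].
  by move=> _ /mapP[b _ ->]; have [f] := dep b; exists f.
exists E.
pose G q := forall e, e \in E -> wspan xev (fun q => q = 0) E (q * e).
have GD p q : G p -> G q -> G (p + q).
  by move=> hp hq e Ee; rewrite mulrDl; apply: (wspanD Jid); [apply: hp|apply: hq].
have GM p q : G p -> G q -> G (p * q).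
  move=> hp hq e Ee; have -> : p * q * e = (q * e) * p by ring.
  by apply: (wspan_mulr Jid (hq e Ee)) => e' Ee'; rewrite mulrC; apply: hp.
have Gk h : G (xev h).
  by move=> e Ee; apply: (wspanZ Jid); apply: wspan_span; exact: span_mod_mem.
have GA a : G (iota (phi a)).
  apply: (sP (fun a => G (iota (phi a)))) => [c|b sb|a' b|a' b].
  - have -> : iota (phi c%:A) = xev c%:P.
      by rewrite /xev polyevC phiZ rmorph1.
    exact: Gk.
  - by move=> e Ee; apply: sE => //; apply: map_f.
  - by rewrite !rmorphD; apply: GD.
  - by rewrite !rmorphM; apply: GM.
have Gpoly b (g : {poly {poly k}}) : G b -> G (polyev xev b g).
  move=> Gb; elim/poly_ind: g => [|g c IH]; first by rewrite rmorph0 -(rmorph0 xev).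
  by rewrite rmorphD rmorphM polyevX polyevC; apply: (GD) => //; apply: (GM).
have Ginv a : iota (phi a) \is a GRing.unit -> G (iota (phi a))^-1.
  move=> ua; have [f f0 e] := dep a.
  have [h [g [h0 e']]] := relation_const_neq0 ua f0 e.
  have Gg := Gpoly _ g (GA a).
  move=> b Eb; apply: (wspan_div h0); rewrite e'; set y := iota _ in ua *.
  have -> : y * polyev xev y g * (y^-1 * b) = y / y * (polyev xev y g * b) by ring.
  by rewrite divrr // mul1r; apply: Gg.
have GR r : G (iota r).
  have [a [t [ut ->]]] := hfrac r; rewrite rmorphM rmorphV //.
  by apply: (GM) => //; apply: Ginv; apply: rmorph_unit.
move=> q; have [r [t [nt ->]]] := hQ q.
have Gt : G (iota t)^-1.
  have [b [t' [ut' et]]] := hfrac t.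
  have eb : iota (phi b) = iota t * iota (phi t') by rewrite -rmorphM et divrK.
  have ub : iota (phi b) \is a GRing.unit.
    by rewrite eb unitrM hnzd //; apply: rmorph_unit.
  have -> : (iota t)^-1 = iota (phi t') / iota (phi b).
    have u1 := hnzd nt; have u2 : iota (phi t') \is a GRing.unit := rmorph_unit iota ut'.
    by rewrite eb invrM // mulVKr.
  by apply: (GM) => //; apply: Ginv.
rewrite -[_ / _]mul1r; apply: (wspan_mulr Jid E1) => e Ee.
by rewrite mulrC; apply: (GM).
Qed.

Lemma fraction_degree_bound : exists dd, forall q, exists2 c : 'I_dd.+1 -> {poly k},
  (exists i, c i != 0) & \sum_i xev (c i) * q ^+ i = 0.
Proof.
have [E Eall] := fraction_span; exists (size E) => q.
apply: (@wspan_dependent _ _ xev (fun q => q = 0) _ E (size E).+1 (fun i => q ^+ i)) => //.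
by split=> //; split=> [a b -> ->|r b ->]; rewrite ?addr0 ?mulr0.
Qed.

Lemma fraction_algebraic q : exists2 f : {poly {poly k}}, f != 0 & polyev xev q f = 0.
Proof.
have [dd h] := fraction_degree_bound; have [c [i0 ci0] e] := h q.
pose f : {poly {poly k}} := \poly_(i < dd.+1) c (inord i).
exists f.
  apply: contraNneq ci0 => /polyP/(_ i0); rewrite coef_poly ltn_ord coef0 inord_val.
  by move=> ->.
rewrite polyevE (horner_coef_wide _ (leq_trans (size_poly _ _) (size_poly _ _))) -[RHS]e.
by apply: eq_bigr => i _; rewrite coef_map coef_poly ltn_ord inord_val.
Qed.

Lemma frac_reduced : reduced Q.
Proof.
move=> q n; have [r [s [ns ->]]] := hQ q; have us := hnzd ns.
rewrite exprMn => /(congr1 ( *%R^~ (iota s ^+ n))); rewrite -mulrA -exprMn mulVr // expr1n.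
by rewrite mulr1 mul0r -rmorphXn => /iota_inj/Rred ->; rewrite rmorph0 mul0r.
Qed.

Lemma frac_nat_unit n : (0 < n)%N -> n%:R \is a @GRing.unit Q.
Proof.
move=> n0; rewrite -(rmorph_nat kscal); apply: rmorph_unit.
by rewrite unitfE ((pcharf0P _).1 hchar) -lt0n.
Qed.

Fact log_deriv_additive (p q : {poly k}) :
  xev ('X * (p + q)^`()) = xev ('X * p^`()) + xev ('X * q^`()).
Proof. by rewrite derivD mulrDr rmorphD. Qed.

Lemma fraction_derivation : exists D : {additive Q -> Q},
  [/\ der_over id D, D X = X & forall c, D (kscal c) = 0].
Proof.
pose d : {additive {poly k} -> Q} := additive_of log_deriv_additive.
have dM : der_over xev d.
  by move=> p q; rewrite /d /= derivM !rmorphM rmorphD !rmorphM; ring.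
have [D [DM DE]] := derivation_of_reduced_ring dM frac_reduced frac_nat_unit xev_unit fraction_algebraic.
exists D; split=> // [|c].
  rewrite -{1}[X](polyevX kscal) -/xev DE /d /= derivX mulr1.
  exact: polyevX.
by rewrite -[kscal c](polyevC kscal X) -/xev DE /d /= derivC mulr0 rmorph0.
Qed.

Lemma fraction_separable_relation r : exists f : {poly {poly k}},
  polyev (ev1 x) r f = 0 /\ nonzerodivisor (polyev (ev1 x) r f^`()).
Proof.
have [f f0 fu] := separable_relation_unit frac_reduced frac_nat_unit xev_unit fraction_algebraic (iota r).
exists f; split; first by apply: iota_inj; rewrite -xev2E.
move=> z e; apply: iota_inj; apply: (mulrI fu).
by rewrite xev2E -rmorphM e rmorph0 mulr0.
Qed.

Lemma fraction_step : exists2 N, (0 < N)%N &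
  forall v n (j : int), S (v ^+ (N * n.+1) * X ^ (- (j * n.+1%:Z + 1))) ->
    filt iota x N (j + 1) v.
Proof.
(* Differences of exponents in relations of degree at most [dd] all divide the factorial of [dd]. *)
have [dd h] := fraction_degree_bound; exists dd`!; first exact: fact_gt0.
move=> v n j Sv; have [c [i0 ci0] e] := h v.
have /choice[f fP] : forall i : 'I_dd.+1, exists au : nat * R,
    c i != 0 -> au.2 \is a GRing.unit /\ xev (c i) = X ^+ au.1 * iota au.2.
  move=> i; have [ci|/xev_split[a [u ?]]] := boolP (c i == 0); last by exists (a, u).
  by exists (0%N, 0) => /negP[].
apply: (@filt_step R Q iota x Mid Mx uX dd`! (fact_gt0 _) dd (fun i => c i != 0)
   (fun i => (f (inord i)).2) (fun i => (f (inord i)).1) v n j) => //.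
- by move=> i /andP[i0' le_i]; apply: dvdn_fact; rewrite i0'.
- by exists i0.
- by move=> i ci; rewrite inord_val; case: (fP i ci).
rewrite -[RHS]e big_mkcond; apply: eq_bigr => i _.
case: eqVneq => [->|ci]; first by rewrite rmorph0 mul0r.
by rewrite inord_val; have [_ ->] := fP i ci; congr (_ * _); rewrite mulrC.
Qed.

Lemma xev_residue (p : {poly k}) : exists2 s, S s & xev p = kscal p.[0] + X * s.
Proof.
elim/poly_ind: p => [|p c _].
  by exists 0; [apply: integral0|rewrite horner0 !rmorph0 mulr0 addr0].
exists (xev p); first by rewrite xevE; apply: integral_id.
by rewrite rmorphD rmorphM [xev 'X]polyevX [xev c%:P]polyevC hornerMXaddC mulr0 add0r addrC mulrC.
Qed.

(** As long as all coefficients vanish at x = 0, a factor x can be cancelled, which lowers the bound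
    on their degrees. *)
Lemma relation_nonzero_residue (u : Q) (f : {poly {poly k}}) :
  f != 0 -> polyev xev u f = 0 -> exists2 g : {poly {poly k}},
    map_poly (horner_eval 0) g != 0 & polyev xev u g = 0.
Proof.
have [n [_]] := coef_size_bound f.
elim: n f => [|n IH] f sf f0 fu.
  case/eqP: f0; apply/polyP => i; apply/eqP; rewrite coef0 -size_poly_leq0; exact: sf.
have [e|ne] := eqVneq (map_poly (horner_eval 0) f) 0; last by exists f.
have /choice[g gP] : forall i, exists q : {poly k}, f`_i = q * 'X.
  move=> i; have /factor_theorem[q] : root f`_i 0.
    by have /polyP/(_ i) := e; rewrite coef_map coef0 => /rootP.
  by rewrite subr0; exists q.
pose h : {poly {poly k}} := \poly_(i < size f) g i.
have fE : f = h * ('X)%:P.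
  apply/polyP => i; rewrite coefMC coef_poly; case: ltnP => // le_i.
  by rewrite nth_default // mul0r.
have h0 : h != 0 by apply: contraNneq f0 => h0; rewrite fE h0 mul0r.
apply: (IH h) => //.
  move=> i; have := sf i; rewrite fE coefMC.
  have [->|hi0] := eqVneq h`_i 0; first by rewrite size_poly0.
  by rewrite size_mulX.
have := fu; rewrite fE rmorphM polyevC [xev 'X]polyevX => /(canRL (mulrK uX)).
by rewrite mul0r.
Qed.

(** Residues are algebraic over k: putting x = 0 in the coefficients of a relation for u changes its
    value by an element of x S. *)
Lemma fraction_residue u : S u -> exists2 p : {poly k}, p != 0 & radX iota x (polyev kscal u p).
Proof.
move=> Su; have [f f0 fu] := fraction_algebraic u.
have [g g0 gu] := relation_nonzero_residue f0 fu.
exists (map_poly (horner_eval 0) g) => //; exists 1%N; rewrite expr1.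
have -> : polyev kscal u (map_poly (horner_eval 0) g) =
  - (polyev xev u g - polyev kscal u (map_poly (horner_eval 0) g)) by rewrite gu sub0r opprK.
rewrite mulNr; apply: integral_opp.
elim/poly_ind: g {g0 gu} => [|g c IH].
  by rewrite !rmorph0 subrr mul0r; apply: integral0.
have [s Ss es] := xev_residue c.
rewrite !rmorphD !rmorphM /= map_polyX map_polyC !polyevX !polyevC es /horner_eval.
set a := polyev xev u g in IH *; set b := polyev kscal u _ in IH *.
have -> : (a * u + (kscal c.[0] + X * s) - (b * u + kscal c.[0])) / X =
   (a - b) / X * u + X / X * s by ring.
by rewrite divrr // mul1r; apply: integral_add => //; apply: integral_mul.
Qed.

(** The constant term of a relation for b is b times an integral element, and also a power of x
    times a unit of R. *)
Lemma inverse_bound b : S b -> b \is a GRing.unit -> exists a, S (X ^+ a * b^-1).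
Proof.
move=> Sb ub; have [f f0 fb] := fraction_algebraic b.
have [h [g [h0 e]]] := relation_const_neq0 ub f0 fb.
have [a [u [uu eh]]] := xev_split h0; exists a.
have Sg : S (polyev xev b g).
  rewrite polyevE; apply: integral_horner => //.
  by apply/integral_poly => i; rewrite coef_map; have := integral_id iota (ev1 x g`_i); rewrite -xevE.
have -> : X ^+ a * b^-1 = iota u^-1 * polyev xev b g.
  have uiu : iota u \is a GRing.unit := rmorph_unit iota uu.
  apply: (mulrI ub); rewrite mulrCA mulrV // mulr1 mulrCA -e eh rmorphV //.
  by rewrite mulrCA mulVr ?mulr1.
by apply: integral_mul => //; apply: integral_id.
Qed.

Lemma fraction_pole q : exists a, S (X ^+ a * q).
Proof.
have [r [s [ns ->]]] := hQ q.
have [a Sa] := inverse_bound (integral_id iota s) (hnzd ns); exists a.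
by rewrite mulrCA; apply: integral_mul => //; apply: integral_id.
Qed.

(** A bound for finitely many generators extends to A by the Leibniz rule, and to R by the quotient
    rule, as the denominators are units of R. *)
Lemma derivation_pole (D : {additive Q -> Q}) : der_over id D ->
  (forall c, D (kscal c) = 0) ->
  exists C, forall r, S (X ^+ C * D (iota r)).
Proof.
move=> DM Dk; have [s sP] := hfg.
have mono a b q : (a <= b)%N -> S (X ^+ a * q) -> S (X ^+ b * q).
  move=> le_ab; rewrite (exprnBM X le_ab) -mulrA; apply: integral_mul.
  exact/integral_exp/integral_id.
have [C CP] : exists C, forall b, b \in s -> S (X ^+ C * D (iota (phi b))).
  elim: s {sP} => [|b s [C CP]]; first by exists 0%N.
  have [a Sa] := fraction_pole (D (iota (phi b))); exists (a + C)%N => b'.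
  rewrite inE => /orP[/eqP ->|/CP h]; first by apply: (mono a) => //; apply: leq_addr.
  by apply: (mono C) => //; apply: leq_addl.
have CA a : S (X ^+ C * D (iota (phi a))).
  apply: (sP (fun a => S (X ^+ C * D (iota (phi a))))) => // [c|a' b|a' b].
  - by rewrite phiZ rmorph1 -[iota c%:A]/(kscal c) Dk mulr0; apply: integral0.
  - by rewrite !rmorphD raddfD mulrDr; apply: integral_add.
  - rewrite !rmorphM DM mulrDr ![X ^+ C * (_ * _)]mulrCA => ha hb.
    by apply: integral_add; apply: integral_mul => //; apply: integral_id.
exists C => r; have [a [t [ut er]]] := hfrac r.
have eD : iota (phi t) * D (iota r) = D (iota (phi a)) - iota r * D (iota (phi t)).
  have -> : iota (phi a) = iota r * iota (phi t) by rewrite er -rmorphM divrK.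
  by rewrite DM; ring.
have uit : iota (phi t) \is a GRing.unit := rmorph_unit iota ut.
rewrite -[D (iota r)](mulKr uit) eD -rmorphV // mulrCA mulrBr.
apply: integral_mul; first exact: integral_id.
by apply: integral_sub => //; rewrite mulrCA; apply: integral_mul => //; apply: integral_id.
Qed.

Lemma log_derivation : (forall s, S s -> exists r, X ^+ 3 * s = iota r) ->
  exists (N : nat) (D : {additive Q -> Q}), [/\ (0 < N)%N, der_over id D, D X = X,
    forall c, D (kscal c) = 0 &
    forall j s, filt iota x N j s -> filt iota x N (j + 1) (Dw iota N D j s)].
Proof.
move=> hcube; have [N N0 hstep] := fraction_step.
have [D [DM DX Dk]] := fraction_derivation; exists N, D; split=> //.
have [C hC] := derivation_pole DM Dk.
apply: (log_bound_all hchar Mid Mx uX N0 hstep fraction_residue DM DX Dk).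
exact: (log_bound_init uX N0 DM DX Dk hcube hC).
Qed.

End CurveFractions.

(** * Detecting nonzero differentials *)

Section CoinducedModule.
Variables (R : comUnitRingType) (G : zmodType).

Record coind := Coind {
  coind_fun : R -> G;
  coind_add : forall a b, coind_fun (a + b) = coind_fun a + coind_fun b }.

Lemma coind_eq (f g : coind) : coind_fun f =1 coind_fun g -> f = g.
Proof.
case: f g => f fD [g gD] /= /funext fg; rewrite fg in fD *.
by rewrite (Prop_irrelevance fD gD).
Qed.

HB.instance Definition _ := gen_eqMixin coind.
HB.instance Definition _ := gen_choiceMixin coind.

Program Definition coind0 := @Coind (fun=> 0) _.
Next Obligation. by rewrite addr0. Qed.
Program Definition coind_opp (f : coind) := @Coind (fun a => - coind_fun f a) _.
Next Obligation. by rewrite coind_add opprD. Qed.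
Program Definition coind_plus (f g : coind) :=
  @Coind (fun a => coind_fun f a + coind_fun g a) _.
Next Obligation. by rewrite !coind_add addrACA. Qed.
Program Definition coind_scale (r : R) (f : coind) :=
  @Coind (fun a => coind_fun f (a * r)) _.
Next Obligation. by rewrite mulrDl coind_add. Qed.

Fact coind_plusA : associative coind_plus.
Proof. by move=> f g h; apply: coind_eq => a /=; rewrite addrA. Qed.
Fact coind_plusC : commutative coind_plus.
Proof. by move=> f g; apply: coind_eq => a /=; rewrite addrC. Qed.
Fact coind_plus0 : left_id coind0 coind_plus.
Proof. by move=> f; apply: coind_eq => a /=; rewrite add0r. Qed.
Fact coind_plusN : left_inverse coind0 coind_opp coind_plus.
Proof. by move=> f; apply: coind_eq => a /=; rewrite addNr. Qed.

HB.instance Definition _ :=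
  GRing.isZmodule.Build coind coind_plusA coind_plusC coind_plus0 coind_plusN.

Fact coind_scaleA a b (f : coind) :
  coind_scale a (coind_scale b f) = coind_scale (a * b) f.
Proof. by apply: coind_eq => c /=; rewrite -mulrA. Qed.
Fact coind_scale1 : left_id 1 coind_scale.
Proof. by move=> f; apply: coind_eq => a /=; rewrite mulr1. Qed.
Fact coind_scaleDr : right_distributive coind_scale +%R.
Proof. by move=> r f g; apply: coind_eq. Qed.
Fact coind_scaleDl (f : coind) : {morph coind_scale^~ f : a b / a + b}.
Proof. by move=> a b; apply: coind_eq => c /=; rewrite mulrDr coind_add. Qed.

HB.instance Definition _ := GRing.Zmodule_isLmodule.Build R coind
  coind_scaleA coind_scale1 coind_scaleDr coind_scaleDl.

Lemma coind_funD (f g : coind) a : coind_fun (f + g) a = coind_fun f a + coind_fun g a.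
Proof. by []. Qed.

Lemma coind_funZ r (f : coind) a : coind_fun (r *: f) a = coind_fun f (a * r).
Proof. by []. Qed.

End CoinducedModule.

Section SubgroupQuotient.
Variables (Q : zmodType) (Y : pset Q).
Hypotheses (Y0 : Y 0) (YB : forall a b, Y a -> Y b -> Y (a - b)).

Definition subgroup_pred (_ : Y 0) (_ : forall a b, Y a -> Y b -> Y (a - b)) :
  {pred Q} := fun a => `[< Y a >].

Fact subgroup_pred_closed : zmod_closed (subgroup_pred Y0 YB).
Proof.
split; first exact/asboolP.
by move=> a b /asboolP Ya /asboolP Yb; apply/asboolP/YB.
Qed.

HB.instance Definition _ := GRing.isZmodClosed.Build Q (subgroup_pred Y0 YB)
  subgroup_pred_closed.

Definition subgroup_quotient : zmodType := {ideal_quot (subgroup_pred Y0 YB)}.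

Definition subgroup_proj : {additive Q -> subgroup_quotient} :=
  (\pi_{ideal_quot (subgroup_pred Y0 YB)})%qT.

Lemma subgroup_proj_eq0 a : subgroup_proj a = 0 <-> Y a.
Proof.
rewrite /subgroup_proj /=; split=> [h|Ya].
  have : (a - 0 \in subgroup_pred Y0 YB).
    by rewrite Quotient.idealrBE h; apply/eqP; rewrite raddf0.
  by rewrite subr0 => /asboolP.
suff : (a - 0 \in subgroup_pred Y0 YB) by rewrite Quotient.idealrBE => /eqP ->; rewrite raddf0.
by rewrite subr0; apply/asboolP.
Qed.

Lemma subgroup_proj_eq a b : subgroup_proj a = subgroup_proj b <-> Y (a - b).
Proof.
rewrite -subgroup_proj_eq0 raddfB; split=> [->|/eqP]; first by rewrite subrr.
by rewrite subr_eq0 => /eqP.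
Qed.

End SubgroupQuotient.

Section KaehlerDetection.
Variables (k : fieldType) (R : comUnitAlgType k) (Om : lmodType R) (d : R -> Om).
Hypothesis hOm : is_kaehler d.

(** The universal property needs an R-module as target, while [G] is only a group: y is sent to the
    map a -> Psi (a, y) in the module of additive maps from R to [G], which is a derivation by the
    hypotheses, and evaluation at 1 recovers the sum. *)
Lemma kaehler_pairing (G : zmodType) (Psi : R -> R -> G) :
  (forall a a' y, Psi (a + a') y = Psi a y + Psi a' y) ->
  (forall a y y', Psi a (y + y') = Psi a y + Psi a y') ->
  (forall a y y', Psi a (y * y') = Psi (a * y) y' + Psi (a * y') y) ->
  (forall a (c : k) y, Psi a (c *: y) = Psi (c *: a) y) ->
  forall s : seq (R * R), \sum_(p <- s) p.1 *: d p.2 = 0 ->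
    \sum_(p <- s) Psi p.1 p.2 = 0.
Proof.
move=> PDl PDr PM PZ s.
pose Delta (y : R) : coind R G := @Coind R G (fun a => Psi a y) (fun a b => PDl a b y).
have [|f [flin [fd _]]] := hOm.2 (coind R G : lmodType R) Delta.
  split; first by move=> a b; apply: coind_eq => e; apply: PDr.
  split; first by move=> a b; apply: coind_eq => e; apply: PM.
  by move=> c a; apply: coind_eq => e; rewrite coind_funZ /= PZ mulr_algr.
have f0 : f 0 = 0.
  by have := flin 1 0 0; rewrite !scale1r addr0 => /esym/eqP; rewrite -subr_eq0 addrK => /eqP.
have fsum : f (\sum_(p <- s) p.1 *: d p.2) = \sum_(p <- s) p.1 *: Delta p.2.
  elim: s => [|p s IH]; first by rewrite !big_nil.
  by rewrite !big_cons flin fd IH.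
move=> e; rewrite e f0 in fsum.
suff -> : \sum_(p <- s) Psi p.1 p.2 = coind_fun (\sum_(p <- s) p.1 *: Delta p.2) 1.
  by rewrite -fsum.
elim: s {fsum e} => [|p s IH]; first by rewrite !big_nil.
by rewrite !big_cons coind_funD coind_funZ mul1r IH.
Qed.

Lemma kaehler_pairing_mod (Q : zmodType) (Y : pset Q) (Psi : R -> R -> Q) :
  Y 0 -> (forall a b, Y a -> Y b -> Y (a - b)) ->
  (forall a a' y, Y (Psi (a + a') y - (Psi a y + Psi a' y))) ->
  (forall a y y', Y (Psi a (y + y') - (Psi a y + Psi a y'))) ->
  (forall a y y', Y (Psi a (y * y') - (Psi (a * y) y' + Psi (a * y') y))) ->
  (forall a (c : k) y, Y (Psi a (c *: y) - Psi (c *: a) y)) ->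
  forall s : seq (R * R), \sum_(p <- s) p.1 *: d p.2 = 0 ->
    Y (\sum_(p <- s) Psi p.1 p.2).
Proof.
move=> Y0 YB PDl PDr PM PZ s e; apply/(subgroup_proj_eq0 Y0 YB); rewrite raddf_sum.
apply: (@kaehler_pairing _ (fun a y => subgroup_proj Y0 YB (Psi a y))) => //.
- by move=> a a' y; rewrite -raddfD; apply/subgroup_proj_eq.
- by move=> a y y'; rewrite -raddfD; apply/subgroup_proj_eq.
- by move=> a y y'; rewrite -raddfD; apply/subgroup_proj_eq.
- by move=> a c y; apply/subgroup_proj_eq.
Qed.

Lemma kderivation_polyev (y x : R) (f : {poly {poly k}}) :
  d (polyev (ev1 x) y f) =
  polyev (ev1 x) y (map_poly (@deriv k) f) *: d x + polyev (ev1 x) y f^`() *: d y.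
Proof.
have [[dD [dM dZ]] _] := hOm.
have d1 : d 1 = 0.
  have := dM 1 1; rewrite mulr1 !scale1r => /eqP.
  by rewrite -subr_eq0 opprD addNKr oppr_eq0 => /eqP.
have dk (c : k) : d (c%:A) = 0 by rewrite dZ d1 scaler0.
have d0 : d 0 = 0 by rewrite -(scale0r (1 : R)) dk.
have d_ev1 (p : {poly k}) : d (ev1 x p) = ev1 x p^`() *: d x.
  elim/poly_ind: p => [|p c IH]; first by rewrite deriv0 !rmorph0 d0 scale0r.
  rewrite rmorphD rmorphM [ev1 x 'X]polyevX [ev1 x c%:P]polyevC dD dM IH dk addr0.
  rewrite derivD derivC addr0 derivM derivX mulr1 rmorphD rmorphM [ev1 x 'X]polyevX.
  by rewrite scalerA scalerDl addrC [x * _]mulrC.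
elim/poly_ind: f => [|f c IH]; first by rewrite !raddf0 d0 !scale0r addr0.
have -> : map_poly (@deriv k) (f * 'X + c%:P) = map_poly (@deriv k) f * 'X + (c^`())%:P.
  rewrite raddfD /= map_polyC; congr (_ + _); apply/polyP => i.
  by rewrite coefMX coef_map coefMX /=; case: eqP => _ //; rewrite ?deriv0 // coef_map.
rewrite !(rmorphD, rmorphM) /= polyevX !polyevC dD dM IH d_ev1.
rewrite derivD derivC addr0 derivM derivX mulr1 rmorphD rmorphM polyevX.
rewrite !scalerDl scalerDr !scalerA -!addrA [y * _]mulrC [y * _]mulrC addrC -!addrA.
congr (_ + _); rewrite addrC -!addrA; congr (_ + _).
by rewrite addrC.
Qed.

End KaehlerDetection.

(** * The torsion of the Kaehler differentials *)

Lemma max_ideal_prime (R : comUnitRingType) : is_ideal (@max_ideal R) ->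
  is_prime_ideal (@max_ideal R).
Proof.
move=> Mid; split; first by split=> // /max_idealP[]; exact: unitr1.
move=> a b /max_idealP; rewrite unitrM => nab.
have [ua|nua] := boolP (a \is a GRing.unit); [right|left]; apply/max_idealP.
  by move=> ub; apply: nab; rewrite ua.
exact/negP.
Qed.

Lemma polyev_taylor (C B : comNzRingType) (j : {rmorphism C -> B}) (a h : B) (p : {poly C}) :
  exists w, polyev j (a + h) p = polyev j a p + h * polyev j a p^`() + h ^+ 2 * w.
Proof.
elim/poly_ind: p => [|p c [w IH]].
  by exists 0; rewrite deriv0 !rmorph0 !mulr0 !addr0.
exists (w * (a + h) + polyev j a p^`()).
rewrite derivD derivC addr0 derivM derivX mulr1 !rmorphD !rmorphM !polyevX !polyevC IH.
by ring.
Qed.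

Section SquareOfMaximalIdeal.
Variables (R : comUnitRingType).
Hypothesis Mid : is_ideal (@max_ideal R).
Local Notation M := (@max_ideal R).

(** As an intersection of ideals, membership is exploited by choosing a suitable ideal [I]. *)
Definition maxsq : pset R := fun t => forall I, is_ideal I ->
  (forall a b, M a -> M b -> I (a * b)) -> I t.

Lemma maxsq_ideal : is_ideal maxsq.
Proof.
split; first by move=> I [].
split=> [a b ha hb|r a ha] I Iid IM; have [_ [Iadd Imul]] := Iid.
  by apply: Iadd; [apply: ha|apply: hb].
by apply: (Imul); apply: ha.
Qed.

Lemma maxsq_mul a b : M a -> M b -> maxsq (a * b).
Proof. by move=> Ma Mb I _; apply. Qed.

(* H is maximal among the ideals modulo which x and y stay independent. *)
Lemma separating_ideal x y : ~ maxsq x -> ~ ideal_adjoin maxsq x y ->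
  exists H, [/\ is_ideal H, forall t, maxsq t -> H t, ~ H x, ~ ideal_adjoin H x y &
    forall t, M t -> exists h a b, H h /\ t = h + a * x + b * y].
Proof.
move=> nx ny.
have [||H [[Hid [nHx nHy]] sH Hmax]] := @pset_zorn R
  (fun H => is_ideal H /\ ~ H x /\ ~ ideal_adjoin H x y) maxsq.
- by split; first exact: maxsq_ideal.
- move=> F Fne FP _ Ftot; split; first by apply: chain_union_ideal => // I /FP[].
  split; first by case=> I /FP[_ [nIx _]].
  by case=> b [c [[I /FP[_ [_ nIy]] Ib] e]]; apply: nIy; exists b, c.
exists H; split=> // t Mt; apply: contrapT => nt.
have [H0 [Hadd Hmul]] := Hid.
(* If [H] is enlarged by t in M, any violation of the two conditions has a unit coefficient at t,
   since M t already lies in [H]; solving for t expresses it by [H], x and y. *)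
have small c : M c -> H (c * t) by move=> Mc; apply: sH; apply: maxsq_mul.
have [Ht|nHt] := pselect (H t).
  by apply: nt; exists t, 0, 0; split=> //; rewrite !mul0r !addr0.
apply: nHt; apply: (Hmax (ideal_adjoin H t)); last 2 first.
- by move=> z; apply: ideal_adjoin_sub.
- exact: ideal_adjoin_mem.
split; first exact: ideal_adjoin_ideal.
split=> [[h [c [Hh e]]]|[z [e [[h [c [Hh ->]]] ey]]]].
  have [/[dup] uc _|/negP/max_idealP Mc] := boolP (c \is a GRing.unit).
    apply: nt; exists (- c^-1 * h), c^-1, 0; split; first exact: Hmul.
    by rewrite e mulrDr mulKr //; ring.
  by apply: nHx; rewrite e; apply: Hadd => //; apply: small.
have [uc|/negP/max_idealP Mc] := boolP (c \is a GRing.unit).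
  apply: nt; exists (- c^-1 * h), (- c^-1 * e), c^-1; split; first exact: Hmul.
  by rewrite ey !mulrDr mulKr //; ring.
apply: nHy; exists (h + c * t), e; split=> //; apply: Hadd => //; exact: small.
Qed.

End SquareOfMaximalIdeal.

Section TorsionFree.
Variables (k : fieldType) (R : comUnitAlgType k) (Q : comUnitRingType).
Variables (iota : {rmorphism R -> Q}) (x : R).
Hypothesis hchar : [pchar k] =i pred0.
Hypothesis Mid : is_ideal (@max_ideal R).
Local Notation M := (@max_ideal R).
Hypothesis Mx : M x.
Hypothesis iota_inj : forall r, iota r = 0 -> r = 0.
Local Notation X := (iota x).
Hypothesis uX : X \is a GRing.unit.
Local Notation S := (integralOver iota).
Local Notation xS := (xS iota x).
Local Notation kscal := (kscal iota).
Variable N : nat.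
Hypothesis N0 : (0 < N)%N.
Variable D : {additive Q -> Q}.
Hypotheses (DM : der_over id D) (DX : D X = X) (Dk : forall c, D (kscal c) = 0).
Hypothesis hD : forall j s, filt iota x N j s -> filt iota x N (j + 1) (Dw iota N D j s).
Hypothesis hres : forall u, S u ->
  exists2 p : {poly k}, p != 0 & radX iota x (polyev kscal u p).
Hypothesis hcube : forall s, S s -> exists r, X ^+ 3 * s = iota r.
Hypothesis hmin : forall y, M y -> xS 1 (iota y).

Let SX : S X := integral_id iota x.
Let xS1P s : S s -> xS 1 (X * s).
Proof. by move=> Ss; apply/(xSXP uX)/xS0. Qed.

Lemma max_of_xS r : xS 1 (iota r) -> M r.
Proof.
move=> /(xSP uX)[t St e]; apply/max_idealP => ur.
apply: (X_notin_unit Mid Mx (integral_mul St (integral_id iota r^-1))).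
by rewrite mulrA -[X]expr1 -e -rmorphM mulrV // rmorph1.
Qed.

Lemma polyev_kscal r p : polyev kscal (iota r) p = iota (polyev (kincl R) r p).
Proof. by rewrite !polyevE -horner_map -map_poly_comp. Qed.

Lemma residue_simple_root r : exists2 p : {poly k}, M (polyev (kincl R) r p) &
  polyev (kincl R) r p^`() \is a GRing.unit.
Proof.
have [p0 p00 rp0] := hres (integral_id iota r).
have Jmul (q : {poly k}) b : radX iota x b -> radX iota x (polyev kscal (iota r) q * b).
  by move=> hb; apply: (radXM _ hb); rewrite polyev_kscal; apply: (integral_id iota).
have Jrad b n : radX iota x (b ^+ n) -> radX iota x b.
  by case=> l h; exists (n * l)%N; rewrite exprM.
have [p [_ sep rp]] := @separable_relation k Q kscal (radX iota x) (iota r) Jmul Jrad hchar p0 p00 rp0.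
have Mp : M (polyev (kincl R) r p).
  have [n h] := radXP Mid Mx uX rp; rewrite polyev_kscal -rmorphXn in h.
  have : M (polyev (kincl R) r p ^+ n.+1) by apply: max_of_xS; rewrite /xS expr1.
  by move=> /max_idealP nu; apply/max_idealP => u; apply/nu/unitrX.
exists p => //; have := sep; rewrite unlock => /Bezout_eq1_coprimepP[[a b] /= e].
have e2 := congr1 (polyev (kincl R) r) e; rewrite rmorphD !rmorphM rmorph1 in e2.
suff : polyev (kincl R) r b * polyev (kincl R) r p^`() \is a GRing.unit.
  by rewrite unitrM => /andP[].
have -> : polyev (kincl R) r b * polyev (kincl R) r p^`() =
    1 + (- polyev (kincl R) r a) * polyev (kincl R) r p.
  by rewrite -[Y in Y + _]e2 mulNr [RHS]addrAC subrr add0r.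
by apply: (local_unitD Mid (unitr1 R)); have [_ [_]] := Mid; exact.
Qed.

Lemma newton_step (p : {poly k}) r : polyev (kincl R) r p^`() \is a GRing.unit ->
  M (polyev (kincl R) r p) -> exists r' w,
  [/\ polyev (kincl R) r' p^`() \is a GRing.unit, M (r - r') &
      polyev (kincl R) r' p = polyev (kincl R) r p ^+ 2 * w].
Proof.
set v := polyev _ _ p^`(); set a := polyev _ _ p => uv Ma.
have Mh : M (- (a / v)) by rewrite -mulrN mulrC; have [_ [_]] := Mid; apply.
have [w e] := polyev_taylor (kincl R) r (- (a / v)) p.
have [w' e'] := polyev_taylor (kincl R) r (- (a / v)) p^`().
exists (r - a / v), (v^-1 ^+ 2 * w); split.
- rewrite e' -/v -addrA; apply: (local_unitD Mid uv).
  rewrite expr2 -mulrA -mulrDr mulrC; have [_ [_]] := Mid; apply => //.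
- by rewrite opprD addrA subrr add0r opprK mulrC; have [_ [_]] := Mid; apply.
- by rewrite e -/v -/a mulNr divrK // subrr add0r sqrrN exprMn; ring.
Qed.

(** An approximate lift of the residue of r to a constant, within R itself. Two Newton steps put
    p(z) in x^4 S, and D (p(z)) = p'(z) D z with p'(z) a unit. *)
Lemma newton_lift r : exists2 z, M (r - z) & xS 4 (D (iota z)).
Proof.
have [p Mp up] := residue_simple_root r.
have [r1 [w1 [u1 Mr1 e1]]] := newton_step up Mp.
have Mp1 : M (polyev (kincl R) r1 p).
  by rewrite e1 expr2 -mulrA mulrC; have [_ [_]] := Mid; apply.
have [z [w [uz Mz e]]] := newton_step u1 Mp1; exists z.
  by have -> : r - z = r - r1 + (r1 - z); [ring|have [_ [Madd _]] := Mid; apply: Madd].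
have Dp : D (iota (polyev (kincl R) z p)) = iota (polyev (kincl R) z p^`()) * D (iota z).
  by rewrite -!polyev_kscal (D_polyev DM Dk).
have uiz := rmorph_unit iota uz.
rewrite -[D (iota z)](mulKr uiz) -Dp -rmorphV //.
apply: xS_mull; first exact: integral_id.
apply: (D_xS hchar uX N0 DM DX Dk hD); rewrite e e1.
have [t St et] := xSP uX (hmin Mp).
have -> : iota ((polyev (kincl R) r p ^+ 2 * w1) ^+ 2 * w) = X ^+ 4 * (t ^+ 4 * iota (w1 ^+ 2 * w)).
  by rewrite !(rmorphM, rmorphXn) et expr1; ring.
apply: xS_mulX => //; apply: integral_mul; last exact: integral_id.
exact: integral_exp.
Qed.

Lemma xM_of_xS4 r : xS 4 (iota r) -> exists2 r', M r' & r = x * r'.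
Proof.
move=> /(xSP uX)[t St e]; have [r' e'] := hcube St; exists r'.
  apply: max_of_xS; rewrite -e' exprS -mulrA; apply: xS1P.
  by apply: integral_mul => //; apply: integral_exp.
by apply/eqP; rewrite -subr_eq0; apply/eqP/iota_inj; rewrite rmorphB rmorphM -e' e; ring.
Qed.

Lemma x_notin_maxsq : ~ maxsq x.
Proof.
move=> h; have /(xSP uX)[t St e] : xS 2 (iota x).
  apply: (h (fun t => xS 2 (iota t))) => [|a b Ma Mb].
    split; first by rewrite rmorph0; apply: xS00.
    split=> [a b ha hb|r a ha]; first by rewrite rmorphD; apply: xSD.
    by rewrite rmorphM; apply: xS_mull => //; apply: integral_id.
  by rewrite rmorphM; apply: (xSM uX (m := 1) (n := 1)); apply: hmin.
apply: (X_notin_unit Mid Mx St); apply: (mulrI uX).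
by rewrite mulr1 {3}e; ring.
Qed.

(** An explicit form of Nakayama's lemma: iterating M = x R + M^2 puts y - x r in x^4 S, and
    elements of R in x^4 S are multiples of x in R. *)
Lemma max_principal : (forall y, M y -> ideal_adjoin (@maxsq R) x y) ->
  forall y, M y -> exists r, y = x * r.
Proof.
move=> hgen; have approx n : forall y, M y -> exists r, xS n.+1 (iota (y - x * r)).
  elim: n => [|n IH] y My.
    by exists 0; rewrite mulr0 subr0; apply: hmin.
  have [m [c [Hm ->]]] := hgen y My.
  have [r hr] : exists r, xS n.+2 (iota (m - x * r)).
    apply: (Hm (fun t => exists r, xS n.+2 (iota (t - x * r)))) => [|a b Ma Mb].
      split; first by exists 0; rewrite mulr0 subr0 rmorph0; apply: xS00.
      split=> [a b [r hr] [r' hr']|a b [r hr]].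
        exists (r + r'); have -> : a + b - x * (r + r') = (a - x * r) + (b - x * r') by ring.
        by rewrite rmorphD; apply: xSD.
      exists (a * r); have -> : a * b - x * (a * r) = a * (b - x * r) by ring.
      by rewrite rmorphM; apply: xS_mull => //; apply: integral_id.
    have [r hr] := IH a Ma; exists (r * b).
    have -> : a * b - x * (r * b) = (a - x * r) * b by ring.
    by rewrite rmorphM -addn1; apply: (xSM uX) => //; apply: hmin.
  by exists (r + c); have -> : m + c * x - x * (r + c) = m - x * r by ring.
move=> y /(approx 3%N)[r /xM_of_xS4[r' _ e]]; exists (r + r').
by rewrite mulrDr -e addrC subrK.
Qed.

Section Kaehler.
Variables (Om : lmodType R) (d : R -> Om).
Hypothesis hOm : is_kaehler d.
Hypothesis hrel : forall r, exists f : {poly {poly k}},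
  polyev (ev1 x) r f = 0 /\ nonzerodivisor (polyev (ev1 x) r f^`()).
Hypothesis htf : forall w r, nonzerodivisor r -> r *: w = 0 -> w = 0 :> Om.

Lemma kaehler_derivation_eq0 (s : seq (R * R)) : \sum_(p <- s) p.1 *: d p.2 = 0 ->
  \sum_(p <- s) iota p.1 * D (iota p.2) = 0.
Proof.
apply: (kaehler_pairing hOm (Psi := fun a y => iota a * D (iota y))) => [a a' y|a y y'|a y y'|a c y].
- by rewrite rmorphD mulrDl.
- by rewrite rmorphD raddfD mulrDr.
- by rewrite !rmorphM DM; ring.
- rewrite -[c *: y]mulr_algl -[c *: a]mulr_algl !rmorphM DM -[iota c%:A]/(kscal c) Dk; ring.
Qed.

(** Up to a nonzerodivisor every d b is a multiple of d x, because b has a separable relation over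
    k[x]. So a nonzerodivisor multiple of the form is g d x, the same multiple of the sum of the a D
    b is g x, and its vanishing gives g = 0. *)
Lemma kaehler_eq0 (s : seq (R * R)) : \sum_(p <- s) iota p.1 * D (iota p.2) = 0 ->
  \sum_(p <- s) p.1 *: d p.2 = 0.
Proof.
have [r [g [nr e1 e2]]] : exists r g, [/\ nonzerodivisor r,
    r *: \sum_(p <- s) p.1 *: d p.2 = g *: d x &
    iota r * \sum_(p <- s) iota p.1 * D (iota p.2) = iota g * X].
  elim: s => [|[a b] s [r [g [nr e1 e2]]]].
    exists 1, 0; rewrite !big_nil scaler0 scale0r mulr0 rmorph0 mul0r; split=> // z.
    by rewrite mul1r.
  have [f [fb nf]] := hrel b; set t := polyev _ _ f^`() in nf.
  pose g' := - polyev (ev1 x) b (map_poly (@deriv k) f).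
  have E : t *: d b = g' *: d x.
    apply/eqP; rewrite -subr_eq0 -scaleNr opprK addrC -(kderivation_polyev hOm b x f) fb.
    have [[dD _] _] := hOm; have := dD 0 0; rewrite addr0 => /eqP.
    by rewrite -subr_eq0 opprD addNKr oppr_eq0.
  have E' : iota t * D (iota b) = iota g' * X.
    have := @kaehler_derivation_eq0 [:: (t, b); (- g', x)].
    rewrite !big_cons !big_nil /= E !addr0 -scalerDl subrr scale0r DX rmorphN mulNr.
    by move=> /(_ erefl)/eqP; rewrite subr_eq0 => /eqP.
  exists (r * t), (t * g + r * a * g'); split.
  - by move=> z; rewrite -mulrA => /nr/nf.
  - rewrite big_cons /= scalerDr [X in X + _]scalerA scalerDl addrC; congr (_ + _).
      by rewrite mulrC -!scalerA e1.
    have -> : r * t * a = r * a * t by ring.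
    by rewrite -!scalerA E.
  - rewrite big_cons /= !rmorphD !rmorphM.
    have -> : iota r * iota t * (iota a * D (iota b) + \sum_(p <- s) iota p.1 * D (iota p.2)) =
      iota r * iota a * (iota t * D (iota b)) +
      iota t * (iota r * \sum_(p <- s) iota p.1 * D (iota p.2)) by ring.
    by rewrite E' e2; ring.
move=> e0; apply: (htf nr); rewrite e1.
have -> : g = 0; last by rewrite scale0r.
by apply: iota_inj; apply: (mulIr uX); rewrite -e2 e0 mulr0 mul0r.
Qed.

Lemma cube_differential s : S s -> exists i i' v, [/\ S v,
  iota i' = X ^+ 4 * v, exists2 r, M r & i' = x * r &
  X ^+ 3 * s = D (iota i) + iota i' * X].
Proof.
move=> Ss; have [u [v [Su Sv e]]] := cube_decomposition hchar uX N0 DM DX Dk hD Ss.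
have [i ei] := hcube Su; have [r er] := hcube Sv.
exists i, (x * r), v; split=> //.
- by rewrite rmorphM -er; ring.
- exists r => //; apply: max_of_xS; rewrite -er; apply: xS_leq (xS_mulX uX 3 Sv) => //.
- by rewrite e ei rmorphM -er; ring.
Qed.

(* The form x dy - y dx is paired with the alternating form of the coordinates
   along x and y on R / (K + H), where K consists of the elements of R that are
   constant modulo x^4 S. *)
Lemma torsion_free_resonant y : M y -> ~ ideal_adjoin (@maxsq R) x y ->
  xS 1 (D (iota y / X)) -> False.
Proof.
move=> My nxy /(xSP uX)[s Ss ey]; rewrite expr1 in ey.
have [H [Hid sH nHx nHy Hgen]] := separating_ideal x_notin_maxsq nxy.
have [H0 [Hadd Hmul]] := Hid; have [_ [Madd Mmul]] := Mid.
pose K z := xS 4 (D (iota z)).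
have KB z z' : K z -> K z' -> K (z - z') by move=> hz hz'; rewrite /K rmorphB raddfB; apply: xSB.
have KD z z' : K z -> K z' -> K (z + z') by move=> hz hz'; rewrite /K rmorphD raddfD; apply: xSD.
have KM z z' : K z -> K z' -> K (z * z').
  by move=> hz hz'; rewrite /K rmorphM DM; apply: xSD; apply: xS_mull => //; apply: integral_id.
have Kc (c : k) : K c%:A by rewrite /K -[iota c%:A]/(kscal c) Dk; apply: xS00.
(* Injectivity of D on x S modulo x^4 S puts z in x^4 S, hence in x M, which lies in M^2. *)
have K0 z : K z -> M z -> H z.
  move=> Kz Mz; have [r Mr ->] := xM_of_xS4 (D_inj hchar uX N0 DM DX hD (hmin Mz) Kz).
  by apply: sH; apply: maxsq_mul.
(* [a] and [b] are the coordinates of r along x and y; [dec0] shows that they are unique modulo M,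
   and [decM] that they obey the Leibniz rule, the product of two elements of M being absorbed by
   [H]. *)
pose dec r a b := exists z h, [/\ K z, H h & r = z + h + a * x + b * y].
have dec_ex r : exists ab, dec r ab.1 ab.2.
  have [z Mz Kz] := newton_lift r; have [h [a [b [Hh e]]]] := Hgen _ Mz.
  by exists (a, b), z, h; split=> //=; rewrite -[LHS](subrK z) e; ring.
have HM h : H h -> M h.
  move=> Hh; apply/max_idealP => uh; apply: nHx.
  by rewrite -[x](divrK uh); apply: Hmul.
have decB r a b r' a' b' : dec r a b -> dec r' a' b' -> dec (r - r') (a - a') (b - b').
  move=> [z [h [Kz Hh ->]]] [z' [h' [Kz' Hh' ->]]]; exists (z - z'), (h - h').
  by split; [exact: KB|exact: is_idealB|ring].
have decD r a b r' a' b' : dec r a b -> dec r' a' b' -> dec (r + r') (a + a') (b + b').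
  move=> [z [h [Kz Hh ->]]] [z' [h' [Kz' Hh' ->]]]; exists (z + z'), (h + h').
  by split; [exact: KD|exact: Hadd|ring].
have decM r a b r' a' b' : dec r a b -> dec r' a' b' ->
    dec (r * r') (r * a' + r' * a) (r * b' + r' * b).
  move=> [z [h [Kz Hh er]]] [z' [h' [Kz' Hh' er']]].
  exists (z * z'), (r * h' + r' * h - (r - z) * (r' - z')); split; first exact: KM.
    apply: is_idealB => //; first by apply: Hadd; apply: Hmul.
    apply: sH; apply: maxsq_mul.
      by rewrite er; have -> : z + h + a * x + b * y - z = h + a * x + b * y by [ring];
        apply: (Madd); [apply: (Madd); [exact: HM|exact: Mmul]|exact: Mmul].
    by rewrite er'; have -> : z' + h' + a' * x + b' * y - z' = h' + a' * x + b' * y by [ring];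
      apply: (Madd); [apply: (Madd); [exact: HM|exact: Mmul]|exact: Mmul].
  have -> : h = r - z - a * x - b * y by rewrite er; ring.
  have -> : h' = r' - z' - a' * x - b' * y by rewrite er'; ring.
  by ring.
have dec0 a b : dec 0 a b -> M a /\ M b.
  move=> [z [h [Kz Hh e]]].
  have Hz : H z.
    apply: K0 => //; have -> : z = - 1 * h + (- a) * x + (- b) * y.
      by apply/eqP; rewrite -subr_eq0; apply/eqP; rewrite [RHS]e; ring.
    by apply: (Madd); [apply: (Madd); [apply/Mmul/HM|exact: Mmul]|exact: Mmul].
  have Hzh := Hadd _ _ Hz Hh.
  have Mb : M b.
    apply/max_idealP => ub; apply: nHy; exists (- b^-1 * (z + h)), (- b^-1 * a).
    split; first exact: Hmul.
    rewrite -[LHS](mulKr ub); have -> : b * y = - (z + h) - a * x.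
      by apply/eqP; rewrite -subr_eq0; apply/eqP; rewrite [RHS]e; ring.
    by ring.
  split=> //; apply/max_idealP => ua; apply: nHx.
  have -> : x = - a^-1 * (z + h + b * y); last first.
    by apply: Hmul; apply: (Hadd) => //; apply: sH; apply: maxsq_mul.
  rewrite -[LHS](mulKr ua); have -> : a * x = - (z + h + b * y).
    by apply/eqP; rewrite -subr_eq0; apply/eqP; rewrite [RHS]e; ring.
  by rewrite mulrN mulNr.
have /choice[ab abP] := dec_ex; pose pi := prime_proj (max_ideal_prime Mid).
pose al r := pi (ab r).1; pose be r := pi (ab r).2.
have abE r a b : dec r a b -> al r = pi a /\ be r = pi b.
  move=> hr; have := decB _ _ _ _ _ _ (abP r) hr; rewrite subrr => /dec0[].
  move=> /(prime_proj_eq0 (max_ideal_prime Mid)) + /(prime_proj_eq0 (max_ideal_prime Mid)).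
  rewrite !rmorphB => /eqP + /eqP; rewrite !subr_eq0 => /eqP ea /eqP eb; by split.
have abD r r' : al (r + r') = al r + al r' /\ be (r + r') = be r + be r'.
  by rewrite -!rmorphD; apply/abE/decD.
have abM r r' : al (r * r') = pi r * al r' + pi r' * al r /\
                be (r * r') = pi r * be r' + pi r' * be r.
  by rewrite -!rmorphM -!rmorphD; apply/abE/decM.
have ab_const z : K z -> al z = 0 /\ be z = 0.
  move=> Kz; rewrite -(rmorph0 pi); apply: abE; exists z, 0; split=> //.
  by rewrite !mul0r !addr0.
have ab_small h : H h -> al h = 0 /\ be h = 0.
  move=> Hh; rewrite -(rmorph0 pi); apply: abE; exists 0, h; split=> //.
    by rewrite -(scale0r (1 : R)); apply: Kc.
  by rewrite !mul0r !addr0 add0r.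
have K00 : K 0 by rewrite -(scale0r (1 : R)); apply: Kc.
have [alx bex] : al x = 1 /\ be x = 0.
  rewrite -(rmorph0 pi) -(rmorph1 pi); apply: abE; exists 0, 0.
  by split=> //; rewrite mul0r mul1r !add0r addr0.
have [aly bey] : al y = 0 /\ be y = 1.
  rewrite -(rmorph0 pi) -(rmorph1 pi); apply: abE; exists 0, 0.
  by split=> //; rewrite mul0r mul1r !add0r.
have [i [i' [v [_ _ [r Mr ei'] e]]]] := cube_differential Ss.
have Yx : iota y = X * (iota y / X) by rewrite mulrC divrK.
(* The alternating form satisfies the required Leibniz identity: the terms with the residue of the
   coefficient as a factor cancel in pairs. It is applied to x dy - y dx - di - i' dx, which D sends
   to zero as x D y - y D x = x^2 D c = x^3 s. *)
have := kaehler_pairing hOm (Psi := fun a b => al a * be b - be a * al b).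
move=> /(_ _ _ _ _ [:: (x, y); (- y, x); (- 1, i); (- i', x)]) H1.
have {H1} : al x * be y - be x * al y + (al (- y) * be x - be (- y) * al x +
   (al (- 1) * be i - be (- 1) * al i + (al (- i') * be x - be (- i') * al x))) = 0.
  have := H1; rewrite !big_cons !big_nil /= !addr0; apply.
  - by move=> a a' b; rewrite !(abD _ _).1 !(abD _ _).2; ring.
  - by move=> a b b'; rewrite !(abD _ _).1 !(abD _ _).2; ring.
  - by move=> a b b'; rewrite !(abM _ _).1 !(abM _ _).2; ring.
  - move=> a c b; rewrite -[c *: b]mulr_algl -[c *: a]mulr_algl !(abM _ _).1 !(abM _ _).2.
    by rewrite !(ab_const _ (Kc c)).1 !(ab_const _ (Kc c)).2; ring.
  have := @kaehler_eq0 [:: (x, y); (- y, x); (- 1, i); (- i', x)].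
  rewrite !big_cons !big_nil /= !addr0; apply.
  rewrite !rmorphN rmorph1 DX Yx DM DX ey.
  have -> : D (iota i) = X ^+ 3 * s - iota i' * X by rewrite e; ring.
  by ring.
have KN1 : K (- 1) by rewrite -(scaleN1r (1 : R)); apply: Kc.
rewrite !(ab_const _ KN1).1 !(ab_const _ KN1).2.
have Hi' : H (- i').
  by rewrite ei' -mulNr; apply: sH; apply: maxsq_mul => //; rewrite -mulN1r; apply: Mmul.
rewrite !(ab_small _ Hi').1 !(ab_small _ Hi').2.
have -> : - y = (- 1) * y by rewrite mulN1r.
rewrite !(abM _ _).1 !(abM _ _).2 !(ab_const _ KN1).1 !(ab_const _ KN1).2 alx bex aly bey.
(* Both x dy and - y dx contribute 1, while - di and - i' dx contribute 0, since -1 lies in [K] and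
   i' in M^2. *)
have -> : 1 * 1 - 0 * 0 + ((pi (-1) * 0 + pi y * 0) * 0 - (pi (-1) * 1 + pi y * 0) * 1 +
   (0 * be i - 0 * al i + (0 * 0 - 0 * 1))) = pi (2%:R : R).
  by rewrite rmorphN rmorph1 rmorph_nat; ring.
move=> /(prime_proj_eq0 (max_ideal_prime Mid))/max_idealP; apply.
rewrite -(rmorph_nat (in_alg R)); apply: alg_scalar_unit.
by rewrite ((pcharf0P _).1 hchar).
Qed.

(* Write r = z + x s with z constant modulo x^3 S and t = tau s, so that t is the
   coefficient of x^2 in r.  Then
     Psi (a, y) = 2 t_a D s_y - s_y D t_a - 2 t_y D s_a + s_a D t_y
   satisfies Psi (a, y y') = Psi (a y, y') + Psi (a y', y) modulo x S, and it takes
   the value 2 D c on x^2 dy when y = x c. *)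
Lemma torsion_free_nonresonant y : M y -> xS 1 (D (iota y / X)).
Proof.
move=> My; have [tau [tS tD tX tZ]] := equivariant_splitting hchar uX N0 DM DX Dk hD.
have DS := D_integral uX N0 hD.
have DxS n s : xS n s -> xS n (D s) := @D_xS k R Q iota x hchar uX N N0 D DM DX Dk hD n s.
have S2 : S 2%:R := integral_nat iota 2.
have X1 : xS 1 X by rewrite -[X]mulr1; apply/xS1P/integral1.
have k1 : kscal 1 = 1 by apply: rmorph1.
have D1 : D 1 = 0 by rewrite -k1.
pose c := iota y / X; have Sc : S c by have := hmin My; rewrite /xS expr1.
(* [V s] collects the four quantities entering Psi, and [B] is Psi as an alternating bilinear form
   in them. All of it matters only modulo x S, which [sm] expresses componentwise. *)
pose V s : (Q * Q) * (Q * Q) := ((s, D s), (tau s, D (tau s))).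
pose B (v w : (Q * Q) * (Q * Q)) :=
  2%:R * v.2.1 * w.1.2 - w.1.1 * v.2.2 - 2%:R * w.2.1 * v.1.2 + v.1.1 * w.2.2.
pose sm (v : (Q * Q) * (Q * Q)) := (xS 1 v.1.1 /\ xS 1 v.1.2) /\ (xS 1 v.2.1 /\ xS 1 v.2.2).
pose int (v : (Q * Q) * (Q * Q)) := (S v.1.1 /\ S v.1.2) /\ (S v.2.1 /\ S v.2.2).
have intV s : S s -> int (V s) by move=> Ss; do 2?split=> //=; auto.
have smD v w : sm v -> sm w -> sm (v + w).
  by move=> [[a1 a2] [a3 a4]] [[b1 b2] [b3 b4]]; do 2?split; apply: xSD.
have smB v w : sm v -> sm w -> sm (v - w).
  by move=> [[a1 a2] [a3 a4]] [[b1 b2] [b3 b4]]; do 2?split; apply: xSB.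
have BDl u v w : B (u - v) w = B u w - B v w by rewrite /B /=; ring.
have BDr u v w : B w (u - v) = B w u - B w v by rewrite /B /=; ring.
have Bl v w : sm v -> int w -> xS 1 (B v w).
  move=> [[a1 a2] [a3 a4]] [[b1 b2] [b3 b4]]; rewrite /B.
  apply: xSD; last by rewrite mulrC; apply: xS_mull.
  apply: xSB; last by apply: xS_mull => //; apply: integral_mul.
  by apply: xSB; [rewrite mulrAC; apply: xS_mull => //; apply: integral_mul|apply: xS_mull].
have Br v w : int v -> sm w -> xS 1 (B v w).
  by move=> iv sw; have := xSN (Bl _ _ sw iv); congr (xS 1 _); rewrite /B; ring.
have V0 : sm (V 0).
  have t0 : xS 1 (tau 0) by have := tX 0 (integral0 _); rewrite mulr0 subr0.
  by do 2?split=> //=; rewrite ?raddf0; try exact: xS00; apply: DxS.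
have VD s s' : S s -> S s' -> sm (V (s + s') - V s - V s').
  move=> Ss Ss'; have t1 := tD _ _ Ss Ss'.
  split; split=> //=; rewrite -?raddfB; last exact: DxS.
    by have -> : s + s' - s - s' = 0 by [ring]; apply: xS00.
  by have -> : s + s' - s - s' = 0 by [ring]; rewrite raddf0; apply: xS00.
have VX s : xS 2 s -> sm (V s).
  move=> /(xSP uX)[t St ->]; have SXt : S (X * t) by apply: integral_mul.
  have h1 : xS 1 (X ^+ 2 * t) by rewrite expr2 -mulrA; apply: xS1P.
  have h2 : xS 1 (tau (X ^+ 2 * t)).
    rewrite expr2 -mulrA -[tau _](subrK (X * t)).
    by apply: xSD; [apply: tX|apply: xS1P].
  by split; split=> //=; apply: DxS.
have VE s s' : S s -> S s' -> xS 2 (s - s') -> sm (V s - V s').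
  move=> Ss Ss' h; have := smD _ _ (VD _ _ Ss' (xS_integral uX h)) (VX _ h).
  by rewrite subrK (addrC s') subrK.
(* The data expected for (z + x s)(z' + x s') with z and z' treated as constants; s s' appears
   because tau (x s s') is s s' modulo x S. *)
pose W z s z' s' : (Q * Q) * (Q * Q) := ((z * s' + z' * s, z * D s' + z' * D s),
  (z * tau s' + z' * tau s + s * s',
   z * D (tau s') + z' * D (tau s) + s * D s' + s' * D s)).
have VM z s z' s' : S z -> S s -> S z' -> S s' -> xS 2 (D z) -> xS 2 (D z') ->
    sm (V (z * s' + z' * s + X * (s * s')) - W z s z' s').
  move=> Sz Ss Sz' Ss' Dz Dz'.
  have Szs' := integral_mul Sz Ss'; have Sz's := integral_mul Sz' Ss.
  have Sss' := integral_mul Ss Ss'; have SX' := integral_mul SX Sss'.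
  have Dz1 := xS_leq uX (isT : (1 <= 2)%N) Dz; have Dz'1 := xS_leq uX (isT : (1 <= 2)%N) Dz'.
  have hX := xS1P Sss'.
  have ht : xS 1 (tau (z * s' + z' * s + X * (s * s')) - (z * tau s' + z' * tau s + s * s')).
    have := xSD (xSD (tD _ _ (integral_add Szs' Sz's) SX') (tD _ _ Szs' Sz's))
      (xSD (xSD (tZ _ _ Sz Ss' Dz) (tZ _ _ Sz' Ss Dz')) (tX _ Sss')).
    by congr (xS 1 _); ring.
  split; split=> //=.
  - by rewrite [_ + X * _]addrC addrK.
  - have := xSD (xSD (xS_mull Ss' Dz1) (xS_mull Ss Dz'1)) (xSD (xS1P (DS _ Sss')) (xS_mull Sss' X1)).
    by congr (xS 1 _); rewrite !(raddfD D) !DM DX; ring.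
  - have := xSD (DxS _ _ ht) (xSD (xS_mull (tS _ Ss') Dz1) (xS_mull (tS _ Ss) Dz'1)).
    by congr (xS 1 _); rewrite (raddfB D) !(raddfD D) !DM; ring.
pose Z (a : k) (v : (Q * Q) * (Q * Q)) : (Q * Q) * (Q * Q) :=
  ((kscal a * v.1.1, kscal a * v.1.2), (kscal a * v.2.1, kscal a * v.2.2)).
have Dkscal a s : D (kscal a * s) = kscal a * D s by rewrite DM Dk mulr0 addr0.
have Sk a : S (kscal a) by apply: (integral_id iota).
have VZ a s : S s -> sm (V (kscal a * s) - Z a (V s)).
  move=> Ss; have ht : xS 1 (tau (kscal a * s) - kscal a * tau s).
    by apply: tZ => //; rewrite Dk; apply: xS00.
  split; split=> //=; rewrite ?Dkscal ?subrr; try exact: xS00.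
  by rewrite -Dkscal -raddfB; apply: DxS.
(* The exponent 3 makes s unique modulo x^2 S, which determines both s and tau s modulo x S. *)
pose lift r z s := [/\ S s, S z, xS 3 (D z) & iota r = z + X * s].
have lift_ex r : exists zs, lift r zs.1 zs.2.
  have [z Mz Dz] := newton_lift r; exists (iota z, iota (r - z) / X).
  split=> /=; first by have := hmin Mz; rewrite /xS expr1.
  - exact: integral_id.
  - exact: xS_leq Dz.
  - by rewrite mulrC divrK // rmorphB addrC subrK.
have lift_uniq r z s z' s' : lift r z s -> lift r z' s' -> sm (V s - V s').
  move=> [Ss Sz Dz er] [Ss' Sz' Dz' er']; apply: VE => //; apply/(xSXP uX).
  have e : X * (s - s') = z' - z.
    have -> : X * (s - s') = (z + X * s) - (z' + X * s') + (z' - z) by ring.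
    by rewrite -er -er' subrr add0r.
  apply: (D_inj hchar uX N0 DM DX hD); first by apply/xS1P/integral_sub.
  by rewrite e raddfB; apply: xSB.
have /choice[zs zsP] := lift_ex; pose v r := V (zs r).2.
have iv r : int (v r) by apply: intV; case: (zsP r).
have vE r z s : lift r z s -> sm (v r - V s) by move/(lift_uniq _ _ _ _ _ (zsP r)).
have vD r r' : sm (v (r + r') - v r - v r').
  have [Ss Sz Dz er] := zsP r; have [Ss' Sz' Dz' er'] := zsP r'.
  have h : lift (r + r') ((zs r).1 + (zs r').1) ((zs r).2 + (zs r').2).
    split; [exact: integral_add|exact: integral_add|by rewrite raddfD; exact: xSD|].
    by rewrite rmorphD er er'; ring.
  have := smD _ _ (vE _ _ _ h) (VD _ _ Ss Ss'); congr sm.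
  by rewrite -!addrA; congr (_ + _); rewrite addrA addNr add0r.
pose w r r' := W (zs r).1 (zs r).2 (zs r').1 (zs r').2.
have vM r r' : sm (v (r * r') - w r r').
  have [Ss Sz Dz er] := zsP r; have [Ss' Sz' Dz' er'] := zsP r'.
  have h : lift (r * r') ((zs r).1 * (zs r').1)
      ((zs r).1 * (zs r').2 + (zs r').1 * (zs r).2 + X * ((zs r).2 * (zs r').2)).
    split; [|exact: integral_mul|by rewrite DM; apply: xSD; apply: xS_mull|].
      by do 2?apply: integral_add; apply: integral_mul => //; apply: integral_mul.
    by rewrite rmorphM er er'; ring.
  have := smD _ _ (vE _ _ _ h) (VM _ _ _ _ Sz Ss Sz' Ss' (xS_leq uX (isT : (2 <= 3)%N) Dz)
    (xS_leq uX (isT : (2 <= 3)%N) Dz')).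
  by congr sm; rewrite addrA subrK.
have vZ a r : sm (v (a *: r) - Z a (v r)).
  have [Ss Sz Dz er] := zsP r.
  have h : lift (a *: r) (kscal a * (zs r).1) (kscal a * (zs r).2).
    split; rewrite ?Dkscal; [exact: integral_mul|exact: integral_mul|exact: xS_mull|].
    by rewrite -mulr_algl rmorphM -[iota a%:A]/(kscal a) er; ring.
  by have := smD _ _ (vE _ _ _ h) (VZ a _ Ss); congr sm; rewrite addrA subrK.
(* With y = x c, x^2 D y = x^3 (c + D c); so x^2 dy = d i + i' dx. *)
have [i [i' [u [Su ei' _ e]]]] := cube_differential (integral_add Sc (DS _ Sc)).
have yX : iota y = X * c by rewrite mulrC divrK.
have := @kaehler_pairing_mod k R Om d hOm Q (xS 1) (fun a b => B (v a) (v b)) (xS00 _ _ _)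
  (fun a b => @xSB _ _ _ _ _ _ a b).
move=> /(_ _ _ _ _ [:: (x ^+ 2, y); (- 1, i); (- i', x)]) H1.
have {H1} : xS 1 (B (v (x ^+ 2)) (v y) + (B (v (- 1)) (v i) + B (v (- i')) (v x))).
  have := H1; rewrite !big_cons !big_nil /= !addr0; apply.
  - move=> a a' b; have := Bl _ _ (vD a a') (iv b).
    by congr (xS 1 _); rewrite !BDl; ring.
  - move=> a b b'; have := Br _ _ (iv a) (vD b b').
    by congr (xS 1 _); rewrite !BDr; ring.
  - move=> a b b'; have := xSB (Br _ _ (iv a) (vM b b'))
      (xSD (Bl _ _ (vM a b) (iv b')) (Bl _ _ (vM a b') (iv b))).
    congr (xS 1 _); rewrite !BDl !BDr /w /v.
    move: (V (zs (a * b)).2) (V (zs (a * b')).2) (V (zs (b * b')).2) => v1 v2 v3.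
    by rewrite /B /W /V /=; ring.
  - move=> a b b'; have := xSB (Br _ _ (iv a) (vZ b b')) (Bl _ _ (vZ b a) (iv b')).
    congr (xS 1 _); rewrite BDl BDr.
    by rewrite /B /Z /=; ring.
  have := @kaehler_eq0 [:: (x ^+ 2, y); (- 1, i); (- i', x)].
  rewrite !big_cons !big_nil /= !addr0; apply.
  rewrite rmorphXn !rmorphN rmorph1 DX yX DM DX.
  have -> : D (iota i) = X ^+ 3 * (c + D c) - iota i' * X by rewrite e; ring.
  by ring.
have l1 : lift (- 1) (- 1) 0.
  split; [exact: integral0|exact/integral_opp/integral1| |].
    by rewrite raddfN D1 oppr0; apply: xS00.
  by rewrite mulr0 addr0 rmorphN rmorph1.
have l2 : lift (- i') 0 (- (X ^+ 3 * u)).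
  split; [apply: integral_opp; apply: integral_mul => //; exact: integral_exp|exact: integral0|
    by rewrite raddf0; apply: xS00|].
  by rewrite rmorphN ei'; ring.
have l3 : lift (x ^+ 2) 0 X.
  by split=> //; [exact: integral0|rewrite raddf0; apply: xS00|rewrite rmorphXn add0r].
have l4 : lift y 0 c.
  by split=> //; [exact: integral0|rewrite raddf0; apply: xS00|rewrite add0r].
have s1 : sm (v (- 1)) by have := smD _ _ (vE _ _ _ l1) V0; rewrite subrK.
have s2 : sm (v (- i')).
  have hu : xS 2 (- (X ^+ 3 * u)).
    by apply: xSN; apply: (xS_leq uX (n := 3)) => //; apply: xS_mulX.
  by have := smD _ _ (vE _ _ _ l2) (VX _ hu); rewrite subrK.
(* For x^2 one has s = x and tau s = 1 modulo x S, and B (e3, V c) = 2 D c; the data of -1 and - i'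
   vanish modulo x S. *)
pose e3 : (Q * Q) * (Q * Q) := ((0, 0), (1, 0)).
have s3 : sm (v (x ^+ 2) - e3).
  have ht : xS 1 (tau X - 1) by have := tX 1 (integral1 _); rewrite mulr1.
  have sX : sm (V X - e3).
    split; split=> //=; rewrite ?subr0 ?DX //.
    by have := DxS _ _ ht; rewrite raddfB D1 subr0.
  by have := smD _ _ (vE _ _ _ l3) sX; rewrite addrA subrK.
have ie3 : int e3.
  by split; split=> /=; try exact: integral0; exact: integral1.
move=> H1; have := xSB (xSB (xSB H1 (xSD (Bl _ _ s1 (iv i)) (Bl _ _ s2 (iv x))))
  (Bl _ _ s3 (iv y))) (Br _ _ ie3 (vE _ _ _ l4)).
rewrite BDl BDr addrK opprB addrCA subrr addr0 opprB addrCA subrr addr0 => h.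
have -> : D c = kscal 2%:R^-1 * (2%:R * D c).
  have e2 : kscal 2%:R = 2%:R := rmorph_nat kscal 2.
  by rewrite mulrA -e2 -rmorphM mulVf ?rmorph1 ?mul1r // ((pcharf0P _).1 hchar).
apply: xS_mull => //; move: h; congr (xS 1 _).
by rewrite /B /e3 /V /=; ring.
Qed.

End Kaehler.
End TorsionFree.

(** * Regularity *)

Section Regularity.
Variables (k : fieldType) (A : comAlgType k) (R : comUnitAlgType k).
Variable phi : {rmorphism A -> R}.
Hypothesis hdep : forall u v, exists2 f, f != 0 & ev2 (phi u) (phi v) f = 0.
Hypothesis hfrac : forall r, exists a s, phi s \is a GRing.unit /\ r = phi a / phi s.
Hypothesis Mid : is_ideal (@max_ideal R).
Variable xi : A.
Local Notation x := (phi xi).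
Hypotheses (Mx : max_ideal x) (nzdx : nonzerodivisor x).

(** Take b in P1 outside P0. A relation between x and b, cleared of powers of b modulo P0, has its
    constant term in P1, and this term is a power of x times a unit. *)
Lemma prime_nonmax_zero (P0 P1 : pset R) : is_prime_ideal P0 -> is_prime_ideal P1 ->
  strict_sub P0 P1 -> P1 x.
Proof.
move=> [[[P00 [_ P0mul]] _] P0pr] [[[_ [P1add P1mul]] P11] P1pr] [P01 [u [P1u nP0u]]].
have [b [s [us eu]]] := hfrac u.
have P1b : P1 (phi b) by rewrite -(divrK us (phi b)) -eu mulrC; apply: P1mul.
have nP0b : ~ P0 (phi b) by move=> h; apply: nP0u; rewrite eu mulrC; apply: P0mul.
have [f f0 fb] := hdep xi b; have [a [q [ef q0]]] := poly_split0 f0.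
have pow (P : pset R) y n : (forall a b, P (a * b) -> P a \/ P b) -> ~ P 1 -> P (y ^+ n) -> P y.
  by move=> Ppr P1'; elim: n => [|n IH] //; rewrite exprS => /Ppr[|/IH].
have P0q : P0 (ev2 x (phi b) q).
  have := fb; rewrite ef /ev2 rmorphM rmorphXn polyevX => e.
  have [] := P0pr (polyev (ev1 x) (phi b) q) (phi b ^+ a) => //.
    by rewrite e.
  by move=> /pow h; case: nP0b; apply: h => // h1; apply: nP0u; rewrite -[u]mulr1; apply: P0mul.
have P1h : P1 (ev1 x q`_0).
  have : P1 (ev2 x (phi b) q) := P01 _ P0q.
  elim/poly_ind: q {ef P0q} q0 => [|q c _]; first by rewrite coef0 eqxx.
  rewrite coefD coefMX coefC /= add0r => _.
  rewrite /ev2 rmorphD rmorphM polyevX polyevC => h.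
  have -> : ev1 x c = polyev (ev1 x) (phi b) q * phi b + ev1 x c +
    (- polyev (ev1 x) (phi b) q) * phi b by ring.
  by apply: P1add => //; apply: P1mul.
have [n [w [uw e]]] := ev1_split Mid Mx q0.
by apply: (pow _ _ n P1pr P11); rewrite -(mulrK uw (x ^+ n)) -e mulrC; apply: P1mul.
Qed.

(** The dimension is one: a prime avoiding the powers of x lies strictly below M, and in a chain of
    three primes the middle one would contain x, hence M. *)
Lemma regular_of_principal : (forall y, max_ideal y -> exists r, y = x * r) ->
  regular_local R.
Proof.
move=> hprin; have Mpr := max_ideal_prime Mid; exists 1%N; split; last first.
  exists (fun=> x) => y; split=> [/hprin[r ->]|[c ->]].
    by exists (fun=> r); rewrite big_ord_recl big_ord0 addr0 mulrC.
  by rewrite big_ord_recl big_ord0 addr0; have [_ [_]] := Mid; apply.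
have Psub (P : pset R) : is_prime_ideal P -> forall a, P a -> max_ideal a.
  move=> [[[_ [_ Pmul]] P1] _] a Pa; apply/max_idealP => ua; apply: P1.
  by rewrite -(mulVr ua); apply: Pmul.
split=> [|[c [cpr cstr]]].
  have [||||P [Ppr _ PT]] := @prime_avoiding R (fun a => a = 0) (fun a => exists n, a = x ^+ n).
  - by split=> //; split=> [a b -> ->|r a ->]; rewrite ?addr0 ?mulr0.
  - by exists 0%N.
  - by move=> a b [n ->] [n' ->]; exists (n + n')%N; rewrite exprD.
  - move=> a -> [n]; elim: n => [|n IH]; first by move/eqP; rewrite eq_sym oner_eq0.
    by rewrite exprS => /esym/nzdx/esym.
  exists (fun i => if i == 0%N then P else @max_ideal R); split=> [[|i] _|[|i] //= _] //.
  split; first exact: Psub.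
  by exists x; split=> // Px; apply: (PT x Px); exists 1%N.
have P1x := prime_nonmax_zero (cpr 0%N isT) (cpr 1%N isT) (cstr 0%N isT).
have [_ [y [P2y nP1y]]] := cstr 1%N isT; apply: nP1y.
have [r ->] := hprin y (Psub _ (cpr 2%N isT) y P2y).
by rewrite mulrC; case: (cpr 1%N isT) => -[[_ [_ h]] _] _; apply: h.
Qed.

End Regularity.

(* k field of char 0; A reduced f.g. k-algebra of pure dimension one;
   (R, M) = A localized at the maximal ideal m; Q = total ring of fractions
   of R, the normalization S = elements of Q integral over R;
   (Om, d) = Omega_{R/k}. *)
Theorem theorem2p13 (k : fieldType) (hchar : [pchar k] =i pred0)
  (A : comAlgType k) (hfg : fin_gen_alg A) (hred : reduced A)
  (hpure : pure_dim_one A)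
  (m : pset A) (hm : is_maximal_ideal m)
  (R : comUnitAlgType k) (phi : A -> R) (hloc : is_localization_at m phi)
  (Q : comUnitRingType) (iota : R -> Q) (hQ : is_total_fractions iota)
  (hcond : cube_conductor iota (@max_ideal R))
  (Om : lmodType R) (d : R -> Om) (hOm : is_kaehler d)
  (hnreg : ~ regular_local R) :
  torsion_nonzero Om.
Proof.
have [xi [mxi nzdx hmin]] := loc_minimal_reduction hchar hfg hred hpure hm hloc hQ.
pose phi' := loc_morph hloc; pose iota' := frac_morph hQ.
have Mid := loc_max_ideal hm hloc.
have Mx : max_ideal (phi' xi) by apply/(loc_max hm hloc).
have phiZ (c : k) a : phi' (c *: a) = c *: phi' a by have [[_ [_ [_ h]]] _] := hloc; apply: h.
have hdep u v := loc_dependent hchar hfg hpure hloc u v.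
have hfrac r : exists a s, phi' s \is a GRing.unit /\ r = phi' a / phi' s.
  have [a [s [nms e]]] := loc_frac hloc r; exists a, s; split=> //.
  exact: (loc_unit hloc nms).
have Rred := loc_reduced hred hm hloc.
have hnzd r : nonzerodivisor r -> iota' r \is a GRing.unit := frac_unit hQ (r := r).
have [_ [_ [_ [_ [hfracQ hinj]]]]] := hQ.
have iota_inj r : iota' r = 0 -> r = 0 := hinj r.
pose X := iota' (phi' xi); have uX : X \is a GRing.unit by apply: hnzd.
have hcube s : integralOver iota' s -> exists r, X ^+ 3 * s = iota' r.
  move=> /integral_overP Ss; have [r e] := hcond _ _ _ _ Mx Mx Mx Ss.
  by exists r; rewrite -[iota' r]e -[iota]/(iota' : R -> Q) !rmorphM /X; ring.
have [N [D [N0 DM DX Dk hD]]] := log_derivation hchar hfg phiZ hdep hfrac Rred Mid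
  hnzd hfracQ iota_inj Mx nzdx hcube.
have hres u := @fraction_residue k A R phi' Q iota' hfg phiZ hdep hfrac hnzd hfracQ xi nzdx u.
have hrel := fraction_separable_relation hchar hfg phiZ hdep hfrac Rred Mid
  hnzd hfracQ iota_inj Mx nzdx.
have hminX y : max_ideal y -> xS iota' (phi' xi) 1 (iota' y).
  by move=> My; rewrite /xS expr1; apply: hmin.
apply: contrapT => ntor.
have htf (w : Om) r : nonzerodivisor r -> r *: w = 0 -> w = 0.
  by move=> nr rw; apply: contrapT => w0; apply: ntor; exists w; split=> //; exists r.
apply: hnreg; apply: (@regular_of_principal k A R phi' hdep hfrac Mid xi Mx nzdx).
apply: (@max_principal k R Q iota' (phi' xi) Mid Mx iota_inj uX hcube hminX) => y My; apply: contrapT => ny.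
apply: (@torsion_free_resonant k R Q iota' (phi' xi) hchar Mid Mx iota_inj uX N N0 D DM DX Dk hD hres hcube hminX Om d hOm
  hrel htf y My ny).
exact: (@torsion_free_nonresonant k R Q iota' (phi' xi) hchar Mid Mx iota_inj uX N N0 D DM DX Dk hD hres hcube hminX Om d hOm
  hrel htf y My).
Qed.
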